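(* Let $n\in\mathbb N$. There exist indecomposable $F\mathfrak S_n$-modules $Y(\lambda|p\mu)$, one for each pair of partitions $(\lambda,\mu)$ with $|\lambda|+p|\mu|=n$, with the following properties: (i) for every $(\alpha|\beta)\in\mathscr P^2(n)$, the module $M(\alpha|\beta)$ is isomorphic to a direct sum of modules $Y(\lambda|p\mu)$ with $(\lambda|p\mu)\trianglerighteq(\alpha|\beta)$; (ii) $[M(\lambda|p\mu):Y(\lambda|p\mu)]=1$; (iii) if $\lambda=\sum_{i=0}^r p^i\lambda(i)$ and $\mu=\sum_{i=0}^{r-1}p^i\mu(i)$ are the $p$-adic expansions, then $Y(\lambda|p\mu)$ has as a vertex a Sylow $p$-subgroup of the Young subgroup $\mathfrak S_\rho$, where $\rho$ is the partition of $n$ having exactly $|\lambda(i)|+|\mu(i-1)|$ parts equal to $p^i$ for each $i\in\{0,\dots,r\}$ (with $\mu(-1)=\varnothing$).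
   Context: $F$ is a field of odd prime characteristic $p$; $\mathfrak S_n$ is the symmetric group on $\{1,\dots,n\}$. A composition of $n$ is a finite sequence $\alpha=(\alpha_1,\dots,\alpha_r)$ of non-negative integers with $\alpha_r\ne0$ and $\sum_i\alpha_i=n$ ($\varnothing$ is the unique composition of $0$); a partition is a non-increasing composition; by convention $\alpha_i=0$ for $i>r$. For a partition $\mu$, $p\mu=(p\mu_1,p\mu_2,\dots)$. $\mathscr P^2(n)$ is the set of pairs $(\alpha|\beta)$ of partitions with $|\alpha|+|\beta|=n$. The Young subgroup of a composition $\alpha$ is $\mathfrak S_\alpha=\mathfrak S_{\alpha_1}\times\cdots\times\mathfrak S_{\alpha_r}$, the $i$-th factor acting on $\{\alpha_1+\dots+\alpha_{i-1}+1,\dots,\alpha_1+\dots+\alpha_i\}$. For $(\alpha|\beta)$ a pair of compositions with $|\alpha|+|\beta|=n$, the signed Young permutation module is $M(\alpha|\beta)=\mathrm{Ind}_{\mathfrak S_\alpha\times\mathfrak S_\beta}^{\mathfrak S_n}(F\boxtimes\mathrm{sgn})$, where $\mathfrak S_\alpha$ permutes $\{1,\dots,|\alpha|\}$ and acts trivially, and $\mathfrak S_\beta$ permutes $\{|\alpha|+1,\dots,n\}$ (as a Young subgroup of that set) and acts by the sign character. For an indecomposable module $N$, $[M:N]$ denotes the number of summands isomorphic to $N$ in a Krull–Schmidt decomposition of $M$. Dominance order on $\mathscr P^2(n)$: $(\lambda|\nu)\trianglerighteq(\alpha|\beta)$ iff for all $k\ge1$, $\sum_{i=1}^k\lambda_i\ge\sum_{i=1}^k\alpha_i$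 and $|\lambda|+\sum_{i=1}^k\nu_i\ge|\alpha|+\sum_{i=1}^k\beta_i$. A partition is $p$-restricted if $\lambda_i-\lambda_{i+1}<p$ for all $i$; every partition $\lambda$ has a unique $p$-adic expansion $\lambda=\sum_{i\ge0}p^i\lambda(i)$ (componentwise sum) with each $\lambda(i)$ a $p$-restricted partition. *)

(* Defs.v *)
From HB Require Import structures.
From mathcomp Require Import all_boot all_order all_algebra all_fingroup all_solvable.
From mathcomp Require Import mxrepresentation.

Set Implicit Arguments.
Unset Strict Implicit.
Unset Printing Implicit Defensive.

Import GRing.Theory.
Local Open Scope ring_scope.

Definition is_partition (s : seq nat) : bool :=
  sorted geq s && all (fun x => 0 < x)%N s.

Definition psize (s : seq nat) : nat := sumn s.

Definition pscale (p : nat) (s : seq nat) : seq nat := map (muln p) s.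

Definition p_restricted (p : nat) (s : seq nat) : Prop :=
  forall j : nat, (nth 0 s j - nth 0 s j.+1 < p)%N.

Definition dominates2 (lam nu al be : seq nat) : Prop :=
  forall k : nat, (1 <= k)%N ->
    (sumn (take k al) <= sumn (take k lam))%N /\
    (sumn al + sumn (take k be) <= sumn lam + sumn (take k nu))%N.

(* index of the block of the composition gam containing position i (0-based) *)
Definition yblock (gam : seq nat) (i : nat) : nat :=
  count (fun k => sumn (take k.+1 gam) <= i)%N (iota 0 (size gam)).

Definition young (n : nat) (gam : seq nat) : {set 'S_n} :=
  [set s : 'S_n | [forall i : 'I_n, yblock gam (s i) == yblock gam i]].

(* sign of the restriction of s to the positions {a, ..., n-1}, computed as the
   parity of the number of inversions of s among those positions (meaningful for
   permutations stabilising that set, e.g. elements of a Young subgroup S_(al++be)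
   with a = |al|). *)
Definition sgn_tail (F : fieldType) (n a : nat) (s : 'S_n) : F :=
  (-1) ^+ #|[set ij : 'I_n * 'I_n |
              [&& (a <= ij.1)%N, (ij.1 < ij.2)%N & (s ij.2 < s ij.1)%N]]|.

Definition Sgroup (n : nat) : {group 'S_n} := [set: 'S_n]%G.

Record fmod (F : fieldType) (n : nat) := FMod {
  fdim : nat;
  frepr : mx_representation F (Sgroup n) fdim
}.

(* Signed Young permutation module M(al|be) = Ind_{S_al x S_be}^{S_n} (F boxtimes sgn),
   realised as the cyclic submodule e * FS_n of the (right) regular module, where
   e = sum_{h in S_al x S_be} chi(h) h.  (The right cosets of H give the basis
   e*g, so this is the induced module.) *)
Definition sy_gen (F : fieldType) (n : nat) (al be : seq nat) : 'rV[F]_#|Sgroup n| :=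
  \sum_(h in young n (al ++ be))
     sgn_tail F (sumn al) h *: delta_mx 0 (gring_index (Sgroup n) h).

Definition signed_young_module (F : fieldType) (n : nat) (al be : seq nat) : fmod F n :=
  @FMod F n _ (submod_repr (cyclic_mx_module (regular_repr F (Sgroup n)) (@sy_gen F n al be))).

Definition indecomposable (F : fieldType) (n : nat) (M : fmod F n) : Prop :=
  (0 < fdim M)%N /\
  forall U V : 'M[F]_(fdim M),
    mxmodule (frepr M) U -> mxmodule (frepr M) V ->
    mxdirect (U + V) -> (U + V :=: 1%:M)%MS ->
    (U == 0) || (V == 0).

Definition fmod_iso (F : fieldType) (n : nat) (M N : fmod F n) : Prop :=
  mx_rsim (frepr M) (frepr N).

Definition direct_decomp (F : fieldType) (n : nat) (M : fmod F n) (k : nat)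
    (U : 'I_k -> 'M[F]_(fdim M)) : Prop :=
  (forall i, mxmodule (frepr M) (U i)) /\
  mxdirect (\sum_(i < k) U i) /\ ((\sum_(i < k) U i)%MS :=: 1%:M)%MS.

Definition summand (F : fieldType) (n : nat) (M : fmod F n) (W : 'M[F]_(fdim M))
   (modW : mxmodule (frepr M) W) : fmod F n :=
  @FMod F n _ (submod_repr modW).

(* [M : N] = 1 : in a (every) decomposition of M into indecomposable summands,
   exactly one summand is isomorphic to N (well defined by Krull--Schmidt). *)
Definition multiplicity_one (F : fieldType) (n : nat) (M N : fmod F n) : Prop :=
  forall (k : nat) (U : 'I_k -> 'M[F]_(fdim M)) (modU : forall i, mxmodule (frepr M) (U i)),
    direct_decomp U ->
    (forall i, indecomposable (summand (modU i))) ->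
    exists i, fmod_iso (summand (modU i)) N /\
      (forall j, fmod_iso (summand (modU j)) N -> j = i).

(* M is relatively Q-projective (Higman's criterion): the identity of M is the
   relative trace Tr_Q^G of some FQ-endomorphism phi of M. *)
Definition rel_projective (F : fieldType) (n : nat) (M : fmod F n) (Q : {group 'S_n}) : Prop :=
  exists phi : 'M[F]_(fdim M),
    (forall x, x \in Q -> frepr M x *m phi = phi *m frepr M x) /\
    \sum_(C in rcosets Q (Sgroup n))
        (frepr M ((repr C)^-1)%g *m phi *m frepr M (repr C)) = 1%:M.

Definition is_vertex (F : fieldType) (n : nat) (M : fmod F n) (Q : {group 'S_n}) : Prop :=
  rel_projective M Q /\
  forall R : {group 'S_n}, R \proper Q -> ~ rel_projective M R.

Definition rho_of (p r : nat) (ls ms : seq (seq nat)) : seq nat :=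
  flatten [seq nseq (sumn (nth [::] ls i) + (if i is i'.+1 then sumn (nth [::] ms i') else 0))
                    (p ^ i)%N
          | i <- rev (iota 0 r.+1)].

(* Main.v *)
(** Let T be the n-th tensor power of a superspace with n+1 even and n+1 odd
    basis vectors ("colors"): it has a basis of colorings of the n points, on
    which S_n acts with signs, and its weight spaces are the signed Young
    permutation modules.  Write w' > w for strict dominance of weights and
    E_w for the endomorphism ring of the weight space of w.

    1. E_w is spanned by the identity and the endomorphisms that factor through
    weights w' > w ("higher" ones): the orbit sum of a pair (u, v) of colorings
    is the leading term of the product of the orbit sums of (u, min(u, v)) and
    (min(u, v), v).

    2. If w is not of the form (lam|p mu), the weight space of w is a summand of
    one of higher weight: exchange two colors, or move a point from an odd color
    used m times, p not dividing m, to an unused even color; the way back and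
    forth is multiplication by m.

    3. For w = (lam|p mu), choose expansions lam = sum p^i lam(i) and
    mu = sum p^i mu(i), and cut the points into blocks of size p^i indexed by
    the boxes of lam(i) and mu(i-1).  Let u be the coloring of a block by its
    row, P a Sylow p-subgroup of the Young subgroup of the blocks, and kappa the
    antisymmetrizer of the permutations of the blocks inside the columns.  Then
    phi(X) = (X kappa)_{u,u} is a linear form on E_w with phi(1) = 1.  Modulo p
    only the P-fixed colorings, that is the ones constant on blocks,
    contribute to phi(X Y), and on those kappa forces the weight to be at most
    w; so phi kills the higher endomorphisms, and by 1 these are its kernel.
    For the same reason phi kills the relative traces from groups smaller
    than P.

    4. Y(lam|p mu) is the indecomposable summand of the weight space of w whose
    idempotent is not killed by phi.  Parts (i) and (ii) follow from 1-3 and the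
    fact that E_Y is local.  The vertex is at least P by 3.  If all lam(i) and
    mu(i) are p-restricted, let v be the coloring obtained from u by reversing
    all columns; P is then a Sylow subgroup of the stabilizer S of (u, v), and phi
    takes the value +-|S : P| on the relative trace from P of the matrix unit at
    (u, v), so that Y is P-projective. *)
Require Import Defs.
From HB Require Import structures.
From mathcomp Require Import all_boot all_order all_algebra all_fingroup all_solvable.
From mathcomp Require Import mxrepresentation.
From mathcomp Require Import zify ring.
From Stdlib Require Import Classical_Prop IndefiniteDescription.

Set Implicit Arguments.
Unset Strict Implicit.
Unset Printing Implicit Defensive.

(** * Modules: Fitting's lemma and decompositions *)

Section ModuleTheory.
Import GRing.Theory.
Local Open Scope ring_scope.
Variables (F : fieldType) (gT : finGroupType) (G : {group gT}).

(** Vectors are rows, so [A] is a homomorphism from [rM] to [rN] acting on the right, and matrix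
    products compose maps from left to right. *)
Definition intertwines m n (rM : mx_representation F G m)
    (rN : mx_representation F G n) (A : 'M_(m, n)) :=
  forall g, g \in G -> rM g *m A = A *m rN g.

Definition indec m (rM : mx_representation F G m) :=
  (0 < m)%N /\ forall e : 'M_m, intertwines rM rM e -> e *m e = e -> e = 0 \/ e = 1%:M.

Section Intertwiners.
Variables (m n k : nat).
Variables (rM : mx_representation F G m) (rN : mx_representation F G n).
Variable (rK : mx_representation F G k).

Lemma intertwines0 : intertwines rM rN 0.
Proof. by move=> g _; rewrite mulmx0 mul0mx. Qed.

Lemma intertwines1 : intertwines rM rM 1%:M.
Proof. by move=> g _; rewrite mulmx1 mul1mx. Qed.

Lemma intertwinesD A B :
  intertwines rM rN A -> intertwines rM rN B -> intertwines rM rN (A + B).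
Proof. by move=> hA hB g Gg; rewrite mulmxDr mulmxDl hA ?hB. Qed.

Lemma intertwinesZ a A : intertwines rM rN A -> intertwines rM rN (a *: A).
Proof. by move=> hA g Gg; rewrite -scalemxAr -scalemxAl hA. Qed.

Lemma intertwinesB A B :
  intertwines rM rN A -> intertwines rM rN B -> intertwines rM rN (A - B).
Proof.
by move=> hA hB; rewrite -scaleN1r; apply: intertwinesD (intertwinesZ _ hB).
Qed.

Lemma intertwinesM A B :
  intertwines rM rN A -> intertwines rN rK B -> intertwines rM rK (A *m B).
Proof. by move=> hA hB g Gg; rewrite mulmxA hA // -mulmxA hB // mulmxA. Qed.

End Intertwiners.

Lemma intertwinesV m (rM : mx_representation F G m) A :
  intertwines rM rM A -> intertwines rM rM (invmx A).
Proof.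
move=> hA g Gg; have [uA|nuA] := boolP (A \in unitmx); last first.
  by rewrite /invmx (negbTE nuA); apply: hA.
apply: (can_inj (mulKmx uA)); apply: (can_inj (mulmxK uA)).
by rewrite !mulmxA mulmxV // mul1mx -hA // mulmxKV.
Qed.

Lemma intertwinesX m (rM : mx_representation F G m) A j :
  intertwines rM rM A -> intertwines rM rM (A ^+ j).
Proof.
move=> hA; elim: j => [|j IH]; first exact: intertwines1.
by rewrite exprS; apply: intertwinesM IH.
Qed.

Lemma proj_intertwines m (rM : mx_representation F G m) (U V : 'M_m) :
    mxmodule rM U -> mxmodule rM V -> (U :&: V)%MS = 0 -> (1%:M <= U + V)%MS ->
  intertwines rM rM (proj_mx U V).
Proof.
move=> mU mV dUV sUV g Gg.
rewrite -[rM g in LHS]mul1mx -(add_proj_mx dUV sUV).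
rewrite !mul1mx !mulmxDl -[RHS]addr0; congr (_ + _).
  by rewrite proj_mx_id ?mxmodule_trans ?proj_mx_sub //; rewrite -[proj_mx U V]mul1mx proj_mx_sub.
by rewrite proj_mx_0 ?mxmodule_trans //; rewrite -[proj_mx V U]mul1mx proj_mx_sub.
Qed.

(** Fitting's lemma: a power of [X] of least rank has complementary image and kernel, and the
    projection onto the image is an idempotent endomorphism, hence 0 or 1. *)
Lemma indec_unit_or_nilpotent m (rM : mx_representation F G m) X :
  indec rM -> intertwines rM rM X -> X \in unitmx \/ exists j, X ^+ j = 0.
Proof.
case=> m0 ind hX.
have [j jmin] : exists j, forall i, (\rank (X ^+ j) <= \rank (X ^+ i))%N.
  have H : forall r j, (\rank (X ^+ j) <= r)%N ->
      exists j, forall i, (\rank (X ^+ j) <= \rank (X ^+ i))%N.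
    elim=> [|r IH] j hj; first by exists j => i; rewrite (leq_trans hj).
    have [|h] := classic (exists i, (\rank (X ^+ i) < \rank (X ^+ j))%N).
      by case=> i hi; apply: (IH i); rewrite -ltnS (leq_trans hi).
    by exists j => i; rewrite leqNgt; apply/negP => hi; apply: h; exists i.
  exact: (H _ 0%N (leqnn _)).
(* The exponent is positive, so that invertibility of [Z] passes to [X] even when [j] is 0. *)
pose Z := X ^+ j.+1.
have hZ : intertwines rM rM Z by apply: intertwinesX.
have rZ : \rank (Z *m Z) = \rank Z.
  apply/eqP; rewrite eqn_leq mxrankM_maxl /= -[Z *m Z]exprD.
  by apply: leq_trans (jmin _); rewrite /Z exprSr; apply: mxrankM_maxl.
have kZ : (kermx (Z *m Z) <= kermx Z)%MS.
  have s : (kermx Z <= kermx (Z *m Z))%MS.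
    by apply/sub_kermxP; rewrite mulmxA mulmx_ker mul0mx.
  by have := mxrank_leqif_sup s; rewrite !mxrank_ker rZ => -[_ <-].
have mU : mxmodule rM Z by apply/mxmoduleP => g Gg; rewrite -hZ // submxMl.
have mV : mxmodule rM (kermx Z).
  by apply/mxmoduleP => g Gg; apply/sub_kermxP; rewrite -mulmxA hZ // mulmxA mulmx_ker mul0mx.
have dUV : (Z :&: kermx Z)%MS = 0.
  apply/eqP/rowV0P => v; rewrite sub_capmx => /andP[/submxP[u ->] /sub_kermxP h].
  apply/sub_kermxP; apply: submx_trans kZ; apply/sub_kermxP.
  by rewrite mulmxA.
have sUV : (1%:M <= Z + kermx Z)%MS.
  rewrite sub1mx /row_full; have := mxrank_disjoint_sum dUV => ->.
  by rewrite mxrank_ker subnKC // rank_leq_row.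
have hP := proj_intertwines mU mV dUV sUV.
have [] := ind _ hP (proj_mx_proj dUV) => [P0|P1].
  by right; exists j.+1; have := proj_mx_id dUV (submx_refl Z); rewrite P0 mulmx0 => /esym.
left; have k0 : kermx Z = 0.
  by have := proj_mx_0 dUV (submx_refl (kermx Z)); rewrite P1 mulmx1.
have : Z \in unitmx by rewrite -row_free_unit -kermx_eq0 k0.
by rewrite /Z exprS unitmx_mul => /andP[].
Qed.

(** The endomorphism ring is local: after division by [X + Y] the two terms sum to 1, and if the
    first is nilpotent the geometric series inverts the second. *)
Lemma indec_unit_sum m (rM : mx_representation F G m) X Y :
    indec rM -> intertwines rM rM X -> intertwines rM rM Y ->
  X + Y \in unitmx -> X \in unitmx \/ Y \in unitmx.
Proof.
move=> iM hX hY u; pose W := invmx (X + Y).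
have hW : intertwines rM rM W by apply/intertwinesV/intertwinesD.
have uW : W \in unitmx by rewrite unitmx_inv.
have hWX := intertwinesM hW hX.
have [uX|[j j0]] := indec_unit_or_nilpotent iM hWX.
  by left; move: uX; rewrite unitmx_mul => /andP[].
have e : W *m Y = 1 - W *m X.
  by apply/eqP; rewrite eq_sym subr_eq addrC -mulmxDr mulVmx.
right; suff: W *m Y \in unitmx by rewrite unitmx_mul => /andP[].
have := subrX1 (W *m X) j; rewrite j0 sub0r -opprB mulNr => /oppr_inj.
by rewrite -e => /esym/mulmx1_unit[].
Qed.

(** Exhibits [rZ] as a direct summand of [rM] with inclusion [A] and projection [B]; the idempotent
    of the summand is [B *m A]. *)
Definition retract m n (rZ : mx_representation F G m) (rM : mx_representation F G n)
    (A : 'M_(m, n)) (B : 'M_(n, m)) :=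
  [/\ intertwines rZ rM A, intertwines rM rZ B & A *m B = 1%:M].

Lemma retract_rsim m n (rZ : mx_representation F G m) (rM : mx_representation F G n) A B :
  (0 < m)%N -> indec rM -> retract rZ rM A B -> mx_rsim rZ rM.
Proof.
move=> m0 [n0 iM] [hA hB AB].
have [BA0|BA1] : B *m A = 0 \/ B *m A = 1%:M.
- by apply: iM; [apply: intertwinesM hB hA | rewrite mulmxA -(mulmxA B) AB mulmx1].
- have : A *m B *m A *m B = 0 by rewrite -(mulmxA A) BA0 mulmx0 mul0mx.
  rewrite AB mul1mx AB => /(congr1 mxrank) /eqP; rewrite mxrank1 mxrank0.
  by rewrite eqn0Ngt m0.
have emn : m = n.
  apply/eqP; rewrite eqn_leq -{1}(mxrank1 F m) -{2}(mxrank1 F n) -AB -BA1.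
  by rewrite !mulmx_max_rank.
by exists A => //; apply/row_freeP; exists B.
Qed.


Definition primitive m (rM : mx_representation F G m) (e : 'M_m) :=
  [/\ intertwines rM rM e, e *m e = e, e != 0
    & forall f, intertwines rM rM f -> f *m f = f -> e *m f = f -> f *m e = f ->
        f = 0 \/ f = e].

(** Induction on the rank of [e]: if [e] is not primitive, it splits into orthogonal idempotents [f]
    and [e - f] of smaller rank. *)
Lemma primitive_decomposition m (rM : mx_representation F G m) (e : 'M_m) :
    intertwines rM rM e -> e *m e = e ->
  exists s : seq 'M_m,
    [/\ forall x, x \in s -> primitive rM x /\ e *m x = x /\ x *m e = x,
        pairwise (fun x y => (x *m y == 0) && (y *m x == 0)) s
      & \sum_(x <- s) x = e].
Proof.
move: {2}(\rank e) (leqnn (\rank e)) => r; elim: r e => [|r IH] e re he ee.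
  exists [::]; split => //; rewrite big_nil; apply/esym/eqP.
  by rewrite -mxrank_eq0 -leqn0.
have [e0|nz] := eqVneq e 0; first by exists [::]; split => //; rewrite big_nil e0.
have [pe|npe] := classic (primitive rM e).
  exists [:: e]; split => //; last by rewrite big_seq1.
  by move=> x; rewrite inE => /eqP->.
have [f [hf ff ef fe [f0 fne]]] : exists f,
    [/\ intertwines rM rM f, f *m f = f, e *m f = f, f *m e = f & f <> 0 /\ f <> e].
  apply: NNPP => h; apply: npe; split => // f hf ff ef fe.
  have [->|f0] := eqVneq f 0; first by left.
  right; apply/eqP; apply: contraT => /eqP fne; case: h; exists f; split => //.
  by split => //; apply/eqP.
have rank_lt x : intertwines rM rM x -> x *m x = x -> e *m x = x -> x *m e = x ->
    x <> e -> (\rank x <= r)%N.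
  move=> _ xx ex xe xne; rewrite -ltnS; apply: leq_trans re.
  rewrite ltn_neqAle -{2}xe mxrankM_maxr andbT; apply/eqP => h; apply: xne.
  have : (e <= x)%MS.
    have s : (x <= e)%MS by rewrite -xe submxMl.
    by have [_ <-] := mxrank_leqif_sup s; rewrite h.
  by case/submxP => u eu; rewrite -ex eu -mulmxA xx.
have ef' : e *m (e - f) = e - f by rewrite mulmxBr ee ef.
have fe' : (e - f) *m e = e - f by rewrite mulmxBl ee fe.
have ff0 : f *m (e - f) = 0 by rewrite mulmxBr fe ff subrr.
have ff1 : (e - f) *m f = 0 by rewrite mulmxBl ef ff subrr.
have ff' : (e - f) *m (e - f) = e - f by rewrite mulmxBr fe' ff1 subr0.
have hf' : intertwines rM rM (e - f) by apply: intertwinesB.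
have ne' : e - f <> e by move/eqP; rewrite subr_eq addrC -subr_eq subrr eq_sym => /eqP.
have [s [s1 s2 s3]] := IH f (rank_lt f hf ff ef fe fne) hf ff.
have [t [t1 t2 t3]] := IH (e - f) (rank_lt _ hf' ff' ef' fe' ne') hf' ff'.
exists (s ++ t); split; last by rewrite big_cat /= s3 t3 addrC subrK.
  move=> x; rewrite mem_cat => /orP[/s1[px [h1 h2]]|/t1[px [h1 h2]]].
    by do 2!split=> //; [rewrite -h1 mulmxA ef | rewrite -h2 -mulmxA fe].
  by do 2!split=> //; [rewrite -h1 mulmxA ef' | rewrite -h2 -mulmxA fe'].
rewrite pairwise_cat s2 t2 !andbT; apply/allrelP => x y /s1[_ [h1 h2]] /t1[_ [h3 h4]].
apply/andP; split.
  by rewrite -h2 -h3 mulmxA -(mulmxA x) ff0 mulmx0 mul0mx.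
by rewrite -h1 -h4 mulmxA -(mulmxA y) ff1 mulmx0 mul0mx.
Qed.

Lemma retract_submod m (rM : mx_representation F G m) (e W : 'M_m)
    (modW : mxmodule rM W) :
    intertwines rM rM e -> e *m e = e -> (W :=: e)%MS ->
  retract (submod_repr modW) rM (val_submod 1%:M) (in_submod W e) /\
  in_submod W e *m val_submod (1%:M : 'M_(\rank W)) = e.
Proof.
move=> he ee We.
have eW : (e <= W)%MS by rewrite We.
split; last by rewrite -val_submodE in_submodK.
split=> [g Gg|g Gg|].
- by rewrite -val_submodE -[RHS](val_submodJ modW) ?mul1mx.
- apply: val_submod_inj; rewrite (val_submodJ modW) // in_submodK //.
  by rewrite val_submodE -mulmxA -val_submodE in_submodK // he.
- rewrite [in_submod W e]in_submodE mulmxA -in_submodE.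
  have /submxP[u eu] : (val_submod (1%:M : 'M_(\rank W)) <= e)%MS by rewrite -We val_submodP.
  by rewrite eu -mulmxA ee -eu val_submodK.
Qed.

(** Sending [f] to [B *m f *m A] carries idempotents of [rZ] to idempotents below [B *m A], and [A]
    and [B] bring them back. *)
Lemma primitive_indec m n (rZ : mx_representation F G m) (rM : mx_representation F G n) A B :
  retract rZ rM A B -> primitive rM (B *m A) -> indec rZ.
Proof.
case=> hA hB AB [_ _ nz prim]; split.
  rewrite lt0n; apply: contra nz => /eqP m0.
  by rewrite -mxrank_eq0 -leqn0 -m0 (leq_trans (mxrankM_maxr _ _)) ?rank_leq_row.
have BAA : B *m A *m B = B by rewrite -mulmxA AB mulmx1.
have ABA : A *m (B *m A) = A by rewrite mulmxA AB mul1mx.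
move=> f hf ff; case: (prim (B *m f *m A)).
- by apply: intertwinesM hA; apply: intertwinesM hB hf.
- by rewrite !mulmxA -(mulmxA _ A) AB mulmx1 -(mulmxA B f) ff.
- by rewrite !mulmxA BAA.
- by rewrite -!mulmxA ABA.
- move=> /(congr1 (fun X => A *m X *m B)).
  rewrite mulmx0 mul0mx !mulmxA AB mul1mx -mulmxA AB mulmx1; by left.
- move=> /(congr1 (fun X => A *m X *m B)).
  rewrite !mulmxA AB !mul1mx -mulmxA AB mulmx1; by right.
Qed.

End ModuleTheory.

Section ModuleDecompositions.
Import GRing.Theory.
Local Open Scope ring_scope.
Variables (F : fieldType) (n : nat).
Implicit Type M : fmod F n.

Lemma indecomposable_indec M : indecomposable M -> indec (frepr M).
Proof.
case=> m0 ind; split=> // e he ee.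
have he' : intertwines (frepr M) (frepr M) (1%:M - e).
  exact: intertwinesB (intertwines1 _) he.
have ee' : (1%:M - e) *m e = 0 by rewrite mulmxBl mul1mx ee subrr.
have modX X : intertwines (frepr M) (frepr M) X -> mxmodule (frepr M) X.
  by move=> hX; apply/mxmoduleP => g Gg; rewrite -hX // submxMl.
have dx : (e :&: (1%:M - e))%MS = 0.
  apply/eqP/rowV0P => v; rewrite sub_capmx => /andP[/submxP[u ->] /submxP[w]].
  by move/(congr1 (mulmx^~ e)); rewrite -!mulmxA ee ee' mulmx0.
have sx : (1%:M <= e + (1%:M - e))%MS.
  by rewrite -{1}[1%:M](subrK e) addrC addmx_sub_adds.
have := ind _ _ (modX _ he) (modX _ he').
case/(_ _ _)/orP => [||/eqP->|]; [by apply/mxdirect_addsP | | by left |].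
  by apply/eqmxP; rewrite submx1.
by rewrite subr_eq0 => /eqP; right.
Qed.

Lemma indec_indecomposable M : indec (frepr M) -> indecomposable M.
Proof.
case=> m0 ind; split=> // U V modU modV /mxdirect_addsP dUV sUV.
have sUV1 : (1%:M <= U + V)%MS by rewrite sUV.
have [P0|P1] := ind _ (proj_intertwines modU modV dUV sUV1) (proj_mx_proj dUV).
  by have := proj_mx_id dUV (submx_refl U); rewrite P0 mulmx0 => <-; rewrite eqxx.
by have := proj_mx_0 dUV (submx_refl V); rewrite P1 mulmx1 => ->; rewrite eqxx orbT.
Qed.

Lemma direct_decomp_retracts M k (U : 'I_k -> 'M[F]_(fdim M))
    (modU : forall i, mxmodule (frepr M) (U i)) : direct_decomp U ->
  exists (A : forall i, 'M_(\rank (U i), fdim M)) (B : forall i, 'M_(fdim M, \rank (U i))),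
  [/\ forall i, retract (frepr (summand (modU i))) (frepr M) (A i) (B i),
      \sum_i (B i *m A i) = 1%:M
    & forall i j, i != j -> B i *m A i *m (B j *m A j) = 0].
Proof.
case=> _ [/mxdirect_sumsP dx sx].
pose V i := (\sum_(j < k | j != i) U j)%MS.
have modV i : mxmodule (frepr M) (V i) by apply: sumsmx_module.
have dUV i : (U i :&: V i)%MS = 0 by apply: dx.
have sUV i : (1%:M <= U i + V i)%MS by rewrite -sx (bigD1 i).
pose P i := proj_mx (U i) (V i).
have hP i : intertwines (frepr M) (frepr M) (P i) by apply: proj_intertwines.
have PP i : P i *m P i = P i by apply: proj_mx_proj.
have UP i : U i *m P i = U i by apply: proj_mx_id.
have UP0 i j : i != j -> U i *m P j = 0.
  by move=> ij; apply: proj_mx_0 => //; apply: (sumsmx_sup i).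
have PU i : (U i :=: P i)%MS.
  by apply/eqmxP; rewrite -{1}UP submxMl /= -[P i]mul1mx proj_mx_sub.
exists (fun i => val_submod 1%:M); exists (fun i => in_submod (U i) (P i)).
have rP i := retract_submod (modU i) (hP i) (PP i) (PU i).
split=> [i||i j ij]; first by case: (rP i).
- rewrite (eq_bigr _ (fun i _ => proj2 (rP i))).
  have /sub_sumsmxP[u eu] : (1%:M <= \sum_i U i)%MS by rewrite sx.
  rewrite -[LHS]mul1mx eu mulmx_suml; apply: eq_bigr => i _.
  rewrite mulmx_sumr (bigD1 i) //= -mulmxA UP big1 ?addr0 // => j ji.
  by rewrite -mulmxA UP0 ?mulmx0 // eq_sym.
- rewrite (proj2 (rP i)) (proj2 (rP j)).
  have /submxP[u ->] : (P i <= U i)%MS by rewrite PU.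
  by rewrite -mulmxA UP0 ?mulmx0.
Qed.

Lemma indecomposable_decomposition M :
  exists (k : nat) (U : 'I_k -> 'M[F]_(fdim M)) (modU : forall i, mxmodule (frepr M) (U i)),
    direct_decomp U /\ forall i, indecomposable (summand (modU i)).
Proof.
have [s [s1 s2 s3]] := primitive_decomposition (intertwines1 (frepr M)) (mulmx1 1%:M).
pose U (i : 'I_(size s)) := nth 0 s i.
have Us i : U i \in s by apply: mem_nth.
have modU i : mxmodule (frepr M) (U i).
  have [[hX _ _ _] _] := s1 _ (Us i).
  by apply/mxmoduleP => g Gg; rewrite -hX // submxMl.
have UU0 i j : i != j -> U i *m U j = 0.
  move=> ij; have /(pairwiseP 0) h := s2.
  case: (ltngtP i j) => [lt|lt|/val_inj eq]; last by rewrite eq eqxx in ij.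
    by have /andP[/eqP] := h i j (ltn_ord i) (ltn_ord j) lt.
  by have /andP[_ /eqP] := h j i (ltn_ord j) (ltn_ord i) lt.
have UU i : U i *m U i = U i by have [[]] := s1 _ (Us i).
exists (size s), U, modU; split; last first.
  move=> i; apply: indec_indecomposable.
  have [[hX XX nz pr] _] := s1 _ (Us i).
  have [rt e] := retract_submod (modU i) hX XX (eqmx_refl _).
  by apply: primitive_indec rt _; rewrite e.
split=> //; split.
  apply/mxdirect_sumsP => i _; apply/eqP/rowV0P => v.
  rewrite sub_capmx => /andP[/submxP[u ->] h].
  rewrite -(UU i) mulmxA; apply/sub_kermxP; apply: submx_trans h _.
  by apply/sumsmx_subP => j ji; apply/sub_kermxP/UU0.
apply/eqmxP; rewrite submx1 /= -s3 (big_nth 0) big_mkord.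
by apply: summx_sub_sums.
Qed.

End ModuleDecompositions.

(** * Induction on finite sets, and permutations matching two functions *)

Lemma set_ind (T : finType) (P : {set T} -> Prop) :
  P set0 -> (forall x (A : {set T}), x \notin A -> P A -> P (x |: A)) -> forall A, P A.
Proof.
move=> P0 PU A; move: {2}#|A| (leqnn #|A|) => k; elim: k A => [|k IH] A.
  by rewrite leqn0 cards_eq0 => /eqP->.
have [->|[x xA]] := set_0Vmem A; first by [].
rewrite (cardsD1 x) xA ltnS => /IH PD; rewrite -(setD1K xA).
by apply: PU => //; rewrite !inE eqxx.
Qed.

Lemma perm_of_fibers (n : nat) (T : eqType) (f f' : 'I_n -> T) :
  (forall t, #|[set x | f x == t]| = #|[set x | f' x == t]|) ->
  exists g : 'S_n, forall x, f' (g x) = f x.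
Proof.
move=> h; pose t := [tuple f i | i < n]; pose t' := [tuple f' i | i < n].
have cnt (u : 'I_n -> T) c : count_mem c [tuple u i | i < n] = #|[set x | u x == c]|.
  rewrite /= count_map cardE [in RHS]/enum_mem size_filter enumT.
  by apply: eq_count => x; rewrite /= inE.
have : perm_eq t t'.
  by rewrite /perm_eq; apply/allP => c _ /=; rewrite !cnt h.
case/tuple_permP => g e; exists g => x.
have := congr1 (nth (f x) ^~ x) e.
by rewrite -(tnth_nth _ t) tnth_mktuple -(tnth_nth _ [tuple tnth t' (g i) | i < n]) !tnth_mktuple.
Qed.

(** * The signed tensor space *)

Section Signs.
Import GRing.Theory.
Local Open Scope ring_scope.
Variables (F : fieldType) (n : nat).
Implicit Types (O : {set 'I_n}) (g h : 'S_n) (f : 'I_n -> 'I_n -> F).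

Definition pair_prod f O :=
  \prod_(a in O) \prod_(b in O) (if (a < b)%N then f a b else 1).

Lemma pair_prodU1 f O x :
    (forall a b, f a b = f b a) -> x \notin O ->
  pair_prod f (x |: O) = pair_prod f O * \prod_(a in O) f a x.
Proof.
move=> fC xO; rewrite /pair_prod big_setU1 //= big_setU1 //= ltnn mul1r.
rewrite [X in _ * X](eq_bigr (fun a : 'I_n => (if (a < x)%N then f a x else 1) *
   \prod_(b in O) (if (a < b)%N then f a b else 1))); last first.
  by move=> a aO; rewrite big_setU1.
rewrite big_split /= mulrA -big_split /= mulrC; congr (_ * _).
apply: eq_bigr => a aO; case: (ltngtP a x) => [||/val_inj ax]; rewrite ?mul1r ?mulr1 //.
by rewrite -ax aO in xO.
Qed.

Lemma pair_prod_imset f O g :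
    (forall a b, f a b = f b a) ->
  pair_prod (fun a b => f (g a) (g b)) O = pair_prod f (g @: O).
Proof.
move=> fC; elim/set_ind: O => [|x O xO IH]; first by rewrite imset0 /pair_prod !big_set0.
rewrite imsetU1 !pair_prodU1 // ?mem_imset //; last exact: perm_inj.
by rewrite IH big_imset //=; apply: in2W; exact: perm_inj.
Qed.

(** Changes sign when two distinct points are exchanged; hence the product of [osgn a b] and
    [osgn (g a) (g b)] depends on the unordered pair only, and it is -1 exactly when [g] inverts the
    pair. *)
Definition osgn (a b : 'I_n) : F := (-1) ^+ (a < b)%N.
Lemma osgn_sqr a b : osgn a b * osgn a b = 1.
Proof. by rewrite -expr2 sqrr_sign. Qed.

(* Only a cocycle: for [g] not stabilizing [O] it compares the orders of [O] and
   [g @: O]; on the stabilizer of [O] it is the sign of the restriction to [O]. *)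
Definition eps O g : F := pair_prod (fun a b => osgn a b * osgn (g a) (g b)) O.

Let epsC g a b : osgn a b * osgn (g a) (g b) = osgn b a * osgn (g b) (g a).
Proof.
rewrite /osgn; case: (ltngtP a b) => [lt|lt|/val_inj ->] //;
  case: (ltngtP (g a) (g b)) => [lt'|lt'|/val_inj/perm_inj e];
  rewrite ?mulr1 ?mul1r // ?mulrNN ?mulr1 //;
  by rewrite e ltnn in lt.
Qed.

Lemma eps_sqr O g : eps O g * eps O g = 1.
Proof.
rewrite /eps /pair_prod -big_split big1 //= => a _; rewrite -big_split big1 //= => b _.
by case: ifP => _; rewrite ?mulr1 // mulrACA !osgn_sqr mulr1.
Qed.

Lemma eps1 O : eps O 1 = 1.
Proof.
rewrite /eps /pair_prod big1 //= => a _; rewrite big1 //= => b _.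
by rewrite !perm1 osgn_sqr; case: ifP.
Qed.

Lemma epsM O g h : eps O (g * h) = eps O g * eps (g @: O) h.
Proof.
rewrite /eps -(@pair_prod_imset (fun a b => osgn a b * osgn (h a) (h b))); last exact: epsC.
rewrite /pair_prod -big_split; apply: eq_bigr => a _.
rewrite -big_split; apply: eq_bigr => b _ /=; case: ifP => _; rewrite ?mulr1 //.
by rewrite !permM mulrA -(mulrA (osgn a b)) osgn_sqr mulr1.
Qed.

Lemma eps_setU1_fixed O g x :
  g @: O = O -> g x = x -> x \notin O -> eps (x |: O) g = eps O g.
Proof.
move=> gO gx xO; rewrite /eps pair_prodU1 //.
rewrite -[RHS]mulr1; congr (_ * _); rewrite gx big_split /=.
rewrite -(@big_imset _ _ _ _ _ g (mem O) (fun b => osgn b x)) /=; last by apply: in2W; exact: perm_inj.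
by rewrite gO -big_split big1 //= => a _; rewrite osgn_sqr.
Qed.

(** Both signs equal the sign on the intersection: the other points are fixed, and adding a fixed
    point to a stable set contributes a product over the set and its reindexing by [g], which
    cancel. *)
Lemma eps_eq_on_support O O' g :
    g @: O = O -> g @: O' = O' ->
    (forall x, (x \in O) != (x \in O') -> g x = x) ->
  eps O g = eps O' g.
Proof.
have sub (A D : {set 'I_n}) : g @: A = A -> (forall x, x \in D -> x \notin A -> g x = x) ->
    eps (D :|: A) g = eps A g /\ g @: (D :|: A) = D :|: A.
  move=> gA; elim/set_ind: D => [|x D xD IH] h; first by rewrite set0U.
  have [e1 e2] : eps (D :|: A) g = eps A g /\ g @: (D :|: A) = D :|: A.
    by apply: IH => y yD; apply: h; rewrite inE yD orbT.
  rewrite -setUA; have [xA|xA] := boolP (x \in D :|: A).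
    by rewrite (setUidPr _) ?sub1set.
  have gx : g x = x by apply: h; rewrite ?setU11 //; apply: contra xA => xA; rewrite inE xA orbT.
  by rewrite eps_setU1_fixed // e1 imsetU1 e2 gx.
move=> gO gO' fx.
have gI : g @: (O :&: O') = O :&: O'.
  by rewrite imsetI ?gO ?gO' //; apply: in2W; exact: perm_inj.
have [] := sub (O :&: O') O gI; first by move=> x xO; rewrite inE xO /= => xO'; apply: fx; rewrite xO (negbTE xO').
have [] := sub (O :&: O') O' gI; first by move=> x xO; rewrite inE xO andbT => xO'; apply: fx; rewrite xO (negbTE xO').
by rewrite (setUidPl (subsetIl _ _)) (setUidPl (subsetIr _ _)) => -> _ ->.
Qed.

Lemma eps_tperm O x y : x != y -> x \in O -> y \in O -> eps O (tperm x y) = -1.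
Proof.
move=> xy xO yO; pose A := O :\ x :\ y; pose g := tperm x y.
have xA : x \notin y |: A by rewrite !inE eqxx (negbTE xy) andbF.
have yA : y \notin A by rewrite !inE eqxx.
have -> : O = x |: (y |: A).
  by rewrite setD1K ?setD1K // !inE yO eq_sym xy.
have gA a : a \in A -> g a = a.
  by rewrite !inE => /and3P[ay ax _]; rewrite tpermD // eq_sym.
have gA1 : g @: A = A by rewrite -[RHS]imset_id; apply: eq_in_imset.
have A1 : eps A g = 1.
  rewrite (@eps_eq_on_support A set0) ?imset0 //; first by rewrite /eps /pair_prod big_set0.
  by move=> z; rewrite in_set0; case: (boolP (z \in A)) => // zA _; apply: gA.
rewrite /eps pair_prodU1 ?pair_prodU1 //; try exact: epsC.
rewrite -/(eps A g) A1 mul1r big_setU1 //= mulrCA -big_split big1 /=; last first.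
  move=> a aA; rewrite gA // /g tpermL tpermR [X in _ * X]mulrC mulrACA.
  by rewrite !osgn_sqr mulr1.
rewrite mulr1 /g tpermL tpermR /osgn; move: xy.
by case: (ltngtP x y) => [lt|lt|/val_inj ->]; rewrite ?mulr1 ?mul1r // eqxx.
Qed.

Lemma sgn_tailE a (g : 'S_n) : sgn_tail F a g = eps [set x : 'I_n | (a <= x)%N] g.
Proof.
rewrite /sgn_tail /eps /pair_prod -prodr_const big_mkcond /=.
rewrite pair_big [RHS]big_mkcond; apply: eq_bigr => -[i j] _; rewrite !inE /=.
case: ifP => [/and3P[ai ij gji]|]; rewrite /osgn.
  by rewrite ai (leq_trans ai (ltnW ij)) ij ltnNge (ltnW gji) mulr1.
case: (leqP a i) => //= ai; case: (leqP a j) => //= aj; case: ifP => //= ij.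
case: (ltngtP (g i) (g j)) => // [_ _|/val_inj/perm_inj e _].
  by rewrite ij -expr2 sqrr_sign.
by rewrite e ltnn in ij.
Qed.

End Signs.

(** * Colorings as a basis of the tensor space *)

Section Colorings.
Import GRing.Theory.
Local Open Scope ring_scope.
Variables (F : fieldType) (n : nat).

(* The first n+1 colors are even, the others odd; being more than n, the even colors
   are never all used. *)
Definition color := 'I_(n.+1 + n.+1).
Definition coloring := {ffun 'I_n -> color}.
Implicit Types (u v : coloring) (g h : 'S_n).

Definition cact u g : coloring := [ffun x => u (g^-1 x)%g].

Lemma cactE u g x : cact u g x = u (g^-1 x)%g.
Proof. by rewrite ffunE. Qed.

Lemma cact1 u : cact u 1 = u.
Proof. by apply/ffunP => x; rewrite ffunE invg1 perm1. Qed.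

Lemma cactM u g h : cact u (g * h) = cact (cact u g) h.
Proof. by apply/ffunP => x; rewrite !ffunE invMg permM. Qed.

Lemma cactK g : cancel (cact^~ g) (cact^~ g^-1%g).
Proof. by move=> u; rewrite -cactM mulgV cact1. Qed.

Lemma cactKV g : cancel (cact^~ g^-1%g) (cact^~ g).
Proof. by move=> u; rewrite -cactM mulVg cact1. Qed.

Lemma cact_inj g : injective (cact^~ g).
Proof. exact: can_inj (cactK g). Qed.

Lemma cact_perm u g x : cact u g (g x) = u x.
Proof. by rewrite ffunE permK. Qed.

Lemma cact_eq u v g : (cact u g == v) = [forall x, v (g x) == u x].
Proof.
apply/eqP/forallP => [<- x|h]; first by rewrite cact_perm.
by apply/ffunP => x; rewrite ffunE -(eqP (h _)) permKV.
Qed.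

Definition oddc (c : color) := (n < c)%N.
Definition odds u := [set x | oddc (u x)].

Lemma odds_cact u g : odds (cact u g) = g @: odds u.
Proof.
apply/setP => x; rewrite -(permKV g x) mem_imset; last exact: perm_inj.
by rewrite !inE cact_perm.
Qed.

(** The Koszul sign: odd tensor factors anticommute when [g] carries the basis vector [u] to
    [cact u g]. *)
Definition sg u g : F := eps F (odds u) g.

Lemma sg1 u : sg u 1 = 1. Proof. exact: eps1. Qed.
Lemma sg_sqr u g : sg u g * sg u g = 1. Proof. exact: eps_sqr. Qed.
Lemma sgM u g h : sg u (g * h) = sg u g * sg (cact u g) h.
Proof. by rewrite /sg epsM odds_cact. Qed.
Lemma sgV u g : sg (cact u g) g^-1 = sg u g.
Proof.
have := sgM u g g^-1; rewrite mulgV sg1 => h.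
by rewrite -[LHS]mul1r -(sg_sqr u g) -mulrA -h mulr1.
Qed.

Definition dimT := #|{: coloring}|.
Definition kmx (f : coloring -> coloring -> F) : 'M[F]_dimT :=
  \matrix_(i, j) f (enum_val i) (enum_val j).
Definition ent (X : 'M[F]_dimT) u v := X (enum_rank u) (enum_rank v).

Lemma ent_kmx f u v : ent (kmx f) u v = f u v.
Proof. by rewrite /ent mxE !enum_rankK. Qed.

Lemma entP X Y : (forall u v, ent X u v = ent Y u v) -> X = Y.
Proof.
by move=> h; apply/matrixP => i j; have := h (enum_val i) (enum_val j); rewrite /ent !enum_valK.
Qed.

Lemma entM X Y u v : ent (X *m Y) u v = \sum_t ent X u t * ent Y t v.
Proof.
rewrite /ent mxE (reindex (@enum_rank coloring)) //.
by exists enum_val => i _; rewrite ?enum_valK ?enum_rankK.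
Qed.

Lemma entD X Y u v : ent (X + Y) u v = ent X u v + ent Y u v.
Proof. by rewrite /ent mxE. Qed.
Lemma entZ a X u v : ent (a *: X) u v = a * ent X u v.
Proof. by rewrite /ent mxE. Qed.
Lemma ent0 u v : ent 0 u v = 0.
Proof. by rewrite /ent mxE. Qed.
Lemma ent_sum I (r : seq I) (P : pred I) (X : I -> 'M_dimT) u v :
  ent (\sum_(i <- r | P i) X i) u v = \sum_(i <- r | P i) ent (X i) u v.
Proof. by rewrite /ent summxE. Qed.

Definition Tmx g := kmx (fun u v => if cact u g == v then sg u g else 0).

Lemma ent_Tmul g X u v : ent (Tmx g *m X) u v = sg u g * ent X (cact u g) v.
Proof.
rewrite entM (bigD1 (cact u g)) //= ent_kmx eqxx big1 ?addr0 // => t ne.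
by rewrite ent_kmx eq_sym (negbTE ne) mul0r.
Qed.

Lemma ent_mulT g X u v : ent (X *m Tmx g) u (cact v g) = ent X u v * sg v g.
Proof.
rewrite entM (bigD1 v) //= ent_kmx eqxx big1 ?addr0 // => t ne.
by rewrite ent_kmx (inj_eq (@cact_inj g)) (negbTE ne) mulr0.
Qed.

Lemma ent1 u v : ent 1%:M u v = (u == v)%:R.
Proof. by rewrite /ent mxE (inj_eq enum_rank_inj). Qed.

Lemma T_repr : mx_repr (Sgroup n) Tmx.
Proof.
split=> [|g h _ _]; apply: entP => u v.
  by rewrite ent1 ent_kmx cact1 sg1; case: eqP.
by rewrite ent_Tmul !ent_kmx cactM sgM; case: eqP; rewrite ?mulr0.
Qed.
Canonical Trep := MxRepresentation T_repr.

Lemma TmxM g h : Tmx (g * h) = Tmx g *m Tmx h.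
Proof. by rewrite (repr_mxM Trep) ?inE. Qed.

Notation "'End_T' X" := (intertwines Trep Trep X) (at level 10).

(** Each [Tmx g] is a signed permutation matrix, so an endomorphism is a function on pairs of
    colorings that is equivariant up to sign; one entry determines its whole orbit. *)
Lemma endT_P X : End_T X <->
  forall g u v, ent X (cact u g) (cact v g) = sg u g * sg v g * ent X u v.
Proof.
split=> [h g u v | h g _].
  have := congr1 (fun Y => ent Y u (cact v g)) (h g (in_setT g)).
  rewrite /= ent_Tmul ent_mulT => /(congr1 (fun x => sg u g * x)).
  by rewrite mulrA sg_sqr mul1r mulrA (mulrAC _ _ (sg v g)).
apply: entP => u v; rewrite -(cactKV g v) ent_Tmul ent_mulT h.
by rewrite !mulrA sg_sqr mul1r mulrC.
Qed.

Definition content u : {ffun color -> nat} := [ffun c => #|[set x | u x == c]|].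

Lemma content_cact u g : content (cact u g) = content u.
Proof.
apply/ffunP => c; rewrite !ffunE -[RHS](card_imset _ (@perm_inj _ g)).
congr #|pred_of_set _|; apply/setP => x; rewrite -(permKV g x) (mem_imset _ _ (@perm_inj _ g)).
by rewrite !inE cact_perm.
Qed.

Lemma content_orbit u v : content u = content v -> exists g, cact u g = v.
Proof.
move=> h; have [|g hg] := @perm_of_fibers n _ u v.
  by move=> c; have := congr1 (fun w : {ffun color -> nat} => w c) h; rewrite /= !ffunE.
by exists g; apply/ffunP => x; rewrite ffunE -hg permKV.
Qed.

Definition wproj (w : {ffun color -> nat}) := kmx (fun u v => ((u == v) && (content u == w))%:R).

Lemma ent_wmul w X u v : ent (wproj w *m X) u v = (content u == w)%:R * ent X u v.
Proof.
rewrite entM (bigD1 u) //= ent_kmx eqxx big1 ?addr0 // => t ne.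
by rewrite ent_kmx eq_sym (negbTE ne) mul0r.
Qed.

Lemma ent_mulw w X u v : ent (X *m wproj w) u v = ent X u v * (content v == w)%:R.
Proof.
rewrite entM (bigD1 v) //= ent_kmx eqxx big1 ?addr0 // => t ne.
by rewrite ent_kmx (negbTE ne) mulr0.
Qed.

Lemma wproj_end w : End_T (wproj w).
Proof.
apply/endT_P => g u v; rewrite !ent_kmx (inj_eq (@cact_inj g)) content_cact.
by case: eqP => [->|_]; rewrite ?mulr0 // sg_sqr mul1r.
Qed.

Lemma wproj_idem w : wproj w *m wproj w = wproj w.
Proof.
by apply: entP => u v; rewrite ent_wmul ent_kmx; case: (content u == w); rewrite ?mul1r ?mul0r ?andbF.
Qed.

End Colorings.

(** * Weights, and endomorphisms factoring through higher weights *)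

Section Dominance.
Variable n : nat.
Definition weight := {ffun color n -> nat}.
Implicit Types (w : weight) (u v : coloring n).

(** Even colors come first, so these are the sums compared by dominance of pairs: partial sums of
    the even part, then the even total plus partial sums of the odd part. *)
Definition dsum k w := \sum_(c : color n | c < k) w c.
Definition domw w' w := forall k, dsum k w <= dsum k w'.
Definition sdom w' w := domw w' w /\ w' <> w.

Lemma domw_trans w1 w2 w3 : domw w1 w2 -> domw w2 w3 -> domw w1 w3.
Proof. by move=> h1 h2 k; apply: leq_trans (h2 k) (h1 k). Qed.

Lemma dsumS (c : color n) w : dsum c.+1 w = dsum c w + w c.
Proof.
rewrite /dsum (bigD1 c) //= addnC; congr (_ + _).
by apply: eq_bigl => d; rewrite ltnS ltn_neqAle andbC.
Qed.

Lemma domw_anti w w' : domw w w' -> domw w' w -> w = w'.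
Proof.
move=> h1 h2; apply/ffunP => c.
have e k : dsum k w = dsum k w' by apply/eqP; rewrite eqn_leq h1 h2.
by have := e c.+1; rewrite !dsumS e => /addnI.
Qed.

Definition height w := \sum_(k < (n.+1 + n.+1).+1) dsum k w.

Lemma height_sdom w' w : sdom w' w -> height w < height w'.
Proof.
case=> h ne; rewrite ltnNge; apply/negP => le; apply: ne.
have e (k : 'I_(n.+1 + n.+1).+1) : dsum k w = dsum k w'.
  have := leqif_sum (fun (k : 'I_(n.+1 + n.+1).+1) (_ : true) => leqif_eq (h k)).
  case=> _; rewrite eqn_leq le /= => /esym.
  have -> : height w <= height w' by apply: leq_sum.
  by move=> /forall_inP h'; apply/eqP/h'.
apply/ffunP => c; have := e (Ordinal (ltn_ord c : c.+1 < (n.+1 + n.+1).+1)).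
have := e (widen_ord (leqnSn _) c).
by rewrite /= !dsumS => -> /addnI.
Qed.

Lemma dsum_content k u : dsum k (content u) = #|[set x | u x < k]|.
Proof.
rewrite -sum1_card (partition_big u (fun c : color n => c < k)) /=; last by move=> x; rewrite inE.
apply: eq_bigr => c ck; rewrite ffunE -sum1_card; apply: eq_bigl => x.
by rewrite !inE; case: eqP => [->|]; rewrite ?ck ?andbF.
Qed.

Lemma height_content u : height (content u) <= (n.+1 + n.+1).+1 * n.
Proof.
rewrite /height -[X in X * _](card_ord (n.+1 + n.+1).+1) -sum_nat_const.
apply: leq_sum => k _; rewrite dsum_content.
by apply: leq_trans (max_card _) _; rewrite card_ord.
Qed.

Lemma card_cact (P : rel (color n)) u v g :
  #|[set x | P (cact u g x) (cact v g x)]| = #|[set x | P (u x) (v x)]|.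
Proof.
rewrite -[RHS](card_imset _ (@perm_inj _ g)).
congr #|pred_of_set _|; apply/setP => x; rewrite -(permKV g x) (mem_imset _ _ (@perm_inj _ g)).
by rewrite !inE !cact_perm.
Qed.

Lemma sum_cact (f : color n -> nat) u g : \sum_x f (cact u g x) = \sum_x f (u x).
Proof.
rewrite (reindex_inj (@perm_inj _ g)); apply: eq_bigr => x _.
by rewrite cact_perm.
Qed.

Definition minc u v : coloring n := [ffun x => if (u x <= v x)%N then u x else v x].

Lemma minc_l u v x : minc u v x <= u x.
Proof. by rewrite ffunE; case: (leqP (u x) (v x)) => // /ltnW. Qed.

Lemma minc_r u v x : minc u v x <= v x.
Proof. by rewrite ffunE; case: (leqP (u x) (v x)). Qed.

Lemma le_minc u v r : (forall x, r x <= u x) -> (forall x, r x <= v x) ->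
  forall x, r x <= minc u v x.
Proof. by move=> h1 h2 x; rewrite ffunE; case: ifP. Qed.

(* The larger [Phi u v], the lower the weight of [minc u v]; the induction that
   eliminates the orbit sums runs upwards along [Phi]. *)
Definition Phi u v := \sum_x (minc u v x : nat).

Lemma eq_of_le_sum u v : (forall x, u x <= v x) ->
  \sum_x (v x : nat) <= \sum_x (u x : nat) -> u = v.
Proof.
move=> h le; have := leqif_sum (fun x (_ : true) => leqif_eq (h x)).
case=> _; rewrite eqn_leq le leq_sum //= => /esym/forall_inP e.
by apply/ffunP => x; apply/val_inj/eqP/e.
Qed.

(** Lowering colors can only raise partial sums. If the weight stayed the same, so would the sum of
    the colors, and [minc u v] would equal both [u] and [v]. *)
Lemma minc_dom u v : content u = content v -> u <> v -> sdom (content (minc u v)) (content u).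
Proof.
move=> cuv ne; split=> [k|e].
  rewrite !dsum_content; apply/subset_leq_card/subsetP => x; rewrite !inE.
  by apply: leq_ltn_trans (minc_l _ _ _).
apply: ne; have [g hg] := content_orbit e; have [h hh] := content_orbit (etrans e cuv).
have e1 : \sum_x (u x : nat) = \sum_x (minc u v x : nat).
  by rewrite -{1}hg (sum_cact (fun c => c : nat)).
have e2 : \sum_x (v x : nat) = \sum_x (minc u v x : nat).
  by rewrite -{1}hh (sum_cact (fun c => c : nat)).
transitivity (minc u v).
  by apply/esym/eq_of_le_sum; [exact: minc_l | rewrite e1].
by apply: eq_of_le_sum; [exact: minc_r | rewrite e2].
Qed.

(** Joint fiber sizes determine the orbit of a pair; the diagonal ones are recovered by subtracting
    the others from the contents. *)
Lemma pair_orbit u v s t :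
  content u = content s -> content v = content t ->
  (forall i j : color n, i != j ->
     #|[set x | (u x == i) && (v x == j)]| = #|[set x | (s x == i) && (t x == j)]|) ->
  exists g, cact u g = s /\ cact v g = t.
Proof.
move=> cu cv h.
have [|g hg] := @perm_of_fibers n _ (fun x => (u x, v x)) (fun x => (s x, t x)).
  case=> i j.
  have -> (a b : coloring n) : [set x | (a x, b x) == (i, j)] = [set x | (a x == i) && (b x == j)] by [].
  have [<-{j}|] := eqVneq i j; last exact: h.
  have part (a b : coloring n) : content a i = #|[set x | (a x == i) && (b x == i)]| +
       \sum_(j | j != i) #|[set x | (a x == i) && (b x == j)]|.
    rewrite ffunE -sum1_card (partition_big b predT) //= (bigD1 i) //=; congr (_ + _).
      by rewrite -sum1_card; apply: eq_bigl => x; rewrite !inE.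
    by apply: eq_bigr => j _; rewrite -sum1_card; apply: eq_bigl => x; rewrite !inE.
  have := part u v; rewrite cu (part s t).
  rewrite (eq_bigr _ (fun j ne => esym (h i j _))); last by move=> *; rewrite eq_sym.
  by move/addIn.
exists g; split; apply/ffunP => x; rewrite ffunE; have := hg (g^-1 x)%g;
  by rewrite permKV => -[e1 e2].
Qed.

End Dominance.

(** * Signed orbit sums and elimination modulo higher endomorphisms *)

Section Spanning.
Import GRing.Theory.
Local Open Scope ring_scope.
Variables (F : fieldType) (n : nat).
Hypothesis two_neq0 : (2%:R : F) != 0.
Implicit Types (w : weight n) (u v s t : coloring n) (g h : 'S_n).
Notation "'End_T' X" := (intertwines (Trep F n) (Trep F n) X) (at level 10).
Notation wproj := (wproj F).
Notation sg := (sg F).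

Inductive higher w : 'M[F]_(dimT n) -> Prop :=
| Higher0 : higher w 0
| HigherD w' A B X : sdom w' w -> End_T A -> End_T B ->
    wproj w *m A = A -> A *m wproj w' = A -> B *m wproj w = B ->
    higher w X -> higher w (A *m B + X).

Lemma higher_add w X Y : higher w X -> higher w Y -> higher w (X + Y).
Proof.
elim=> [|w' A B {}X d hA hB h1 h2 h3 hX IH] hY; first by rewrite add0r.
by rewrite -addrA; apply: (HigherD d) => //; apply: IH.
Qed.

Lemma higher_mull w C X : End_T C -> wproj w *m C = C -> higher w X -> higher w (C *m X).
Proof.
move=> hC wC; elim=> [|w' A B {}X d hA hB h1 h2 h3 hX IH]; first by rewrite mulmx0; constructor.
rewrite mulmxDr mulmxA; apply: (HigherD d) => //; first exact: intertwinesM hC hA.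
  by rewrite mulmxA wC.
by rewrite -mulmxA h2.
Qed.

Lemma higher_mulr w C X : End_T C -> C *m wproj w = C -> higher w X -> higher w (X *m C).
Proof.
move=> hC wC; elim=> [|w' A B {}X d hA hB h1 h2 h3 hX IH]; first by rewrite mul0mx; constructor.
rewrite mulmxDl -mulmxA; apply: (HigherD d) => //; first exact: intertwinesM hB hC.
by rewrite -mulmxA wC.
Qed.

Lemma higher_scale w a X : higher w X -> higher w (a *: X).
Proof.
elim=> [|w' A B {}X d hA hB h1 h2 h3 hX IH]; first by rewrite scaler0; constructor.
rewrite scalerDr scalemxAl; apply: (HigherD d) => //; first exact: intertwinesZ.
  by rewrite -scalemxAr h1.
by rewrite -scalemxAl h2.
Qed.

Lemma higher_end w X : higher w X -> [/\ End_T X, wproj w *m X = X & X *m wproj w = X].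
Proof.
elim=> [|w' A B {}X d hA hB h1 h2 h3 _ [IH1 IH2 IH3]].
  by split; rewrite ?mulmx0 ?mul0mx //; apply: intertwines0.
split; first by apply: intertwinesD IH1; apply: intertwinesM hB.
  by rewrite mulmxDr mulmxA h1 IH2.
by rewrite mulmxDl -mulmxA h3 IH3.
Qed.

Lemma sg_neq0 u g : sg u g != 0.
Proof.
by apply/eqP => r0; have := sg_sqr F u g; rewrite r0 mulr0 => /eqP; rewrite eq_sym oner_eq0.
Qed.

(** The stabilizer of the pair acts with trivial sign, which makes a signed orbit sum through the
    pair well defined. *)
Definition good u v := forall g, cact u g = u -> cact v g = v -> sg u g * sg v g = 1.

(** An element fixing [u] and [v] permutes points with the same two colors, so it fixes every point
    where the parities differ, and the two signs agree. *)
Lemma goodP u v :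
  (forall x y, u x = u y -> v x = v y -> oddc (u x) != oddc (v x) -> x = y) -> good u v.
Proof.
move=> h g gu gv; rewrite -[RHS](sg_sqr F u g); congr (_ * _).
apply: eps_eq_on_support; rewrite -?odds_cact ?gu ?gv // => x; rewrite !inE => ne.
apply/esym/h; rewrite 1?eq_sym //.
- by rewrite -{2}gu cact_perm.
- by rewrite -{2}gv cact_perm.
Qed.

(** The transposition of [x] and [y] fixes both colorings, with sign -1 on exactly one of them; so
    the entry equals its own negative. *)
Lemma end_mixed0 X u v x y : End_T X -> x <> y -> u x = u y -> v x = v y ->
  oddc (u x) != oddc (v x) -> ent X u v = 0.
Proof.
move=> /endT_P hX /eqP xy ux vx ne; pose g := tperm x y.
have fixed s : s x = s y -> cact s g = s.
  move=> sx; apply/eqP; rewrite cact_eq; apply/forallP => z; apply/eqP.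
  by rewrite /g; case: tpermP => [->|->|].
have sg_odd s : s x = s y -> sg s g = (-1) ^+ oddc (s x).
  move=> sx; case ox : (oddc (s x)).
    by apply: eps_tperm; rewrite // inE -?sx ox.
  rewrite expr0 /sg (@eps_eq_on_support _ _ _ set0) ?imset0 //.
  - by rewrite /eps /pair_prod big_set0.
  - by rewrite -odds_cact fixed.
  move=> z; rewrite !inE; case: (oddc (s z)) / idP => // oz _.
  by rewrite tpermD //; apply: contraTneq oz => <-; rewrite -?sx ox.
have := hX g u v; rewrite !fixed // !sg_odd // -signr_addb.
have -> : oddc (u x) (+) oddc (v x) = true by move: ne; do 2!case: (oddc _).
rewrite expr1 mulN1r => /eqP; rewrite -addr_eq0 -mulr2n -mulr_natr mulf_eq0 (negbTE two_neq0) orbF.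
by move/eqP.
Qed.

(** Signed orbit sum of the matrix unit at the pair. The element chosen by [pick] is arbitrary; for
    a good pair the value does not depend on it. *)
Definition xi u v : 'M[F]_(dimT n) := kmx (fun s t =>
  if [pick g | (cact u g == s) && (cact v g == t)] is Some g then sg u g * sg v g else 0).

Lemma xi_val u v g : good u v -> ent (xi u v) (cact u g) (cact v g) = sg u g * sg v g.
Proof.
move=> gd; rewrite ent_kmx; case: pickP => [h /andP[/eqP hu /eqP hv]|/(_ g)]; last by rewrite !eqxx.
have gu : cact u (h * g^-1) = u by rewrite cactM hu cactK.
have gv : cact v (h * g^-1) = v by rewrite cactM hv cactK.
have := gd _ gu gv; rewrite !sgM hu hv !sgV mulrACA => e.
have bb : (sg u g * sg v g) * (sg u g * sg v g) = 1 by rewrite mulrACA !sg_sqr mulr1.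
by rewrite -[LHS]mulr1 -bb mulrA e mul1r.
Qed.

Lemma xi_supp u v s t : ent (xi u v) s t != 0 -> exists g, s = cact u g /\ t = cact v g.
Proof.
rewrite ent_kmx; case: pickP => [g /andP[/eqP <- /eqP <-] _|_]; last by rewrite eqxx.
by exists g.
Qed.

Lemma xi_end u v : good u v -> End_T (xi u v).
Proof.
move=> gd; apply/endT_P => g s t.
have [/xi_supp[h [-> ->]]|] := boolP (ent (xi u v) s t != 0).
  by rewrite -!cactM !xi_val // !sgM mulrACA mulrC.
rewrite negbK => /eqP e; rewrite e mulr0; apply/eqP; apply: contraTT isT => /xi_supp[h [hs ht]].
have hs' : s = cact u (h * g^-1) by rewrite cactM -hs cactK.
have ht' : t = cact v (h * g^-1) by rewrite cactM -ht cactK.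
move: e; rewrite hs' ht' xi_val // => /eqP; rewrite mulf_eq0.
by rewrite !(negbTE (sg_neq0 _ _)).
Qed.

Lemma xi_proj u v : wproj (content u) *m xi u v = xi u v /\ xi u v *m wproj (content v) = xi u v.
Proof.
split; apply: entP => s t; rewrite ?ent_wmul ?ent_mulw;
  have [/xi_supp[h [-> ->]]|/negPn/eqP ->] := boolP (ent (xi u v) s t != 0);
  by rewrite ?content_cact ?eqxx ?mul1r ?mulr1 ?mulr0 ?mul0r.
Qed.

Section LeadingTerm.
Variables (X : 'M[F]_(dimT n)) (u v : coloring n).
Hypotheses (endX : End_T X) (Xuv : ent X u v != 0) (cuv : content u = content v) (neuv : u <> v).
Let k := minc u v.
Let Z := xi u k *m xi k v.

(** Where the parity of the minimum differs from that of one coloring, the minimum is the other one;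
    so a violation of goodness would be a mixed coincidence for [u] and [v], where [X] vanishes. *)
Lemma leading_good : good u k /\ good k v.
Proof.
have mixed x y : u x = u y -> v x = v y -> oddc (u x) != oddc (v x) -> x = y.
  move=> h1 h2 h3; apply: NNPP => xy; move/eqP: Xuv; apply; exact: end_mixed0 xy h1 h2 h3.
have kor x : k x = u x \/ k x = v x by rewrite ffunE; case: ifP; [left | right].
split; apply: goodP => x y e1 e2 ne.
- have [kx|kx] := kor x; first by rewrite kx eqxx in ne.
  have [ky|ky] := kor y; first by rewrite e2 e1 ky eqxx in ne.
  by apply: mixed; rewrite -?kx // -ky.
- have [kx|kx] := kor x; last by rewrite kx eqxx in ne.
  have [ky|ky] := kor y; last by rewrite e1 e2 ky eqxx in ne.
  by apply: mixed; rewrite -?kx // -ky.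
Qed.

(** A nonzero term passes through some [r] in the orbit of [k] lying below both [s] and [t], hence
    below [minc s t]. This bounds [Phi s t] from below, and equality forces [r = minc s t]. *)
Lemma leading_supp s t : ent Z s t != 0 ->
  (Phi u v <= Phi s t)%N /\ (Phi s t = Phi u v -> exists g, cact u g = s /\ cact v g = t).
Proof.
rewrite entM => /eqP h.
have [r hr] : exists r, ent (xi u k) s r * ent (xi k v) r t != 0.
  apply: NNPP => nh; apply: h; apply: big1 => r _; apply/eqP; apply/negPn/negP => hr.
  by apply: nh; exists r.
move: hr; rewrite mulf_eq0 negb_or => /andP[/xi_supp[g [sg' rg]] /xi_supp[h' [rh th]]].
have rs x : (r x <= s x)%N by rewrite sg' rg !cactE minc_l.
have rt x : (r x <= t x)%N by rewrite th rh !cactE minc_r.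
have sr : (\sum_x (r x : nat))%N = Phi u v by rewrite rg (sum_cact (fun c => c : nat)).
have rk := le_minc rs rt.
split; first by rewrite -sr; apply: leq_sum.
move=> e; have {rk}rk : r = minc s t.
  by apply: eq_of_le_sum => //; rewrite sr -e.
(* For [i < j] the color pair is seen equally well on the minimum and the second coloring, so joint
   counts of [s] and [t] can be read off [r] and [t]; [minr] treats [j < i]. *)
have minl (a b : coloring n) (i j : color n) : (i < j)%N ->
    [set x | (a x == i) && (b x == j)] = [set x | (minc a b x == i) && (b x == j)].
  move=> ij; apply/setP => x; rewrite !inE ffunE; case: (eqVneq (b x) j) => [->|]; rewrite ?andbF // !andbT.
  case: leqP => // lt; rewrite [RHS]gtn_eqF //; apply/eqP => e1.
  by rewrite e1 ltnNge ltnW in lt.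
have minr (a b : coloring n) (i j : color n) : (j < i)%N ->
    [set x | (a x == i) && (b x == j)] = [set x | (a x == i) && (minc a b x == j)].
  move=> ij; apply/setP => x; rewrite !inE ffunE; case: (eqVneq (a x) i) => [->|]; rewrite //=.
  case: leqP => // lt; rewrite [RHS]gtn_eqF //; apply/eqP => e1.
  by rewrite e1 leqNgt ij in lt.
apply: pair_orbit; rewrite ?sg' ?th ?content_cact // => i j ij.
rewrite -sg' -th; case: (ltngtP i j) ij => [lt|lt|/val_inj->] ij; last by rewrite eqxx in ij.
- rewrite (minl u v) // (minl s t) // -/k -rk rh th.
  by rewrite (card_cact (fun a b => (a == i) && (b == j)) k v h').
- rewrite (minr u v) // (minr s t) // -/k -rk sg' rg.
  by rewrite (card_cact (fun a b => (a == i) && (b == j)) u k g).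
Qed.

Lemma leading_one : ent Z u v = 1.
Proof.
have [gd1 gd2] := leading_good.
have xi1 a b : good a b -> ent (xi a b) a b = 1.
  by move=> gd; have := xi_val 1 gd; rewrite !cact1 !sg1 mulr1.
rewrite entM (bigD1 k) //= !xi1 // mulr1 big1 ?addr0 // => r rk.
apply/eqP; apply: contraNT rk; rewrite mulf_eq0 negb_or => /andP[/xi_supp[g [sg' rg]] /xi_supp[h' [rh th]]].
apply/eqP; apply: eq_of_le_sum; last by rewrite rg (sum_cact (fun c => c : nat)).
apply: le_minc => x; first by rewrite [in X in (_ <= X)%N]sg' rg !cactE minc_l.
by rewrite [in X in (_ <= X)%N]th rh !cactE minc_r.
Qed.

Lemma leading_higher : higher (content u) Z.
Proof.
have [gd1 gd2] := leading_good.
rewrite -[Z]addr0; apply: (HigherD (minc_dom cuv neuv)); try exact: xi_end.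
- by have [] := xi_proj u k.
- by have [] := xi_proj u k.
- by rewrite cuv; have [] := xi_proj k v.
- by constructor.
Qed.

End LeadingTerm.

Definition spanned w X := exists a H, higher w H /\ X = a *: wproj w + H.

Definition level (X : 'M[F]_(dimT n)) m :=
  [set st : coloring n * coloring n | (ent X st.1 st.2 != 0) && (Phi st.1 st.2 == m)].

(** Elimination along [Phi]: a nonzero entry of lowest level is cleared, with its whole orbit, by a
    multiple of [wproj w] if it is diagonal and of a product of two orbit sums otherwise. *)
Lemma end_spanned w X : End_T X -> wproj w *m X = X -> X *m wproj w = X -> spanned w X.
Proof.
have [M PhiM] : exists M, forall u v : coloring n, (Phi u v < M)%N.
  exists (\max_(uv : coloring n * coloring n) Phi uv.1 uv.2).+1 => u v; rewrite ltnS.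
  exact: (leq_bigmax (u, v)).
(* [M - m] bounds the levels of the support from below, and [q] bounds the number of nonzero entries
   on that level; the induction is on [m], then on [q]. *)
suff H m q : forall X, End_T X -> wproj w *m X = X -> X *m wproj w = X ->
    (forall s t, ent X s t != 0 -> (M <= Phi s t + m)%N) -> (#|level X (M - m)| < q)%N ->
    spanned w X.
  by move=> h1 h2 h3; apply: (H M (#|level X (M - M)%N|).+1) => // s t _; rewrite leq_addl.
elim: m q => [|m IHm] q.
  move=> {}X _ _ _ hs _; exists 0, 0; split; first by constructor.
  rewrite scale0r addr0; apply: entP => u v; rewrite ent0; apply/eqP; apply: contraTT isT => /hs.
  by rewrite addn0 leqNgt PhiM.
elim: q => // q IHq {}X hX wX Xw hs hq.
have [e|[[s t]]] := set_0Vmem (level X (M - m.+1)%N).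
  apply: (IHm (#|level X (M - m)%N|).+1) => // s t Xst; have := hs _ _ Xst.
  rewrite leq_eqVlt => /predU1P[e1|]; last by rewrite addnS.
  have : (s, t) \in level X (M - m.+1)%N by rewrite inE /= Xst e1 addnK eqxx.
  by rewrite e inE.
rewrite inE /= => /andP[Xst /eqP est].
have content_supp u v : ent X u v != 0 -> content u = w /\ content v = w.
  move=> Xuv; split; apply/eqP; apply: contraNT Xuv => /negbTE ne.
    by rewrite -wX ent_wmul ne mul0r.
  by rewrite -Xw ent_mulw ne mulr0.
have [cs ct] := content_supp _ _ Xst.
have [Z [hZ wZ Zw [Zst Zsupp spZ]]] : exists Z, [/\ End_T Z, wproj w *m Z = Z, Z *m wproj w = Z &
   [/\ ent Z s t = 1,
    forall a b, ent Z a b != 0 -> (Phi s t <= Phi a b)%N /\ (Phi a b = Phi s t -> exists g, cact s g = a /\ cact t g = b)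
    & forall Y c, spanned w Y -> spanned w (Y + c *: Z)]].
  have [st|st] := eqVneq s t.
    exists (wproj w); split; rewrite ?wproj_idem //; first exact: wproj_end.
    split; first by rewrite ent_kmx st eqxx ct eqxx.
      move=> a b; rewrite ent_kmx; case: (eqVneq a b) => [<-|]; rewrite ?eqxx //=.
      case: (eqVneq (content a) w) => [ca|]; rewrite ?eqxx // => _.
      rewrite -st; have [g <-] := content_orbit (etrans cs (esym ca)).
      split=> [|_]; last by exists g.
      have minxx (r : coloring n) : minc r r = r by apply/ffunP => x; rewrite ffunE leqnn.
      by rewrite /Phi !minxx (sum_cact (fun c => c : nat)).
    move=> Y c [a [H [hH ->]]]; exists (a + c), H; split => //.
    by rewrite scalerDl addrAC.
  have cst : content s = content t by rewrite cs ct.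
  have st' := elimN eqP st.
  have hZ := leading_higher hX Xst cst st'.
  rewrite cs in hZ; have [h1 h2 h3] := higher_end hZ.
  exists (xi s (minc s t) *m xi (minc s t) t); split => //; split.
  - exact: leading_one hX Xst.
  - by move=> a b; apply: leading_supp.
  - move=> Y c [a [H [hH ->]]]; exists a, (H + c *: (xi s (minc s t) *m xi (minc s t) t)).
    by split; [apply: higher_add => //; apply: higher_scale | rewrite addrA].
pose c := ent X s t; pose X' := X - c *: Z.
have -> : X = X' + c *: Z by rewrite subrK.
apply: spZ; apply: IHq.
- by apply: intertwinesB => //; apply: intertwinesZ.
- by rewrite mulmxBr -scalemxAr wX wZ.
- by rewrite mulmxBl -scalemxAl Xw Zw.
- move=> a b; rewrite /X' -scaleNr entD entZ => ne.
  have [/hs //|/negPn/eqP e0] := boolP (ent X a b != 0).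
  have /Zsupp[le _] : ent Z a b != 0 by apply: contraNneq ne => ->; rewrite e0 mulr0 addr0.
  by apply: leq_trans (hs _ _ Xst) _; rewrite leq_add2r.
rewrite -ltnS; apply: leq_trans hq; rewrite ltnS; apply: proper_card.
apply/properP; split; last first.
  exists (s, t); first by rewrite inE /= Xst est eqxx.
  by rewrite inE /= /X' -scaleNr entD entZ Zst mulr1 subrr eqxx.
(* No new entry appears on this level: there [Z] is supported on the orbit of [s] and [t], where [X]
   is nonzero too. *)
apply/subsetP => -[a b]; rewrite !inE /= => /andP[ne eab]; rewrite eab andbT.
apply: contraNneq ne => e0; rewrite /X' -scaleNr entD entZ e0 add0r.
have [/Zsupp[_]|/negPn/eqP->] := boolP (ent Z a b != 0); last by rewrite mulr0.
rewrite (eqP eab) est => /(_ erefl)[g [ga gb]].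
move/endT_P: hX => /(_ g s t); rewrite ga gb e0 => /esym/eqP.
by rewrite !mulf_eq0 !(negbTE (sg_neq0 _ _)) (negbTE Xst).
Qed.

End Spanning.

(** * The signed Young permutation modules as weight spaces *)

Section Blocks.
Implicit Types (g : seq nat) (i k : nat).

Lemma yblock_cons a g i : yblock (a :: g) i = if i < a then 0 else (yblock g (i - a)).+1.
Proof.
rewrite /yblock [size _]/= -[iota 0 _]/(0 :: iota 1 (size g)) [count _ _]/= take0 addn0.
rewrite (iotaDl 1 0) count_map leqNgt; case: (ltnP i a) => [lt|le].
  rewrite add0n (@eq_count _ _ pred0) ?count_pred0 // => k /=.
  by apply/negbTE; rewrite -ltnNge (leq_trans lt) ?leq_addr.
by rewrite add1n; congr _.+1; apply: eq_count => k /=; rewrite leq_subRL.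
Qed.

Lemma yblockP g i : i < sumn g ->
  [/\ yblock g i < size g, sumn (take (yblock g i) g) <= i
    & i < sumn (take (yblock g i) g) + nth 0 g (yblock g i)].
Proof.
elim: g i => // a g IH i /=; rewrite yblock_cons; case: (ltnP i a) => [lt _|le lt] /=.
  by split=> //; lia.
have [|h1 h2 h3] := IH (i - a); first by lia.
by split=> //; lia.
Qed.

Lemma yblockK g k o : o < nth 0 g k -> yblock g (sumn (take k g) + o) = k.
Proof.
elim: g k => [|a g IH] [|k] //=; rewrite yblock_cons ?add0n; first by move=> ->.
by move=> h; rewrite -addnA ltnNge leq_addr /= addKn IH.
Qed.

Lemma card_yblock n g k : sumn g = n -> #|[set x : 'I_n | yblock g x == k]| = nth 0 g k.
Proof.
move=> gn; have lt (o : 'I_(nth 0 g k)) : sumn (take k g) + o < n.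
  have kg : k < size g.
    by rewrite ltnNge; apply/negP => le; have := ltn_ord o; rewrite [X in _ < X]nth_default.
  rewrite -gn -[X in _ < sumn X](cat_take_drop k g) sumn_cat ltn_add2l.
  by rewrite (drop_nth 0 kg) /= (leq_trans (ltn_ord o)) ?leq_addr.
rewrite -[RHS]card_ord -(card_imset _ (_ : injective (fun o => Ordinal (lt o)))).
  apply: eq_card => x; rewrite inE; apply/eqP/imsetP => [e|[o _ ->] /=]; last exact: yblockK.
  have [|_ h2 h3] := @yblockP g x; first by rewrite gn.
  rewrite e in h2 h3; rewrite -ltn_subLR // in h3.
  by exists (Ordinal h3) => //; apply/val_inj; rewrite /= subnKC.
by move=> o o' /(congr1 val) /= /addnI /val_inj.
Qed.

End Blocks.

Section Weights.
Variable n : nat.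
Implicit Types al be : seq nat.

Definition wt al be : weight n :=
  [ffun c : color n => if c < n.+1 then nth 0 al c else nth 0 be (c - n.+1)].

Lemma size_partition al : is_partition al -> size al <= sumn al.
Proof.
case/andP => _; elim: al => //= a al IH /andP[a0 /IH]; lia.
Qed.

(** A coloring whose stabilizer is the Young subgroup; [n.+1] shifts the parts of [be] to the odd
    colors. For partitions of total size [n] the argument of [inord] is in range. *)
Definition stdcol al be : coloring n :=
  [ffun x : 'I_n => let k := yblock (al ++ be) x in
     (@inord (n + n.+1) (if k < size al then k else n.+1 + (k - size al)) : color n)].

Section Std.
Variables al be : seq nat.
Hypotheses (pal : is_partition al) (pbe : is_partition be) (abn : psize al + psize be = n).

Let sal : size al <= n.
Proof. by apply: leq_trans (size_partition pal) _; rewrite -abn leq_addr. Qed.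
Let sbe : size be <= n.
Proof. by apply: leq_trans (size_partition pbe) _; rewrite -abn leq_addl. Qed.
Let sab : sumn (al ++ be) = n. Proof. by rewrite sumn_cat. Qed.

Lemma stdcolE x : stdcol al be x = (let k := yblock (al ++ be) x in
  if k < size al then k else n.+1 + (k - size al)) :> nat.
Proof.
rewrite ffunE; cbv zeta; rewrite (@inordK (n + n.+1)) //.
have [|h _ _] := @yblockP (al ++ be) x; first by rewrite sab.
rewrite size_cat in h; move: (sal) (sbe); case: ifP => hk; lia.
Qed.

Lemma content_stdcol : content (stdcol al be) = wt al be.
Proof.
apply/ffunP => c; rewrite !ffunE.
have cc := ltn_ord c.
have blk x : yblock (al ++ be) (x : 'I_n) < size al + size be.
  by have [|h _ _] := @yblockP (al ++ be) x; rewrite ?sab -?size_cat.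
have e k : (forall x, (stdcol al be x == c) = (yblock (al ++ be) x == k)) ->
    #|[set x | stdcol al be x == c]| = nth 0 (al ++ be) k.
  by move=> h; rewrite -(card_yblock k sab); apply: eq_card => x; rewrite !inE h.
have [lc|lc] := ltnP c n.+1.
  have [ls|ls] := ltnP c (size al).
    rewrite (e c) ?nth_cat ?ls // => x; rewrite -val_eqE /= stdcolE /=; case: ifP; lia.
  rewrite [RHS]nth_default //; apply/eqP; rewrite cards_eq0; apply/eqP/setP => x.
  rewrite !inE -val_eqE /= stdcolE /=; have := blk x; case: ifP; lia.
rewrite (e (size al + (c - n.+1))).
  by rewrite nth_cat ltnNge leq_addr /= addKn.
by move=> x; rewrite -val_eqE /= stdcolE /=; have := blk x; case: ifP; lia.
Qed.

Lemma odds_stdcol : odds (stdcol al be) = [set x : 'I_n | sumn al <= x].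
Proof.
apply/setP => x; rewrite !inE /oddc stdcolE /=.
have [|h1 h2 h3] := @yblockP (al ++ be) x; first by rewrite sab.
rewrite size_cat in h1; move: (sal) => hsal; case: (ltnP (yblock (al ++ be) x) (size al)) => lk.
  have : sumn (take (yblock (al ++ be) x) (al ++ be)) + nth 0 (al ++ be) (yblock (al ++ be) x) <= sumn al.
    rewrite take_cat nth_cat lk -[X in _ <= sumn X](cat_take_drop (yblock (al ++ be) x) al) sumn_cat leq_add2l.
    by rewrite (drop_nth 0 lk) /= leq_addr.
  lia.
have : sumn al <= sumn (take (yblock (al ++ be) x) (al ++ be)).
  by rewrite take_cat ltnNge lk /= sumn_cat leq_addr.
lia.
Qed.

Lemma stdcol_stab g : (cact (stdcol al be) g == stdcol al be) = (g \in young n (al ++ be)).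
Proof.
rewrite cact_eq inE; apply: eq_forallb => x; rewrite -val_eqE /= !stdcolE /=.
case: ifP; case: ifP; lia.
Qed.

End Std.
End Weights.

Section SignedYoungModule.
Import GRing.Theory.
Local Open Scope ring_scope.
Variables (F : fieldType) (n : nat) (al be : seq nat).
Hypotheses (pal : is_partition al) (pbe : is_partition be) (abn : (psize al + psize be)%N = n).
Let G := Sgroup n.
Let R := regular_repr F G.
Let u0 := stdcol n al be.
Let w := wt n al be.
Let e := sy_gen F n al be.
Let U := cyclic_mx R e.

(* Sends the coloring [cact u0 g] to [+- e * g]; unlike a map in the other direction
   this makes sense also when p divides the order of the Young subgroup. *)
Let Th : 'M[F]_(dimT n, #|G|) := \matrix_(i, j)
  if cact u0 (enum_val j) == enum_val i then sg F u0 (enum_val j) else 0.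

Let Th_intertwines : intertwines (Trep F n) R Th.
Proof.
move=> h _; apply/matrixP => i j.
have hG x : x \in G by rewrite inE.
transitivity (sg F (enum_val i) h *
   if cact u0 (enum_val j) == cact (enum_val i) h then sg F u0 (enum_val j) else 0).
  rewrite mxE (bigD1 (enum_rank (cact (enum_val i) h))) //= !mxE !enum_rankK eqxx.
  rewrite big1 ?addr0 // => k ne; rewrite !mxE ifN ?mul0r //.
  by apply: contra ne => /eqP ->; rewrite enum_valK.
rewrite mxE (bigD1 (gring_index G (enum_val j * h^-1))) //= big1 ?addr0; last first.
  move=> k ne; rewrite !mxE eqxx /=; case: (j =P _) => [ej|]; last by rewrite mulr0.
  by case/eqP: ne; rewrite ej gring_indexK ?hG // mulgK gring_valK.
rewrite !mxE gring_indexK ?hG // mulgKV gring_valK !eqxx mulr1.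
rewrite -[in RHS](inj_eq (@cact_inj _ h)) -cactM mulgKV; case: eqP => [eq|]; last by rewrite mulr0.
by rewrite sgM eq sgV mulrC.
Qed.

Let Th_gen : row (enum_rank u0) Th = e.
Proof.
apply/rowP => j; rewrite !mxE enum_rankK stdcol_stab //.
rewrite /e /sy_gen summxE -[enum_val j]mul1g.
rewrite (eq_bigr (fun h => sgn_tail F (sumn al) h * (gring_index G h == j)%:R)); last first.
  by move=> h _; rewrite !mxE eqxx eq_sym.
rewrite mul1g; case: ifP => hj; last first.
  rewrite big1 // => h hy; case: eqP => [eq|]; rewrite ?mulr0 //.
  by rewrite -eq gring_indexK ?in_setT // hy in hj.
rewrite (bigD1 (enum_val j)) //= gring_valK eqxx mulr1 big1 ?addr0.
  by rewrite sgn_tailE /sg odds_stdcol.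
move=> h /andP[_ ne]; case: eqP => [eq|]; rewrite ?mulr0 //.
by case/eqP: ne; rewrite -eq gring_indexK ?in_setT.
Qed.

Let wTh : wproj F w *m Th = Th.
Proof.
apply/matrixP => i j; rewrite mxE (bigD1 i) //= !mxE eqxx /= big1 ?addr0; last first.
  by move=> k ne; rewrite !mxE (inj_eq enum_val_inj) eq_sym (negbTE ne) mul0r.
case: (_ =P enum_val i) => [<-|]; last by rewrite mulr0.
by rewrite content_cact content_stdcol // eqxx mul1r.
Qed.

(** Every coloring of weight [w] is some [cact u0 g], and the column of [g] in [Th] has its only
    nonzero entry there. *)
Let Th_inj k (X : 'M_(k, dimT n)) : X *m Th = 0 -> X *m wproj F w = X -> X = 0.
Proof.
move=> h0 <-; apply/matrixP => i j; rewrite !mxE (bigD1 j) //= mxE eqxx /= big1 ?addr0; last first.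
  by move=> l ne; rewrite mxE (inj_eq enum_val_inj) (negbTE ne) mulr0.
case: eqP => [|_]; last by rewrite mulr0.
have cw : content u0 = w by apply: content_stdcol.
rewrite -cw => /esym/content_orbit[g hg].
have /matrixP/(_ i (gring_index G g)) := h0; rewrite !mxE (bigD1 j) //= mxE gring_indexK ?in_setT //.
rewrite hg eqxx big1 => [|l ne]; last first.
  by rewrite mxE gring_indexK ?in_setT // hg (inj_eq enum_val_inj) eq_sym (negbTE ne) mulr0.
rewrite addr0 mulr1 => /eqP; rewrite mulf_eq0 (negbTE (sg_neq0 _ _ _)) orbF => /eqP.
by [].
Qed.

Let ThU : (Th :=: U)%MS.
Proof.
apply/eqmxP/andP; split; last first.
  apply: cyclic_mx_sub; last by rewrite -Th_gen row_sub.
  by apply/mxmoduleP => g Gg; rewrite -Th_intertwines // submxMl.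
apply/row_subP => i; have [ci|ci] := eqVneq (content (enum_val i)) w.
  have [g hg] : exists g, cact u0 g = enum_val i.
    by apply: content_orbit; rewrite ci content_stdcol.
  have -> : row i Th = sg F u0 g *: (e *m R g).
    rewrite -Th_gen -row_mul -Th_intertwines ?inE // row_mul.
    have -> : row (enum_rank u0) (Trep F n g) = sg F u0 g *: delta_mx 0 i.
      apply/rowP => j; rewrite !mxE enum_rankK hg (inj_eq enum_val_inj) eq_sym /=.
      by case: eqP; rewrite ?mulr1 ?mulr0.
    by rewrite -scalemxAl scalerA sg_sqr scale1r -rowE.
  by rewrite scalemx_sub // mxmodule_trans ?cyclic_mx_module ?cyclic_mx_id ?inE.
suff -> : row i Th = 0 by apply: sub0mx.
apply/rowP => j; rewrite !mxE; case: eqP => // hj; case/eqP: ci.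
by rewrite -hj content_cact content_stdcol.
Qed.

Lemma signed_young_retract :
  exists A B, retract (frepr (signed_young_module F n al be)) (Trep F n) A B /\
    B *m A = wproj F w.
Proof.
pose modU := cyclic_mx_module R e.
pose v1 : 'M_(\rank U, #|G|) := val_submod 1%:M.
have v1Th : (v1 <= Th)%MS by rewrite ThU val_submodP.
(* [pinvmx] gives some preimage under [Th]; the projection puts it into the weight space, where [Th]
   is injective. *)
pose A := v1 *m pinvmx Th *m wproj F w.
pose B : 'M_(dimT n, \rank U) := in_submod U Th.
have ATh : A *m Th = v1 by rewrite -mulmxA wTh mulmxKpV.
have Aw : A *m wproj F w = A by rewrite -mulmxA wproj_idem.
have Bv : B *m v1 = Th by rewrite -val_submodE in_submodK // ThU.
have v1R g : g \in G -> submod_repr modU g *m v1 = v1 *m R g.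
  by move=> Gg; rewrite -val_submodE -[submod_repr modU g]mul1mx (val_submodJ modU).
have v1_inj k (X Y : 'M_(k, \rank U)) : X *m v1 = Y *m v1 -> X = Y.
  by rewrite -!val_submodE => /val_submod_inj.
change (exists A B, retract (submod_repr modU) (Trep F n) A B /\ B *m A = wproj F w).
move: (submod_repr modU) v1R => rM v1R; clearbody A B v1; exists A, B; split; last first.
  apply/eqP; rewrite -subr_eq0; apply/eqP/Th_inj.
    by rewrite mulmxBl wTh -mulmxA ATh Bv subrr.
  by rewrite mulmxBl wproj_idem -mulmxA Aw.
split=> [g Gg|g Gg|].
- apply/eqP; rewrite -subr_eq0; apply/eqP/Th_inj.
    rewrite mulmxBl -!mulmxA Th_intertwines // ATh (mulmxA A) ATh v1R // subrr //.
  by rewrite mulmxBl -!mulmxA (wproj_end F w Gg) Aw (mulmxA A) Aw.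
- by apply: v1_inj; rewrite -!mulmxA Bv v1R // mulmxA Bv Th_intertwines.
- by apply: v1_inj; rewrite mul1mx -mulmxA Bv ATh.
Qed.

End SignedYoungModule.

(** * Weights that are not of the form (lam|p mu) *)

Section WeightPartitions.
Variable n : nat.
Implicit Types (al be s : seq nat) (w : weight n) (u v : coloring n).

Lemma sumn_takeS s k : sumn (take k.+1 s) = sumn (take k s) + nth 0 s k.
Proof. by elim: s k => [|x s IH] [|k] //=; rewrite ?take0 ?addn0 // IH addnA. Qed.

Lemma dsum0 w : dsum 0 w = 0.
Proof. by rewrite /dsum big1. Qed.

Lemma dsum_wt_even al be k : k <= n.+1 -> dsum k (wt n al be) = sumn (take k al).
Proof.
elim: k => [|k IH] lek; first by rewrite dsum0 take0.
have lt : k < n.+1 + n.+1 by lia.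
have := dsumS (Ordinal lt) (wt n al be); rewrite /= => ->.
by rewrite ffunE /= lek sumn_takeS IH // ltnW.
Qed.

Lemma dsum_wt_odd al be k : size al <= n.+1 -> k <= n.+1 ->
  dsum (n.+1 + k) (wt n al be) = sumn al + sumn (take k be).
Proof.
move=> sal; elim: k => [|k IH] lek.
  by rewrite addn0 dsum_wt_even // take_oversize // take0 addn0.
have lt : n.+1 + k < n.+1 + n.+1 by lia.
rewrite addnS; apply: etrans (dsumS (Ordinal lt) (wt n al be)) _.
rewrite ffunE ifN; last by rewrite -leqNgt leq_addr.
rewrite -[nat_of_ord _]/(n.+1 + k) addKn IH ?sumn_takeS ?addnA //.
exact: ltnW.
Qed.

Lemma dom_dominates2 lam nu al be : size lam <= n.+1 -> size nu <= n.+1 ->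
    size al <= n.+1 -> size be <= n.+1 ->
  domw (wt n lam nu) (wt n al be) -> dominates2 lam nu al be.
Proof.
move=> s1 s2 s3 s4 h k _.
(* There are at most [n.+1] parts, so every later partial sum is the total and cutoffs up to [n.+1]
   suffice. *)
have tk s : size s <= n.+1 -> take k s = take (minn k n.+1) s.
  by move=> ss; case: (leqP k n.+1) => // lt; rewrite !take_oversize // (leq_trans ss) // ltnW.
have km : minn k n.+1 <= n.+1 by apply: geq_minr.
rewrite !tk //; split; first by rewrite -(dsum_wt_even al be km) -(dsum_wt_even lam nu km).
by rewrite -!dsum_wt_odd.
Qed.

Lemma filter_pos_sorted s : sorted geq s ->
  [/\ is_partition [seq x <- s | 0 < x], sumn [seq x <- s | 0 < x] = sumn s
    & forall k, nth 0 [seq x <- s | 0 < x] k = nth 0 s k].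
Proof.
move=> ss; have tr : transitive geq by move=> x y z h1 h2; apply: leq_trans h2 h1.
split.
- rewrite /is_partition sorted_filter //=.
  by apply/allP => x; rewrite mem_filter => /andP[].
- by elim: s {ss} => //= x s; case: x => [|x] /= ->.
elim: s ss => //= x s IH pxs k.
case: x pxs => [|x] pxs /=; last by case: k => //= k; apply/IH/path_sorted/pxs.
have all0 y : y \in s -> y = 0.
  by move=> ys; have /allP/(_ y ys) := order_path_min tr pxs; rewrite /= leqn0 => /eqP.
rewrite (@eq_in_filter _ _ pred0) ?filter_pred0; last by move=> y /all0 ->.
rewrite nth_nil; case: k => //= k; have [lt|le] := ltnP k (size s); last by rewrite nth_default.
by apply/esym/all0/mem_nth.
Qed.

Lemma sum_content u : \sum_c content u c = n.
Proof.
have := dsum_content (n.+1 + n.+1) u; rewrite /dsum => e.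
transitivity (\sum_(c : color n | c < n.+1 + n.+1) content u c).
  by apply: eq_bigl => c; rewrite ltn_ord.
rewrite e -[RHS]card_ord; apply: eq_card => x; rewrite !inE; exact: (ltn_ord (u x)).
Qed.

(** If the weight is non-increasing on the colors of each parity and divisible by [p] on the odd
    ones, then [lam] and [mu] are its two halves, the odd one divided by [p], with the trailing
    zeros deleted. *)
Lemma weight_cases p u (w := content u) : 0 < p ->
  [\/ exists lam mu, [/\ is_partition lam, is_partition mu, psize lam + p * psize mu = n
        & w = wt n lam (pscale p mu)],
      exists i j : color n, [/\ i < j, oddc i = oddc j & w i < w j]
    | exists c : color n, oddc c /\ ~~ (p %| w c)].
Proof.
move=> p0.
have [h2|h2] := classic (exists i j : color n, [/\ i < j, oddc i = oddc j & w i < w j]).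
  by constructor 2.
have [h3|h3] := classic (exists c : color n, oddc c /\ ~~ (p %| w c)).
  by constructor 3.
constructor 1.
have mono (i j : color n) : i < j -> oddc i = oddc j -> w j <= w i.
  by move=> ij o; rewrite leqNgt; apply/negP => lt; apply: h2; exists i, j.
have dv (c : color n) : oddc c -> p %| w c.
  by move=> oc; apply/negPn/negP => nd; apply: h3; exists c.
pose fe k := if k < n.+1 then w (@inord (n + n.+1) k) else 0.
pose fo k := if k < n.+1 then w (@inord (n + n.+1) (n.+1 + k)) %/ p else 0.
have oddE (c : color n) : oddc c = (n < c) by [].
have se : sorted geq (mkseq fe n.+1).
  apply/(sortedP 0) => k; rewrite size_mkseq => lt.
  rewrite !nth_mkseq // 1?ltnW // /fe lt (ltnW lt) /=; apply: mono.
    by rewrite !(@inordK (n + n.+1)) //; lia.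
  by rewrite !oddE !(@inordK (n + n.+1)); lia.
have so : sorted geq (mkseq fo n.+1).
  apply/(sortedP 0) => k; rewrite size_mkseq => lt.
  rewrite !nth_mkseq // 1?ltnW // /fo lt (ltnW lt) /=; apply/leq_div2r/mono.
    by rewrite !(@inordK (n + n.+1)) //; lia.
  by rewrite !oddE !(@inordK (n + n.+1)); lia.
have [pe sue ne] := filter_pos_sorted se; have [po suo no] := filter_pos_sorted so.
exists [seq x <- mkseq fe n.+1 | 0 < x], [seq x <- mkseq fo n.+1 | 0 < x].
split=> //.
  have sumiota f m : \sum_(j <- iota 0 m) f j = \sum_(i < m) f i.
    by rewrite -(big_mkord xpredT) /index_iota subn0.
  rewrite /psize sue suo -[RHS](sum_content u) -/w big_split_ord !sumnE; congr (_ + _).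
    rewrite big_map sumiota; apply: eq_bigr => i _.
    by rewrite /fe ltn_ord; congr (w _); apply/ord_inj; rewrite (@inordK (n + n.+1)) //; have := ltn_ord i; lia.
  rewrite big_map sumiota big_distrr /=; apply: eq_bigr => i _.
  rewrite /fo ltn_ord mulnC divnK; last by apply: dv; rewrite oddE (@inordK (n + n.+1)); have := ltn_ord i; lia.
  by congr (w _); apply/ord_inj; rewrite (@inordK (n + n.+1)) //; have := ltn_ord i; lia.
apply/ffunP => c; rewrite [RHS]ffunE; have cc := ltn_ord c.
case: ltnP => lc.
  by rewrite ne nth_mkseq // /fe lc; congr (w _); apply/ord_inj; rewrite (@inordK (n + n.+1)).
have nthp (s : seq nat) k : nth 0 (pscale p s) k = p * nth 0 s k.
  by have [lt|le] := ltnP k (size s); [rewrite (nth_map 0) | rewrite !nth_default ?muln0 ?size_map].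
rewrite nthp no nth_mkseq /fo; last by lia.
rewrite ifT; last by lia.
rewrite mulnC divnK; first by congr (w _); apply/ord_inj; rewrite (@inordK (n + n.+1)) /=; lia.
by apply: dv; rewrite oddE (@inordK (n + n.+1)); lia.
Qed.

Lemma lt_content_sdom u v : (forall x, v x <= u x) -> v <> u -> sdom (content v) (content u).
Proof.
move=> le ne; split=> [k|e].
  rewrite !dsum_content; apply/subset_leq_card/subsetP => x; rewrite !inE.
  by apply: leq_ltn_trans.
apply: ne; have [g hg] := content_orbit e; apply: eq_of_le_sum => //.
by rewrite -hg (sum_cact (fun c => c : nat)).
Qed.

End WeightPartitions.

Section WeightMoves.
Import GRing.Theory.
Local Open Scope ring_scope.
Variables (F : fieldType) (n : nat).
Implicit Types (w : weight n) (u v s t : coloring n) (g h : 'S_n).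
Notation T := (Trep F n).
Notation "'End_T' X" := (intertwines (Trep F n) (Trep F n) X) (at level 10).
Notation wproj := (wproj F).
Notation sg := (sg F).

(** Says that [rZ] is a direct summand of the weight space of [w], with maps written on the whole
    tensor space. *)
Definition in_weight m (rZ : mx_representation F (Sgroup n) m) w :=
  exists A B, [/\ intertwines rZ T A, intertwines T rZ B & A *m wproj w *m B = 1%:M].

Lemma in_weight_trans m (rZ : mx_representation F (Sgroup n) m) w w' C D :
    End_T C -> End_T D -> wproj w = C *m wproj w' *m D ->
  in_weight rZ w -> in_weight rZ w'.
Proof.
move=> hC hD e [A [B [hA hB AB]]]; exists (A *m C), (D *m B); split.
- exact: intertwinesM hA hC.
- exact: intertwinesM hD hB.
- by rewrite -AB e !mulmxA.
Qed.

Section Swap.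
Variables i j : color n.
Hypotheses (ltij : (i < j)%N) (oij : oddc i = oddc j).

Let recol u : coloring n := [ffun x => tperm i j (u x)].
Let recolK u : recol (recol u) = u.
Proof. by apply/ffunP => x; rewrite !ffunE tpermK. Qed.
Let recol_act u g : recol (cact u g) = cact (recol u) g.
Proof. by apply/ffunP => x; rewrite !ffunE. Qed.
Let odds_recol u : odds (recol u) = odds u.
Proof. by apply/setP => x; rewrite !inE ffunE; case: tpermP => // ->. Qed.
Let S : 'M[F]_(dimT n) := kmx (fun u v => (v == recol u)%:R).

(** Exchanging two colors of the same parity is an automorphism of the tensor space that identifies
    two weight spaces; the larger multiplicity moves to the earlier color. *)
Lemma swap_weight m (rZ : mx_representation F (Sgroup n) m) w : (w i < w j)%N ->
  in_weight rZ w -> exists w', sdom w' w /\ in_weight rZ w'.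
Proof.
move=> wij Zw; pose w' : weight n := [ffun c => w (tperm i j c)].
exists w'; split.
  split; last by move/ffunP/(_ i); rewrite ffunE tpermL => e; rewrite e ltnn in wij.
  move=> k; rewrite /dsum [X in (_ <= X)%N](eq_bigr (fun c => w (tperm i j c))); last by move=> c _; rewrite ffunE.
  have [e|ne] := eqVneq (i < k)%N (j < k)%N.
    rewrite [X in (_ <= X)%N](reindex_inj (@perm_inj _ (tperm i j))) /=.
    rewrite [X in (_ <= X)%N](eq_big (fun c : color n => (c < k)%N) (fun c => w c)) // => [c|c _].
      by case: tpermP => // ->.
    by rewrite tpermK.
  have [ik kj] : (i < k)%N /\ (k <= j)%N by move: ne; lia.
  rewrite (bigD1 i) // [X in (_ <= X)%N](bigD1 i) //= tpermL leq_add ?(ltnW wij) //.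
  rewrite leq_eqVlt; apply/orP; left; apply/eqP/eq_bigr => c /andP[ck ci].
  by rewrite tpermD // 1?eq_sym //; apply: contraTneq ck => ->; rewrite -leqNgt.
have hS : End_T S.
  apply/endT_P => g u v; rewrite !ent_kmx recol_act (inj_eq (@cact_inj _ g)).
  case: eqP => [->|_]; last by rewrite mulr0.
  by rewrite /sg odds_recol -/(sg u g) sg_sqr mulr1.
apply: (in_weight_trans hS hS _ Zw); apply: entP => u v.
rewrite entM (bigD1 (recol u)) //= big1 ?addr0; last first.
  by move=> t ne; rewrite ent_mulw ent_kmx (negbTE ne) !mul0r.
have cw : (content (recol u) == w') = (content u == w).
  apply/eqP/eqP => h; apply/ffunP => c.
    have /ffunP/(_ (tperm i j c)) := h; rewrite !ffunE tpermK => <-.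
    by apply: eq_card => x; rewrite !inE ffunE (inj_eq perm_inj).
  by rewrite !ffunE -h ffunE; apply: eq_card => x; rewrite !inE ffunE (canF_eq (tpermK i j)).
rewrite ent_mulw !ent_kmx eqxx mul1r recolK cw [v == u]eq_sym.
by case: (u == v); case: (content u == w); rewrite ?mulr1 ?mulr0.
Qed.

End Swap.

Lemma move_box_weight m (rZ : mx_representation F (Sgroup n) m) u (i j : color n) :
    ~~ oddc i -> oddc j -> content u i = 0%N -> ((content u j)%:R : F) != 0 ->
  in_weight rZ (content u) -> exists w', sdom w' (content u) /\ in_weight rZ w'.
Proof.
move=> ei oj ui0 uj Zw; set w := content u.
have ui z : u z != i.
  move: ui0; rewrite ffunE => /eqP; rewrite cards_eq0 => /eqP/setP/(_ z).
  by rewrite !inE => ->.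
have [x ux] : exists x, u x = j.
  apply: NNPP => h; case/eqP: uj; rewrite ffunE (_ : [set x | _] = set0) ?cards0 //.
  by apply/setP => x; rewrite !inE; apply/negbTE/eqP => e; apply: h; exists x.
have ltij : (i < j)%N by move: ei oj; rewrite /oddc; lia.
pose upd y : coloring n := [ffun z => if z == y then i else u z].
have updi y z : (upd y z == i) = (z == y).
  by rewrite ffunE; case: (z == y); rewrite ?eqxx // (negbTE (ui z)).
pose v := upd x.
have vx : v x = i by rewrite /v ffunE eqxx.
have vz z : z != x -> v z = u z by rewrite /v ffunE => /negbTE ->.
have mixed y : oddc (u y) != oddc (v y) -> y = x.
  by move=> ne; apply/eqP; apply: contraNT ne => /vz ->.
have gd1 : good F u v.
  apply: goodP => y z uyz vyz ne; rewrite (mixed y) // (mixed z) //.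
  by rewrite -uyz -vyz.
have gd2 : good F v u.
  apply: goodP => y z vyz uyz ne; rewrite (mixed y) 1?eq_sym // (mixed z) //.
  by rewrite eq_sym -uyz -vyz.
exists (content v); split.
  apply: lt_content_sdom => [z|e]; last by have := ui x; rewrite -e vx eqxx.
  by have [->|ne] := eqVneq z x; rewrite ?vx ?ux ?(ltnW ltij) // vz.
have h1 := xi_end gd1; have h2 := xi_end gd2.
pose Z := xi F u v *m xi F v u.
have hZ : End_T Z by apply: intertwinesM h1 h2.
pose nu : F := (content u j)%:R.
have xiu r : ent (xi F u v) u r != 0 -> exists2 y, u y = j & r = upd y.
  case/xi_supp => g [gu ->]; exists (g x); first by rewrite {1}gu cact_perm.
  apply/ffunP => z; rewrite cactE /v !ffunE -(inj_eq (@perm_inj _ g)) permKV.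
  by rewrite [in RHS]gu cactE.
(* The intermediate colorings are the [upd y] with [u y = j]. The way back must restore the only
   point of color [i], so only [u] is reached, once for each [y], with cancelling signs. *)
have Zu t : ent Z u t = nu * (u == t)%:R.
  rewrite entM; have [<-|ne] := eqVneq u t; last first.
    rewrite mulr0 big1 // => r _; apply/eqP; apply: contraNT ne; rewrite mulf_eq0 negb_or.
    case/andP=> /xiu[y uy ->] /xi_supp[h [yh ->]]; apply/eqP/ffunP => z.
    have hx : h x = y.
      by apply/eqP; rewrite -updi yh cact_perm vx eqxx.
    rewrite -{2}(permKV h z) cact_perm.
    have [zy|zy] := eqVneq z y; first by rewrite zy -hx permK ux hx.
    have -> : u z = upd y z by rewrite ffunE (negbTE zy).
    rewrite yh cactE vz //; apply: contraNneq zy => e.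
    by rewrite -hx -e permKV.
  rewrite mulr1 (bigID (fun r => r \in [set upd y | y in [set y | u y == j]])) /=.
  rewrite [X in _ + X]big1 ?addr0; last first.
    move=> r nr; apply/eqP; apply: contraNT nr; rewrite mulf_eq0 negb_or => /andP[/xiu[y uy ->] _].
    by apply: imset_f; rewrite inE uy eqxx.
  rewrite big_imset /=; last first.
    by move=> y y' _ _ e; apply/eqP; rewrite -updi -e updi.
  rewrite (eq_bigr (fun=> 1)); last first.
    move=> y; rewrite inE => /eqP uy; pose g := tperm x y.
    have gu : cact u g = u.
      apply/eqP; rewrite cact_eq; apply/forallP => z; apply/eqP.
      by rewrite /g; case: tpermP => [->|->|]; rewrite ?ux ?uy.
    have gv : cact v g = upd y.
      apply/eqP; rewrite cact_eq; apply/forallP => z; apply/eqP.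
      rewrite /v !ffunE /g; case: tpermP => [->|->|/eqP zx /eqP zy]; first by rewrite !eqxx.
        by rewrite ux uy eq_sym.
      by rewrite (negbTE zx) (negbTE zy).
    have e1 := xi_val g gd1; have e2 := xi_val g gd2; rewrite gu gv in e1 e2.
    by rewrite e1 e2 mulrACA [sg u g * sg v g]mulrC mulrACA !sg_sqr mulr1.
  by rewrite sumr_const /nu ffunE.
have eZ : Z = nu *: wproj w.
  apply: entP => s t; rewrite entZ ent_kmx.
  have [cs|cs] := eqVneq (content s) w; last first.
    rewrite andbF mulr0 entM big1 // => r _; apply/eqP; apply: contraNT cs.
    rewrite mulf_eq0 negb_or => /andP[/xi_supp[g [-> _]] _]; by rewrite content_cact.
  have [g gs] := content_orbit (esym cs); rewrite andbT.
  move/endT_P: hZ => /(_ g u (cact t g^-1)); rewrite cactKV gs => ->.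
  rewrite Zu; have [<-|ne] := eqVneq s t; first by rewrite -gs cactK eqxx sg_sqr mul1r.
  have /negbTE-> : u != cact t g^-1; last by rewrite !mulr0.
  by apply: contraNneq ne => e; rewrite -gs e cactKV.
apply: (in_weight_trans (C := nu^-1 *: xi F u v) (D := xi F v u) _ h2 _ Zw).
  exact: intertwinesZ.
rewrite -!scalemxAl (proj2 (xi_proj F u v)) -/Z eZ scalerA mulVf // scale1r.
by [].
Qed.

End WeightMoves.

(** * Labelling of the indecomposable summands *)

Section Labels.
Import GRing.Theory.
Local Open Scope ring_scope.
Variables (F : fieldType) (n : nat).
Hypothesis two_neq0 : (2%:R : F) != 0.
Implicit Types (w : weight n).
Notation T := (Trep F n).
Notation "'End_T' X" := (intertwines (Trep F n) (Trep F n) X) (at level 10).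
Notation wproj := (wproj F).

(** In the local endomorphism ring of [rZ] a sum is invertible only if some term is, and each term
    factors through a single higher weight space. *)
Lemma unit_through_higher m (rZ : mx_representation F (Sgroup n) m) w X A B :
    indec rZ -> higher w X -> intertwines rZ T A -> intertwines T rZ B ->
    A *m X *m B \in unitmx ->
  exists w', sdom w' w /\ in_weight rZ w'.
Proof.
move=> iZ hX hA hB; elim: hX => [|w' C D {}X d hC hD h1 h2 h3 hX IH].
  case: iZ => m0 _; rewrite mulmx0 mul0mx -row_free_unit /row_free mxrank0 => /eqP e.
  by rewrite -e in m0.
have [hX' _ _] := higher_end hX.
rewrite mulmxDr mulmxDl => u.
have hACDB : intertwines rZ rZ (A *m (C *m D) *m B).
  by apply: intertwinesM hB; apply: intertwinesM hA _; apply: intertwinesM hD.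
have hAXB : intertwines rZ rZ (A *m X *m B).
  by apply: intertwinesM hB; apply: intertwinesM hX'.
case: (indec_unit_sum iZ hACDB hAXB u) => [u1|]; last exact: IH.
exists w'; split=> //; exists (A *m C), (D *m B *m invmx (A *m (C *m D) *m B)); split.
- exact: intertwinesM hA hC.
- by apply: intertwinesM (intertwinesV hACDB); apply: intertwinesM hD hB.
- by rewrite -(mulmxA A) h2 -(mulmxV u1) !mulmxA.
Qed.

Definition weight_functional w (phi : 'M[F]_(dimT n) -> F) :=
  [/\ forall X Y, phi (X + Y) = phi X + phi Y, forall a X, phi (a *: X) = a * phi X,
      phi (wproj w) = 1 & forall X, higher w X -> phi X = 0].

Definition in_corner w X := [/\ End_T X, wproj w *m X = X & X *m wproj w = X].

Lemma in_cornerM w X Y : in_corner w X -> in_corner w Y -> in_corner w (X *m Y).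
Proof.
case=> hX wX Xw [hY wY Yw]; split; first exact: intertwinesM hX hY.
  by rewrite mulmxA wX.
by rewrite -mulmxA Yw.
Qed.

Section Functional.
Variables (w : weight n) (phi : 'M[F]_(dimT n) -> F).
Hypothesis wphi : weight_functional w phi.

Lemma functional_decomp X : in_corner w X -> exists H, higher w H /\ X = phi X *: wproj w + H.
Proof.
case=> hX wX Xw; have [phiD phiZ phi1 phi0] := wphi.
have [a [H [hH e]]] := end_spanned two_neq0 hX wX Xw.
by exists H; split=> //; rewrite {2}e phiD phiZ phi1 mulr1 (phi0 _ hH) addr0.
Qed.

Lemma functional_ker X : in_corner w X -> phi X = 0 -> higher w X.
Proof. by move=> cX p0; have [H [hH ->]] := functional_decomp cX; rewrite p0 scale0r add0r. Qed.

(** Modulo the ideal of higher endomorphisms the corner consists of scalars, and [phi] is the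
    quotient map. *)
Lemma functionalM X Y : in_corner w X -> in_corner w Y -> phi (X *m Y) = phi X * phi Y.
Proof.
move=> cX cY; have [phiD phiZ phi1 phi0] := wphi.
have [H [hH eX]] := functional_decomp cX; have [hX wX Xw] := cX; have [hY wY Yw] := cY.
rewrite {1}eX mulmxDl -scalemxAl wY phiD phiZ (phi0 (H *m Y)) ?addr0 //.
exact: higher_mulr.
Qed.

Lemma functional_idem X : in_corner w X -> X *m X = X -> phi X <> 0 -> phi X = 1.
Proof.
move=> cX XX /eqP nz; apply: (mulfI nz).
by rewrite -functionalM // XX mulr1.
Qed.

(** Transported to the tensor space, the powers of [A *m C *m B] have the nonzero values
    [phi C ^+ k]; so this endomorphism is not nilpotent, and Fitting's lemma applies. *)
Lemma functional_unit m (rZ : mx_representation F (Sgroup n) m) A B C :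
    indec rZ -> retract rZ T A B -> in_corner w (B *m A) -> phi (B *m A) <> 0 ->
    in_corner w C -> phi C <> 0 ->
  A *m C *m B \in unitmx.
Proof.
move=> iZ [hA hB AB] cE phE cC /eqP phC; have [hC wC Cw] := cC.
have phE1 : phi (B *m A) = 1.
  by apply: functional_idem phE => //; rewrite mulmxA -(mulmxA B A B) AB mulmx1.
pose X := A *m C *m B.
have hX : intertwines rZ rZ X by apply: intertwinesM hB; apply: intertwinesM hC.
have [//|[k Xk]] := indec_unit_or_nilpotent iZ hX.
have : forall k, in_corner w (B *m X ^+ k *m A) /\ phi (B *m X ^+ k *m A) = phi C ^+ k.
  elim=> [|j [IH1 IH2]]; first by rewrite mulmx1 phE1.
  have -> : B *m X ^+ j.+1 *m A = (B *m X ^+ j *m A) *m (C *m (B *m A)).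
    by rewrite exprSr /X !mulmxA.
  have cCE := in_cornerM cC cE.
  split; first exact: in_cornerM.
  by rewrite !functionalM // IH2 phE1 mulr1 exprSr.
case/(_ k) => _; rewrite Xk mulmx0 mul0mx => e.
have : phi C ^+ k != 0 by apply: expf_neq0.
have [_ phiZ _ _] := wphi; have := phiZ 0 0; rewrite scale0r mul0r => p0.
by rewrite -e p0 eqxx.
Qed.

Definition label_module m (rY : mx_representation F (Sgroup n) m) :=
  indec rY /\ exists A B, [/\ retract rY T A B, in_corner w (B *m A) & phi (B *m A) <> 0].

(** The invertible endomorphism [A *m (D *m C) *m B] of [rZ] factors through [rY], so [rZ] is a
    summand of the indecomposable [rY]. *)
Lemma label_module_rsim m k (rZ : mx_representation F (Sgroup n) m)
    (rY : mx_representation F (Sgroup n) k) :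
  label_module rZ -> label_module rY -> mx_rsim rZ rY.
Proof.
case=> iZ [A [B [rtZ cZ pZ]]] [iY [C [D [rtY cY pY]]]].
have u := functional_unit iZ rtZ cZ pZ cY pY.
have [hA hB AB] := rtZ; have [hC hD CD] := rtY.
have hU : intertwines rZ rZ (A *m (D *m C) *m B).
  by apply: intertwinesM hB; apply: intertwinesM hA _; apply: intertwinesM hD hC.
apply: (@retract_rsim F _ _ _ _ rZ rY (A *m D) (C *m B *m invmx (A *m (D *m C) *m B))).
- by case: iZ.
- by [].
split.
- exact: intertwinesM hA hD.
- by apply: intertwinesM (intertwinesV hU); apply: intertwinesM hC hB.
- by rewrite -(mulmxV u) !mulmxA.
Qed.

(** If [phi] killed the idempotent of [rZ], that idempotent would be higher; the one of the
    isomorphic [rY] factors through it and would be killed too. *)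
Lemma label_module_rsimI m k (rZ : mx_representation F (Sgroup n) m)
    (rY : mx_representation F (Sgroup n) k) A B :
    retract rZ T A B -> in_corner w (B *m A) -> mx_rsim rZ rY -> label_module rY ->
  phi (B *m A) <> 0.
Proof.
move=> [hA hB AB] cE sim [_ [C [D [[hC hD CD] cY pY]]]] p0.
case: sim => V emk Vfree hV; subst k.
have uV : V \in unitmx by rewrite -row_free_unit.
have hE := functional_ker cE p0.
have hP : intertwines rY T (invmx V *m A).
  move=> g Gg; apply: (can_inj (mulKmx uV)); rewrite !mulmxA mulmxV // mul1mx -hV //.
  by rewrite mulmxK // hA.
pose P := D *m invmx V *m A; pose Q := B *m V *m C.
have cP : [/\ End_T P, End_T Q, wproj w *m P = P & Q *m wproj w = Q].
  have [_ wY Yw] := cY.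
  have wD : wproj w *m D = D.
    by rewrite -{1}[D]mulmx1 -CD (mulmxA D) mulmxA wY -mulmxA CD mulmx1.
  have Cw : C *m wproj w = C.
    by rewrite -{1}[C]mul1mx -CD -!mulmxA (mulmxA D) Yw mulmxA CD mul1mx.
  split.
  - by rewrite /P -mulmxA; apply: intertwinesM hD hP.
  - by rewrite /Q -mulmxA; apply: intertwinesM hB _; apply: intertwinesM hV hC.
  - by rewrite /P !mulmxA wD.
  - by rewrite /Q -mulmxA Cw.
case: cP => hP' hQ wP Qw.
have [_ phiZ _ phi0] := wphi; apply: pY.
have -> : D *m C = P *m (B *m A) *m Q.
  rewrite /P /Q !mulmxA -(mulmxA _ A B) AB mulmx1 -(mulmxA _ A B) AB mulmx1.
  by rewrite -(mulmxA D) mulVmx // mulmx1.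
by apply: phi0; apply: higher_mulr => //; apply: higher_mull.
Qed.

(** The form is 1 on [wproj w], which is the sum of the idempotents of an indecomposable
    decomposition; so it is nonzero on one of them. *)
Lemma label_module_exists m (rM : mx_representation F (Sgroup n) m) A B :
    retract rM T A B -> B *m A = wproj w ->
  exists Y : fmod F n, label_module (frepr Y).
Proof.
case=> hA hB AB BA; pose M := FMod rM.
have [k [U [modU [dU iU]]]] := indecomposable_decomposition M.
have [C [D [rt sDC _]]] := direct_decomp_retracts modU dU.
have [phiD phiZ phi1 phi0] := wphi.
apply: NNPP => no.
have phi00 : phi 0 = 0 by have := phiZ 0 0; rewrite scale0r mul0r.
have : phi (wproj w) = 0.
  have -> : wproj w = \sum_i (B *m (D i *m C i) *m A).
    by rewrite -mulmx_suml -mulmx_sumr sDC mulmx1.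
  apply: (big_ind (fun X => phi X = 0)) => // [X Y hX hY|i _]; first by rewrite phiD hX hY addr0.
  apply: NNPP => nz; apply: no; exists (summand (modU i)); split.
    exact/indecomposable_indec/iU.
  have [hC hD CD] := rt i.
  exists (C i *m A), (B *m D i).
  have e : B *m D i *m (C i *m A) = B *m (D i *m C i) *m A by rewrite !mulmxA.
  rewrite e; split=> //.
  - split; first exact: intertwinesM hC hA; first exact: intertwinesM hB hD.
    by rewrite -mulmxA (mulmxA A) AB mul1mx.
  - split.
    + by apply: intertwinesM hA; apply: intertwinesM hB _; apply: intertwinesM hD hC.
    + by rewrite -BA !mulmxA -(mulmxA B A B) AB mulmx1.
    + by rewrite -BA -!mulmxA (mulmxA A B A) AB mul1mx.
by rewrite phi1 => /eqP; rewrite oner_eq0.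
Qed.

(** The summands isomorphic to [Y] are those with [phi (E i)] nonzero. One exists since the [E i]
    add up to [wproj w]; two cannot, since the [E i] are orthogonal and [phi] is multiplicative. *)
Lemma label_multiplicity_one (M Y : fmod F n) A B :
    retract (frepr M) T A B -> B *m A = wproj w -> label_module (frepr Y) ->
  multiplicity_one M Y.
Proof.
case=> hA hB AB BA lY k U modU dU iU.
have [C [D [rt sDC oDC]]] := direct_decomp_retracts modU dU.
have [phiD phiZ phi1 phi0] := wphi.
pose E i := B *m D i *m (C i *m A).
have rtE i : retract (frepr (summand (modU i))) T (C i *m A) (B *m D i).
  have [hC hD CD] := rt i; split; first exact: intertwinesM hC hA; first exact: intertwinesM hB hD.
  by rewrite -mulmxA (mulmxA A) AB mul1mx.
have cE i : in_corner w (E i).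
  have [hC hD CD] := rt i; split.
  - by apply: intertwinesM; [apply: intertwinesM hB hD | apply: intertwinesM hC hA].
  - by rewrite -BA /E !mulmxA -(mulmxA B A B) AB mulmx1.
  - by rewrite -BA /E -!mulmxA (mulmxA A B A) AB mul1mx.
have iff i : fmod_iso (summand (modU i)) Y <-> phi (E i) <> 0.
  split=> [sim|nz]; first exact: label_module_rsimI (rtE i) (cE i) sim lY.
  apply: (label_module_rsim _ lY); split; first exact/indecomposable_indec/iU.
  by exists (C i *m A), (B *m D i); split; [exact: rtE | exact: cE | exact: nz].
have EE i j : i <> j -> E i *m E j = 0.
  move=> /eqP ij; transitivity (B *m (D i *m C i *m (D j *m C j)) *m A).
    by rewrite /E !mulmxA -(mulmxA _ A B) AB mulmx1.
  by rewrite oDC // mulmx0 mul0mx.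
have [i hi] : exists i, phi (E i) <> 0.
  apply: NNPP => no; have : phi (wproj w) = 0.
    have -> : wproj w = \sum_i E i.
      rewrite -BA -[B in LHS]mulmx1 -sDC mulmx_sumr mulmx_suml; apply: eq_bigr => i _.
      by rewrite /E !mulmxA.
    have phi00 : phi 0 = 0 by have := phiZ 0 0; rewrite scale0r mul0r.
    apply: (big_ind (fun X => phi X = 0)) => // [X Z hX hZ|i _]; first by rewrite phiD hX hZ addr0.
    by apply: NNPP => nz; apply: no; exists i.
  by rewrite phi1 => /eqP; rewrite oner_eq0.
exists i; split; first exact/iff.
move=> j /iff hj; apply: NNPP => ij.
have := functionalM (cE j) (cE i); rewrite EE //.
have := phiZ 0 0; rewrite scale0r mul0r => -> /esym/eqP; rewrite mulf_eq0.
by move/eqP: hi; move/eqP: hj => /negbTE-> /negbTE->.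
Qed.

End Functional.

Definition valid p lam mu :=
  [/\ is_partition lam, is_partition mu & (psize lam + p * psize mu)%N = n].

(** The module is pushed to ever higher weights of which it is a summand. Heights are bounded, so
    this ends at a weight (lam|p mu) whose form does not kill the idempotent. *)
Lemma indec_has_label p (Y : seq nat -> seq nat -> fmod F n)
    (phi : seq nat -> seq nat -> 'M[F]_(dimT n) -> F) :
    p \in [pchar F] ->
    (forall lam mu, valid p lam mu -> weight_functional (wt n lam (pscale p mu)) (phi lam mu)) ->
    (forall lam mu, valid p lam mu ->
       label_module (wt n lam (pscale p mu)) (phi lam mu) (frepr (Y lam mu))) ->
  forall m (rZ : mx_representation F (Sgroup n) m) w, indec rZ -> in_weight rZ w ->
  exists lam mu, [/\ valid p lam mu, domw (wt n lam (pscale p mu)) w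
    & mx_rsim rZ (frepr (Y lam mu))].
Proof.
move=> hp hphi hY m rZ w iZ.
have p_gt0 : (0 < p)%N by apply: prime_gt0; case/andP: hp.
have [k] := ubnP (((n.+1 + n.+1).+1 * n).+1 - height w)%N.
elim: k w => // k IH w hk Zw.
have [u cu] : exists u : coloring n, content u = w.
  apply: NNPP => nou; have [A [B [_ _ AB]]] := Zw.
  have w0 : wproj w = 0.
    apply: entP => u v; rewrite ent_kmx ent0; case: eqP => [_|//] /=.
    by case: eqP => // cu; case: nou; exists u.
  move: AB; rewrite w0 mulmx0 mul0mx => /(congr1 mxrank); rewrite mxrank0 mxrank1 => m0.
  by have [lt _] := iZ; rewrite -m0 in lt.
have improve w' : sdom w' w -> in_weight rZ w' ->
    exists lam mu, [/\ valid p lam mu, domw (wt n lam (pscale p mu)) w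
      & mx_rsim rZ (frepr (Y lam mu))].
  move=> d Zw'; have [|lam [mu [v1 v2 v3]]] := IH w' _ Zw'.
    have := height_sdom d; have := height_content u; rewrite cu.
    move: hk; set a := ((n.+1 + n.+1).+1 * n)%N; lia.
  by exists lam, mu; split=> //; apply: domw_trans v2 (proj1 d).
have [[lam [mu [pl pm s e]]]|[i [j [ij oij wij]]]|[c [oc nd]]] := weight_cases u p_gt0.
- have v : valid p lam mu by [].
  rewrite cu in e; have wphi := hphi _ _ v; rewrite -e in wphi.
  have [A [B [hA hB AB]]] := Zw.
  pose A' := A *m wproj w; pose B' := wproj w *m B.
  have AB' : A' *m B' = 1%:M by rewrite /A' /B' mulmxA -(mulmxA A) wproj_idem AB.
  have rt : retract rZ T A' B'.
    by split=> //; [apply: intertwinesM hA _ | apply: intertwinesM _ hB]; apply: wproj_end.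
  have cE : in_corner w (B' *m A').
    split; first by case: rt => h1 h2 _; apply: intertwinesM h2 h1.
      by rewrite /B' !mulmxA wproj_idem.
    by rewrite /A' -!mulmxA wproj_idem.
  (* A killed idempotent is higher, and locality then makes [rZ] a summand of a higher weight
     space. *)
  clearbody A' B'; have [p0|np] := classic (phi lam mu (B' *m A') = 0).
    have [|||w' [d Zw']] := @unit_through_higher _ _ w _ A' B' iZ (functional_ker wphi cE p0).
    + by case: rt.
    + by case: rt.
    + by rewrite !mulmxA AB' mul1mx AB' unitmx1.
    exact: improve d Zw'.
  exists lam, mu; split=> //; first by rewrite -e.
  have hYv := hY _ _ v; rewrite -e in hYv.
  by apply: (label_module_rsim wphi _ hYv); split=> //; exists A', B'.
- rewrite cu in wij; have [w' [d Zw']] := swap_weight ij oij wij Zw.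
  exact: improve d Zw'.
- rewrite cu in nd.
  (* There are [n.+1] even colors but only [n] points. *)
  have [i [ei ui]] : exists i : color n, ~~ oddc i /\ content u i = 0%N.
    apply: NNPP => no; have := sum_content u; rewrite big_split_ord /= => e.
    have : (\sum_(i < n.+1) 1 <= \sum_(i < n.+1) content u (lshift n.+1 i))%N.
      apply: leq_sum => i _; rewrite lt0n; apply/eqP => c0; apply: no.
      by exists (lshift n.+1 i); split=> //; rewrite /oddc /= -leqNgt -ltnS.
    rewrite sum_nat_const card_ord muln1 => lt.
    by move: (leq_addr (\sum_(i < n.+1) content u (rshift n.+1 i)) (\sum_(i < n.+1) content u (lshift n.+1 i))); rewrite e leqNgt lt.
  rewrite -cu in Zw nd; have [|w' [d Zw']] := move_box_weight ei oc ui _ Zw.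
    by rewrite -(dvdn_pcharf hp).
  by rewrite cu in d; exact: improve d Zw'.
Qed.

End Labels.

(** * The column functional *)

Section Counting.
Import GroupScope.

Lemma card_le_fibers (n : nat) (T : eqType) (f : 'I_n -> T) (Q R : pred 'I_n) :
  (forall x0, #|[set x | Q x & f x == f x0]| <= #|[set x | R x & f x == f x0]|) ->
  #|[set x | Q x]| <= #|[set x | R x]|.
Proof.
(* [r] picks one representative in each fiber, so that the fibers are indexed by a finite type
   although [T] is only an [eqType]. *)
move=> h; pose r x := odflt x [pick y | f y == f x].
have fr x : f (r x) = f x by rewrite /r; case: pickP => [y /eqP|].
have rE x y : (r x == r y) = (f x == f y).
  apply/eqP/eqP => [e|e]; first by rewrite -fr e fr.
  rewrite /r; have -> : [pick z | f z == f x] = [pick z | f z == f y] by apply: eq_pick => z; rewrite e.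
  by case: pickP => // /(_ y); rewrite eqxx.
rewrite -!sum1_card (partition_big r predT) // [X in _ <= X](partition_big r predT) //=; apply: leq_sum => j _.
have [/existsP[x0 /eqP <-]|] := boolP [exists x, r x == j].
  have := h x0; rewrite -!sum1_card.
  by congr (_ <= _); apply: eq_bigl => x; rewrite !inE rE.
rewrite negb_exists => /forallP nj; rewrite big1 // => x /andP[_ e].
by have := nj x; rewrite e.
Qed.

(** [B] contains exactly one point of every 2-cycle, and [g] is the product of the transpositions of
    [x] and [g x] for [x] in [B]. *)
Lemma odd_involution (n : nat) (g : 'S_n) (B : {set 'I_n}) :
    (forall x, g (g x) = x) ->
    (forall x, x \in B -> g x \notin B) ->
    (forall x, g x != x -> (x \in B) || (g x \in B)) ->
  odd_perm g = odd #|B|.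
Proof.
move=> gg gB gx.
have key (s : seq 'I_n) : uniq s -> (forall x, x \in s -> g x \notin s) ->
    (forall y, (\prod_(x <- s) tperm x (g x)) y = if (y \in s) || (g y \in s) then g y else y)
    /\ odd_perm (\prod_(x <- s) tperm x (g x)) = odd (size s).
  elim: s => [|x s IH] us hs.
    by rewrite big_nil odd_perm1; split=> // y; rewrite perm1.
  have /andP[xs us'] := us; have gxs := hs x (mem_head _ _).
  move: (gxs); rewrite inE negb_or => /andP[gxx gxs'].
  have [|IH1 IH2] := IH us'.
    move=> y ys; have := hs y; rewrite inE ys orbT => /(_ isT).
    by rewrite inE negb_or => /andP[].
  rewrite big_cons; split; last by rewrite odd_permM IH2 odd_tperm eq_sym gxx.
  move=> y; rewrite permM IH1 !inE.
  case: tpermP => [->|->|/eqP yx /eqP ygx].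
  - by rewrite gg eqxx /= (negbTE gxs') (negbTE xs).
  - by rewrite gg eqxx orbT (negbTE xs) (negbTE gxs').
  rewrite (negbTE yx) /=; have -> : (g y == x) = false; last by [].
  by apply: contraNF ygx => /eqP <-; rewrite gg.
have [|h1 h2] := key (enum B) (enum_uniq _).
  by move=> x; rewrite !mem_enum; apply: gB.
rewrite cardE -h2; congr odd_perm; apply/permP => y; rewrite h1 !mem_enum.
by case: ifP => // ny; apply/eqP; apply: contraFT ny => /gx.
Qed.

End Counting.

Section PGroupSum.
Import GRing.Theory.
Local Open Scope group_scope.
Local Open Scope ring_scope.

(** The orbits of non-fixed points have size divisible by [p], and [f] is constant on them. *)
Lemma pgroup_sum (F : fieldType) (p : nat) (gT : finGroupType) (sT : finType)
    (P : {group gT}) (to : {action gT &-> sT}) (A : {set sT}) (f : sT -> F) :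
    p \in [pchar F] -> p.-group P -> [acts P, on A | to] ->
    (forall x s, x \in P -> s \in A -> f (to s x) = f s) ->
  \sum_(s in A) f s = \sum_(s in 'Fix_(A | to)(P)) f s.
Proof.
move=> hp pP actA fP.
rewrite (big_setID 'Fix_to(P)) /= [X in _ + X](_ : _ = 0) ?addr0; first by rewrite setIC.
rewrite (partition_big (orbit to P) (fun O => O \in orbit to P @: (A :\: 'Fix_to(P)))) /=; last first.
  by move=> s sA; apply: imset_f.
apply: big1 => _ /imsetP[s sA ->]; move: sA; rewrite inE => /andP[sF sA].
rewrite (eq_bigl (mem (orbit to P s))) /=; last first.
  move=> t; apply/andP/idP => [[_ /eqP <-]|tO]; first exact: orbit_refl.
  have e : orbit to P t = orbit to P s by apply/orbit_eqP.
  rewrite e eqxx; split=> //; rewrite inE; apply/andP; split; last first.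
    by have := acts_sub_orbit s actA; rewrite sA => /subsetP/(_ t tO).
  apply: contra sF => tF; have : s \in orbit to P t by rewrite orbit_sym.
  by case/orbitP => x xP <-; rewrite (afixP tF).
rewrite (eq_bigr (fun=> f s)); last by move=> t /orbitP[x xP <-]; apply: fP.
rewrite sumr_const -mulr_natr.
have : p.-nat #|orbit to P s| by rewrite card_orbit; apply: pnat_dvd (dvdn_indexg _ _) pP.
case/p_natP => -[|k] ek; last first.
  by rewrite ek natrX (pcharf0 hp) exprS mul0r mulr0.
case/negP: sF; apply/afixP => x xP; apply/set1P.
have /cards1P[t et] : #|orbit to P s| == 1%N by rewrite ek.
have := orbit_refl to P s; rewrite et => /set1P->; rewrite -et.
have : to s x \in orbit to P s by apply: mem_orbit.
by have := orbit_refl to P s; rewrite et => /set1P->.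
Qed.

(** On the stabilizer of [u] the sign is a homomorphism with values of square 1, hence trivial on
    elements of odd order. *)
Lemma sg_pgroup (F : fieldType) (n : nat) (P : {group 'S_n}) (u : coloring n) (x : 'S_n) :
  odd #|P| -> x \in P -> (forall y, y \in P -> cact u y = u) -> sg F u x = 1.
Proof.
move=> oP xP uP; have ux := uP x xP.
have sgX k : sg F u (x ^+ k)%g = sg F u x ^+ k.
  by elim: k => [|k IH]; [rewrite sg1 | rewrite expgS exprS sgM ux IH].
have ox : odd #[x] by apply: dvdn_odd oP; apply: order_dvdG.
have := sgX #[x]; rewrite expg_order sg1 -(odd_double_half #[x]) ox add1n exprS.
by rewrite -mul2n exprM expr2 sg_sqr expr1n mulr1 => <-.
Qed.

End PGroupSum.

Section RelativeTrace.
Import GRing.Theory.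
Local Open Scope ring_scope.
Variables (F : fieldType) (gT : finGroupType) (G R : {group gT}) (m : nat).
Variables (rG : mx_representation F G m) (f : 'M[F]_m).
Hypotheses (sRG : R \subset G) (fR : forall r, r \in R -> rG r *m f = f *m rG r).

Definition rel_trace := \sum_(D in rcosets R G) (rG (repr D)^-1%g *m f *m rG (repr D)).

Lemma repr_rcosets D : D \in rcosets R G -> [/\ repr D \in D, D = (R :* repr D)%g & repr D \in G].
Proof.
case/rcosetsP => g gG ->; have h := mem_repr_rcoset R g.
split=> //; first by rewrite (rcoset_eqP h).
by case/rcosetP: h => r rR ->; rewrite groupM // (subsetP sRG).
Qed.

Lemma conj_rcoset r g : r \in R -> g \in G ->
  rG (r * g)^-1%g *m f *m rG (r * g)%g = rG g^-1%g *m f *m rG g.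
Proof.
move=> rR gG; have rG' := subsetP sRG r rR.
have e1 : rG r^-1%g *m rG r = 1%:M by rewrite -repr_mxM ?groupV // mulVg repr_mx1.
rewrite invMg !repr_mxM ?groupV // -!mulmxA (mulmxA f) -fR // !mulmxA.
by rewrite -(mulmxA _ (rG r^-1%g)) e1 mulmx1.
Qed.

(** Right multiplication by [h] permutes the cosets of [R], and by [conj_rcoset] the summand of a
    coset does not depend on its representative. *)
Lemma rel_trace_intertwines : intertwines rG rG rel_trace.
Proof.
move=> h hG; have eh : rG h *m rG h^-1%g = 1%:M by rewrite -repr_mxM ?groupV // mulgV repr_mx1.
suff e : rG h^-1%g *m rel_trace *m rG h = rel_trace by rewrite -{1}e !mulmxA eh mul1mx.
rewrite mulmx_sumr mulmx_suml /rel_trace.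
have hact D : ((D :* h)%g \in rcosets R G) = (D \in rcosets R G).
  have sub D' h' : h' \in G -> D' \in rcosets R G -> (D' :* h')%g \in rcosets R G.
    by move=> h'G /rcosetsP[g gG ->]; rewrite -rcosetM; apply/rcosetsP; exists (g * h')%g; rewrite ?groupM.
  by apply/idP/idP => [/(sub _ h^-1%g)|/sub]; rewrite ?rcosetK; apply; rewrite ?groupV.
rewrite [RHS](reindex_inj (can_inj (rcosetK h))) /=; apply: eq_big => [D|D DR]; first by rewrite hact.
have [rD eD rDG] := repr_rcosets DR.
have [|rD' _ _] := @repr_rcosets (D :* h)%g; first by rewrite hact.
have : repr (D :* h)%g \in (R :* (repr D * h))%g by rewrite rcosetM -eD.
case/rcosetP => r rR ->; rewrite conj_rcoset ?groupM // invMg !repr_mxM ?groupV //.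
by rewrite !mulmxA.
Qed.

End RelativeTrace.

Section ColumnFunctional.
Import GRing.Theory.
Local Open Scope group_scope.
Local Open Scope ring_scope.
Variables (F : fieldType) (n p : nat).
Hypotheses (oddp : odd p) (charp : p \in [pchar F]).
Implicit Types (g h c : 'S_n) (x y z : 'I_n) (u v s t : coloring n).
Notation "'End_T' X" := (intertwines (Trep F n) (Trep F n) X) (at level 10).
Notation sg := (sg F).
Notation wproj := (wproj F).

(* Coordinates of a point: it lies in a block of size [p ^ lev] sitting in a box of the
   diagram of lam(lev) or, when [par] holds, of mu(lev - 1), at position [off] of the block. *)
Variables (par : 'I_n -> bool) (lev row col off : 'I_n -> nat).
Variable len : bool * nat * nat -> nat.
(** A cell is a block; a line consists of the points with the same offset in the blocks of one
    column, one point for each row. *)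
Definition column x := (par x, lev x, col x).
Definition line x := (column x, off x).
Definition cell x := (column x, row x).

Hypothesis line_row_inj : forall x y, line x = line y -> row x = row y -> x = y.
Hypothesis row_lt_len : forall x, (row x < len (column x))%N.
Hypothesis line_row_surj : forall x r, (r < len (column x))%N ->
  exists y, line y = line x /\ row y = r.
Hypothesis row_lt : forall x, (row x < n.+1)%N.
Hypothesis card_cell : forall x, #|[set y | cell y == cell x]| = (p ^ lev x)%N.
Hypothesis par_lev : forall x, par x -> (0 < lev x)%N.

Variable P : {group 'S_n}.
Hypothesis pP : p.-group P.
Hypothesis P_cell : forall g x, g \in P -> cell (g x) = cell x.
Hypothesis P_trans : forall x y, cell x = cell y -> exists2 g, g \in P & g x = y.

Let p_pr : prime p. Proof. by case/andP: charp. Qed.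

Definition hw_coloring : coloring n := [ffun x => @inord (n + n.+1) (par x * n.+1 + row x)].
Notation us := hw_coloring.

Lemma hw_coloringE x : us x = (par x * n.+1 + row x)%N :> nat.
Proof.
rewrite ffunE (@inordK (n + n.+1)) //; have := row_lt x; clear.
case: (par x); rewrite ?mul1n ?mul0n; lia.
Qed.

Lemma oddc_hw x : oddc (us x) = par x.
Proof.
rewrite /oddc hw_coloringE; have := row_lt x; clear.
case: (par x); rewrite ?mul1n ?mul0n; lia.
Qed.

Lemma hw_eq x y : us x = us y -> par x = par y /\ row x = row y.
Proof.
move=> e; have pe : par x = par y by rewrite -!oddc_hw e.
split=> //; have := congr1 (@nat_of_ord _) e; rewrite !hw_coloringE pe.
by move/addnI.
Qed.

Lemma us_cell x y : cell x = cell y -> us x = us y.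
Proof. by case=> e1 _ _ e2; apply/ord_inj; rewrite !hw_coloringE e1 e2. Qed.

(** These permute whole blocks inside their columns: offsets are kept, and the points of one block
    go to the same row. *)
Definition col_perms : {set 'S_n} := [set g : 'S_n | [forall x, line (g x) == line x] &&
  [forall x, forall y, (cell x == cell y) ==> (row (g x) == row (g y))]].
Notation C := col_perms.

Lemma col_permsP g : reflect ((forall x, line (g x) = line x) /\
  (forall x y, cell x = cell y -> row (g x) = row (g y))) (g \in C).
Proof.
rewrite inE; apply: (iffP andP) => -[h1 h2]; split.
- by move=> x; apply/eqP/(forallP h1).
- by move=> x y /eqP e; apply/eqP; move/forallP/(_ x)/forallP/(_ y)/implyP: h2; apply.
- by apply/forallP => x; apply/eqP.
- by apply/forallP => x; apply/forallP => y; apply/implyP => /eqP /h2 ->.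
Qed.

Lemma line_column x y : line x = line y -> column x = column y.
Proof. exact: (congr1 fst). Qed.

Lemma cell_column x y : cell x = cell y -> column x = column y.
Proof. exact: (congr1 fst). Qed.

Lemma line_par x y : line x = line y -> par x = par y.
Proof. by case. Qed.

Lemma cell_par x y : cell x = cell y -> par x = par y.
Proof. by case. Qed.

Lemma col_permsM g h : g \in C -> h \in C -> (g * h)%g \in C.
Proof.
move=> /col_permsP[g1 g2] /col_permsP[h1 h2]; apply/col_permsP; split=> [x|x y e].
  by rewrite permM h1 g1.
rewrite !permM; apply: h2; rewrite /cell (g2 _ _ e) (line_column (g1 x)) (line_column (g1 y)).
by rewrite (cell_column e).
Qed.

Lemma col_perms_cell g x y : g \in C -> cell x = cell y -> cell (g x) = cell (g y).
Proof.
move=> /col_permsP[g1 g2] e; rewrite /cell (g2 _ _ e) (line_column (g1 x)) (line_column (g1 y)).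
by rewrite (cell_column e).
Qed.

Lemma lift_rows (R : 'I_n -> nat) :
    (forall x, (R x < len (column x))%N) ->
    (forall x y, line y = line x -> row y = R x -> R y = row x) ->
    (forall x y, cell x = cell y -> R x = R y) ->
  exists2 g, g \in C & (forall x, row (g x) = R x) /\ (forall x, g (g x) = x).
Proof.
move=> h1 h2 h3.
pose f x := odflt x [pick y | (line y == line x) && (row y == R x)].
have fP x : line (f x) = line x /\ row (f x) = R x.
  rewrite /f; case: pickP => [y /andP[/eqP -> /eqP ->] //|no].
  have [y [e1 e2]] := line_row_surj (h1 x); have := no y.
  by rewrite e1 e2 !eqxx.
have ff x : f (f x) = x.
  have [e1 e2] := fP x; have [e3 e4] := fP (f x).
  by apply: line_row_inj; rewrite ?e3 ?e1 // e4; apply: h2.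
have gE x : perm (can_inj ff) x = f x by rewrite permE.
exists (perm (can_inj ff)); last by split=> x; rewrite !gE ?ff //; case: (fP x).
apply/col_permsP; split=> [x|x y e]; rewrite !gE; first by case: (fP x).
by rewrite (proj2 (fP x)) (proj2 (fP y)); apply: h3.
Qed.

(* The sign of [c] on the points of the even columns: two blocks of the same odd color
   already anticommute. *)
Definition chi c : F := (-1) ^+ odd_perm c * sg us c.

Lemma odds_us_col g : g \in C -> g @: odds us = odds us.
Proof.
move=> /col_permsP[g1 _]; apply/setP => x.
rewrite -(permKV g x) mem_imset; last exact: perm_inj.
by rewrite !inE !oddc_hw (line_par (g1 _)).
Qed.

Lemma chiM g c : g \in C -> chi (g * c)%g = chi g * chi c.
Proof.
move=> gC; rewrite /chi odd_permM signr_addb sgM mulrACA; congr (_ * (_ * _)).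
by rewrite /sg odds_cact odds_us_col.
Qed.

Lemma chi1 : chi 1%g = 1.
Proof. by rewrite /chi odd_perm1 sg1 mulr1. Qed.

Definition kappa : 'M[F]_(dimT n) := \sum_(c in C) chi c *: Tmx F c.

Definition phi (X : 'M[F]_(dimT n)) : F := ent (X *m kappa) us us.

Lemma phiE X : phi X = \sum_(c in C) chi c * ent (X *m Tmx F c) us us.
Proof.
rewrite /phi mulmx_sumr ent_sum; apply: eq_bigr => c _.
by rewrite -scalemxAr entZ.
Qed.

Lemma phiD X Y : phi (X + Y) = phi X + phi Y.
Proof. by rewrite /phi mulmxDl entD. Qed.

Lemma phiZ a X : phi (a *: X) = a * phi X.
Proof. by rewrite /phi -scalemxAl entZ. Qed.

Lemma kappa_end X : End_T X -> X *m kappa = kappa *m X.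
Proof.
move=> hX; rewrite /kappa mulmx_sumr mulmx_suml; apply: eq_bigr => c _.
by rewrite -scalemxAr -scalemxAl -[X *m _](hX c) ?inE.
Qed.

Lemma col_perm_eq g h : g \in C -> h \in C -> cact us g = cact us h -> g = h.
Proof.
move=> gC hC e; suff : (g^-1 = h^-1)%g by apply: invg_inj.
have inv k : k \in C -> forall x, line (k^-1 x)%g = line x.
  by move=> /col_permsP[k1 _] x; rewrite -{2}(permKV k x) k1.
apply/permP => x; apply: line_row_inj; first by rewrite !inv.
have /ffunP/(_ x) := e; rewrite !cactE => /hw_eq[_ ->].
by [].
Qed.

Lemma phi1 : phi (wproj (content us)) = 1.
Proof.
have C1 : 1%g \in C by apply/col_permsP; split=> [x|x y [_ _ _]]; rewrite !perm1.
rewrite phiE (bigD1 1%g) //= chi1 mul1r big1 ?addr0.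
  by rewrite ent_wmul eqxx mul1r ent_kmx cact1 eqxx sg1.
move=> c /andP[cC c1]; rewrite ent_wmul eqxx mul1r ent_kmx; case: eqP => [e|]; last by rewrite mulr0.
by case/eqP: c1; apply: col_perm_eq => //; rewrite e cact1.
Qed.

Lemma oddP : odd #|P|.
Proof. by have /p_natP[k ->] := pP; rewrite oddX oddp orbT. Qed.

Lemma us_fixed_col c g : c \in C -> g \in P -> cact (cact us c^-1) g = cact us c^-1.
Proof.
move=> cC gP; apply/eqP; rewrite cact_eq; apply/forallP => x; apply/eqP.
rewrite !cactE !invgK; apply/us_cell/col_perms_cell => //.
by rewrite P_cell.
Qed.

Lemma us_fixed g : g \in P -> cact us g = us.
Proof.
move=> gP; apply/eqP; rewrite cact_eq; apply/forallP => x; apply/eqP.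
by apply/us_cell; rewrite P_cell.
Qed.

Lemma sg_fixed t g : (forall g, g \in P -> cact t g = t) -> g \in P -> sg t g = 1.
Proof. by move=> h gP; apply: sg_pgroup oddP gP h. Qed.

Definition cellconst t := forall x y, cell x = cell y -> t x = t y.

Lemma fixed_cellconst t : (forall g, g \in P -> cact t g = t) -> cellconst t.
Proof.
move=> h x y e; have [g gP <-] := P_trans e.
by rewrite -{2}(h g gP) cact_perm.
Qed.

Canonical cact_action := TotalAction (@cact1 n) (@cactM n).

(* The multiplicativity of the Brauer construction with respect to [P]. *)
Lemma brauer_mul X Y c : End_T X -> End_T Y -> c \in C ->
  ent (X *m (Y *m Tmx F c)) us us =
  \sum_(t | [forall g, (g \in P) ==> (cact t g == t)]) ent X us t * ent (Y *m Tmx F c) t us.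
Proof.
move=> /endT_P hX /endT_P hY cC; pose eta := cact us c^-1.
have e t : ent (Y *m Tmx F c) t us = ent Y t eta * sg eta c.
  by rewrite -{1}(cactKV c us) ent_mulT.
rewrite entM (eq_bigl (mem [set: coloring n])); last by move=> t; rewrite /= in_setT.
rewrite (@pgroup_sum F p _ _ P cact_action [set: coloring n]) //.
- apply: eq_bigl => t; rewrite !inE /=; apply/subsetP/forallP => [h g|h g gP].
    by apply/implyP => gP; have := h g gP; rewrite inE => /eqP ->.
  by rewrite inE; apply: (implyP (h g)).
- by apply/actsP => g _ t; rewrite !inE.
(* Summands are constant on orbits of [P]: its signs on [us] and [eta] are trivial, and the sign on
   [t] occurs twice. *)
move=> g t gP _ /=; rewrite !e mulrA [RHS]mulrA; congr (_ * _).
have etaP h : h \in P -> cact eta h = eta := us_fixed_col cC; have usP := us_fixed.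
rewrite -{1}(usP g gP) hX -{1}(etaP g gP) hY (sg_fixed usP) // (sg_fixed etaP) //.
by rewrite mul1r mulr1 mulrACA sg_sqr mul1r.
Qed.

(** Exchanging two blocks of a column offset by offset is a product of as many transpositions as a
    block has points, a power of the odd number [p]. *)
Lemma swap_exists x0 y0 : line x0 = line y0 -> x0 <> y0 ->
  exists2 g, g \in C & [/\ odd_perm g = true, forall x, g (g x) = x
    & forall x, g x <> x -> cell x = cell x0 \/ cell x = cell y0] /\
    forall x, (cell x = cell x0 -> cell (g x) = cell y0) /\ (cell x = cell y0 -> cell (g x) = cell x0).
Proof.
move=> el ne; have ec := line_column el.
have nr : row x0 <> row y0 by move=> er; apply: ne; apply: line_row_inj.
pose R x := if column x == column x0 then
   (if row x == row x0 then row y0 else if row x == row y0 then row x0 else row x) else row x.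
have [| | |g gC [gR gg]] := @lift_rows R.
- move=> x; rewrite /R; case: (column x =P _) => [e|_]; last exact: row_lt_len.
  case: ifP => _; first by rewrite e ec row_lt_len.
  by case: ifP => _; [rewrite e row_lt_len | exact: row_lt_len].
- move=> x y e; rewrite /R (line_column e); case: eqP => // _.
  have [-> ->|nx] := eqVneq (row x) (row x0).
    by rewrite eqxx; case: eqP => // ->.
  have [-> ->|ny ->] := eqVneq (row x) (row y0); first by rewrite eqxx.
  by rewrite (negbTE nx) (negbTE ny).
- by move=> x y e; rewrite /R; rewrite (cell_column e) (congr1 snd e : row x = row y).
have gcol x : column (g x) = column x by have /col_permsP[g1 _] := gC; apply: line_column.
have sw x : (cell x = cell x0 -> cell (g x) = cell y0) /\ (cell x = cell y0 -> cell (g x) = cell x0).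
  have cellE a b : column a = column b -> row a = row b -> cell a = cell b by rewrite /cell => -> ->.
  split=> e; apply: cellE; rewrite ?gcol ?gR /R (cell_column e) ?(congr1 snd e : row x = row _) -?ec ?eqxx //.
  by case: eqP.
have moved x : g x <> x -> cell x = cell x0 \/ cell x = cell y0.
  move=> gx; have gr : R x <> row x.
    move=> e; apply: gx; apply: line_row_inj; last by rewrite gR.
    by have /col_permsP[g1 _] := gC.
  move: gr; rewrite /R; case: (column x =P column x0) => // ek.
  case: eqP => [er _|_]; first by left; rewrite /cell ek er.
  by case: eqP => // er _; right; rewrite /cell ek er ec.
exists g => //; split=> //; split=> //.
rewrite (@odd_involution _ g [set y | cell y == cell x0]) //.
- by rewrite card_cell oddX oddp orbT.
- move=> x; rewrite !inE => /eqP /(proj1 (sw x)) ->.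
  by apply/eqP => e; apply: nr; exact: esym (congr1 snd e).
- move=> x /eqP /moved; rewrite !inE => -[->|/(proj2 (sw x)) ->]; by rewrite eqxx ?orbT.
Qed.

Lemma two_neq0 : (2%:R : F) != 0.
Proof.
rewrite -(dvdn_pcharf charp); apply/negP => /dvdn_leq => /(_ isT).
have := prime_gt1 p_pr; move: oddp; case: (p) => [|[|[|q]]] //.
Qed.

(** The exchange [g] of the two blocks fixes [t], and [chi g * sg t g] is -1; replacing [c] by
    [g * c] in [kappa] turns the entry into its negative. *)
Lemma kappa_kill t x0 y0 (Y : 'M[F]_(dimT n)) v : cellconst t -> line x0 = line y0 -> x0 <> y0 ->
  t x0 = t y0 -> oddc (t x0) = par x0 -> ent (kappa *m Y) t v = 0.
Proof.
move=> ct el ne et ot; have [g gC [[og gg gm] sw]] := swap_exists el ne.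
have tg : cact t g = t.
  apply/eqP; rewrite cact_eq; apply/forallP => x; apply/eqP.
  have [->//|/eqP/gm[] e] := eqVneq (g x) x.
    by rewrite (ct _ _ (proj1 (sw x) e)) (ct _ _ e).
  by rewrite (ct _ _ (proj2 (sw x) e)) (ct _ _ e).
have sgt : sg us g = sg t g.
  apply: eps_eq_on_support; rewrite ?odds_us_col // -?odds_cact ?tg // => z.
  rewrite !inE oddc_hw => nz; apply: NNPP => /gm h.
  have pz : par z = par x0 by case: h => /cell_par -> //; rewrite (line_par el).
  have oz : oddc (t z) = oddc (t x0) by case: h => /ct ->; rewrite ?et.
  by rewrite pz oz ot eqxx in nz.
pose S := ent (kappa *m Y) t v.
have Se : S = \sum_(c in C) chi c * (sg t c * ent Y (cact t c) v).
  rewrite /S /kappa mulmx_suml ent_sum; apply: eq_bigr => c _.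
  by rewrite -scalemxAl entZ ent_Tmul.
have : S = - S.
  rewrite {1}Se (reindex_inj (mulgI g)) /=.
  rewrite Se -sumrN; apply: eq_big => [c|c cC].
    apply/idP/idP => h; last exact: col_permsM.
    have -> : c = (g * (g * c))%g.
      by apply/permP => x; rewrite !permM gg.
    exact: col_permsM.
  rewrite chiM // sgM cactM tg [chi g]/chi og sgt expr1 mulN1r !mulNr; congr (- _).
  by rewrite -(mulrA (sg t g) (sg t c)) mulrACA sg_sqr mul1r.
move=> e; apply/eqP; rewrite -/S; move/eqP: e; rewrite -addr_eq0 -mulr2n -mulr_natr mulf_eq0.
by rewrite (negbTE two_neq0) orbF.
Qed.

(** Lines are compared one at a time: in a line the colors with the parity of the column are
    pairwise distinct, and [us] uses the smallest ones. *)
Lemma content_le t : (forall x, par x -> oddc (t x)) ->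
    (forall x y, line x = line y -> x <> y -> t x = t y -> oddc (t x) <> par x) ->
  domw (content us) (content t).
Proof.
move=> ho hinj k; rewrite !dsum_content.
apply: (@card_le_fibers n _ line (fun x => (t x < k)%N) (fun x => (us x < k)%N)) => x0.
(* [lo] is the first color with the parity of the column, and [k0] counts the colors from [lo] on
   that are below [k]; it is 0 if [k] is at most [lo]. *)
pose lo := (par x0 * n.+1)%N; pose k0 := (k - lo)%N.
set A := [set x | _ & _]; set B := [set x | _ & _].
have inA x : (x \in A) = (t x < k)%N && (line x == line x0) by rewrite inE.
have inB x : (x \in B) = (us x < k)%N && (line x == line x0) by rewrite inE.
have usB x : line x = line x0 -> (us x < k)%N = (row x < k0)%N.
  by move=> /line_par e; rewrite hw_coloringE e /k0 /lo ltn_subRL.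
have [/existsP[x1 /andP[/eqP l1 r1]]|nx] := boolP [exists x, (line x == line x0) && (k0 <= row x)%N]; last first.
  apply/subset_leq_card/subsetP => x; rewrite inA inB => /andP[_ /eqP lx].
  rewrite lx eqxx andbT usB // ltnNge; apply: contra nx => h.
  by apply/existsP; exists x; rewrite lx eqxx.
apply: (@leq_trans k0).
  (* In an even column [k = k0] is at most [row x1], hence at most [n], so colors below [k] are
     even; odd columns carry odd colors by [ho]. *)
  have lep x : x \in A -> oddc (t x) = par x.
    rewrite inA => /andP[tk /eqP/line_par e]; rewrite e; case px: (par x0).
      by apply: ho; rewrite e.
    have := row_lt x1; move: r1; rewrite /k0 /lo px mul0n subn0 /oddc; lia.
  rewrite cardE -(size_map (fun x => t x : nat)) -(size_iota lo k0).
  apply: uniq_leq_size.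
    rewrite map_inj_in_uniq ?enum_uniq // => x y; rewrite !mem_enum => xA yA /ord_inj e.
    apply: NNPP => xy; apply: (hinj x y _ xy e); last exact: lep.
    by move: xA yA; rewrite !inA => /andP[_ /eqP ->] /andP[_ /eqP ->].
  move=> c /mapP[x]; rewrite mem_enum => xA ->; rewrite mem_iota.
  have := lep x xA; move: xA; rewrite inA /lo /k0 /lo => /andP[tk /eqP/line_par ->].
  rewrite /oddc; case: (par x0); rewrite ?mul1n ?mul0n; lia.
rewrite cardE -(size_map row) -{1}(size_iota 0 k0).
apply: uniq_leq_size; first exact: iota_uniq.
move=> r; rewrite mem_iota /= add0n => rk.
have [|y [ly ry]] := @line_row_surj x1 r.
  by apply: ltn_trans (row_lt_len x1); apply: leq_trans rk r1.
apply/mapP; exists y => //; rewrite mem_enum inB ly l1 eqxx andbT usB ?ry //.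
by rewrite ly.
Qed.

Lemma phi_higher X : higher (content us) X -> phi X = 0.
Proof.
elim=> [|w' A B {}X d hA hB h1 h2 h3 hX IH].
  by rewrite /phi mul0mx ent0.
rewrite phiD IH addr0 phiE.
rewrite (eq_bigr (fun c => \sum_(t | [forall g, (g \in P) ==> (cact t g == t)])
   chi c * (ent A us t * ent (B *m Tmx F c) t us))); last first.
  by move=> c cC; rewrite -mulmxA brauer_mul // mulr_sumr.
rewrite exchange_big /= big1 // => t /forallP ft.
have {}ft g : g \in P -> cact t g = t by move=> gP; apply/eqP/(implyP (ft g)).
transitivity (ent A us t * ent (kappa *m B) t us).
  rewrite -kappa_end // /kappa mulmx_sumr ent_sum mulr_sumr; apply: eq_bigr => c _.
  by rewrite -scalemxAr entZ mulrCA.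
have [->|At] := eqVneq (ent A us t) 0; first by rewrite mul0r.
have ct := fixed_cellconst ft.
have cw : content t = w'.
  by apply/eqP; apply: contraNT At => /negbTE ne; rewrite -h2 ent_mulw ne mulr0.
(* An odd column has positive level, so its blocks have two distinct points. Both [us] and [t] are
   constant on a block, and different parities would make the entry of [A] vanish. *)
have ho x : par x -> oddc (t x).
  move=> px; have : (1 < #|[set y | cell y == cell x]|)%N.
    rewrite card_cell; have := par_lev px; case: (lev x) => // l _.
    by rewrite -{1}(expn0 p) ltn_exp2l // prime_gt1.
  case/card_gt1P => y [z []]; rewrite !inE => /eqP yx /eqP zx /eqP yz.
  have e : cell y = cell z by rewrite yx zx.
  apply: contraNT At => nt; apply/eqP.
  apply: (end_mixed0 two_neq0 hA yz); [exact: us_cell | exact: ct |].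
  by rewrite oddc_hw (cell_par yx) px (ct _ _ yx) (negbTE nt).
have [[x [y [lxy xy txy ox]]]|no] := classic (exists x y,
    [/\ line x = line y, x <> y, t x = t y & oddc (t x) = par x]).
  by rewrite (kappa_kill _ _ ct lxy xy txy ox) mulr0.
(* In the remaining case [content_le] bounds [w'] by the weight of [us], against strict
   dominance. *)
case: d => d ne; case: ne; apply: (domw_anti d).
rewrite -cw; apply: content_le => // x y lxy xy txy ox.
by apply: no; exists x, y.
Qed.

Lemma phi_weight_functional : weight_functional (content us) phi.
Proof.
split; [exact: phiD | exact: phiZ | exact: phi1 | exact: phi_higher].
Qed.

(** The summands are invariant under right multiplication of the cosets of [R] by [P], so modulo [p]
    only fixed cosets count; a fixed coset would put [P] inside a conjugate of [R]. *)
Lemma phi_relative_trace (R : {group 'S_n}) (f : 'M[F]_(dimT n)) :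
    (#|R| < #|P|)%N -> (forall r : 'S_n, r \in R -> Tmx F r *m f = f *m Tmx F r) ->
  phi (rel_trace R (Trep F n) f) = 0.
Proof.
move=> ltRP hf; rewrite phiE big1 // => c cC; rewrite mulmx_suml ent_sum.
pose eta := cact us c^-1.
have etaP h : h \in P -> cact eta h = eta := us_fixed_col cC.
pose k g := ent (Tmx F g^-1%g *m f *m Tmx F g) us eta.
rewrite (eq_bigr (fun D => k (repr D) * sg eta c)); last first.
  by move=> D _; rewrite -{2}(cactKV c us) ent_mulT.
rewrite -mulr_suml.
have kR (r : 'S_n) g : r \in R -> k (r * g)%g = k g.
  move=> rR; have e1 : Tmx F r^-1%g *m Tmx F r = 1%:M.
    by rewrite -TmxM mulVg; apply: (repr_mx1 (Trep F n)).
  rewrite /k invMg !TmxM -!mulmxA (mulmxA f) -hf // !mulmxA.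
  by rewrite -(mulmxA _ (Tmx F r^-1%g)) e1 mulmx1.
have kP g (x : 'S_n) : x \in P -> k (g * x)%g = k g.
  move=> xP; rewrite /k invMg !TmxM -(etaP x xP) !mulmxA ent_mulT -!mulmxA ent_Tmul.
  have xVP : x^-1%g \in P by rewrite groupV.
  by rewrite (us_fixed xVP) (sg_fixed us_fixed) // (sg_fixed etaP) // mul1r mulr1 (etaP x).
have repr_mem D : D \in rcosets R (Sgroup n) -> repr D \in D /\ D = R :* repr D.
  case/rcosetsP => g _ ->; have := mem_repr_rcoset R g => h; split=> //.
  by rewrite (rcoset_eqP h).
rewrite (@pgroup_sum F p _ _ P ('Rs)%act (rcosets R (Sgroup n))) //.
- rewrite big_pred0 ?mul0r ?mulr0 // => D; apply/negbTE/negP; rewrite inE => /andP[DR /afixP fD].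
  have [rD eD] := repr_mem D DR; set g := repr D in rD eD.
  have : P \subset R :^ g.
    apply/subsetP => x xP; have e : D :* x = D by rewrite -rcosetE; exact: fD x xP.
    rewrite mem_conjg; have : (g * x)%g \in D.
      by rewrite -e mem_rcoset mulgK.
    by rewrite eD mem_rcoset conjgE invgK mulgA.
  by move/subset_leq_card; rewrite cardJg leqNgt ltRP.
- apply: subset_trans (subsetT P) _; exact: (actsRs_rcosets R (Sgroup n)).
move=> x D xP DR; have [rD eD] := repr_mem D DR.
have DxR : D :* x \in rcosets R (Sgroup n).
  by rewrite eD -rcosetM; apply/rcosetsP; exists (repr D * x)%g; rewrite ?inE ?rcosetE.
have [rDx _] := repr_mem _ DxR.
have : repr (D :* x) \in R :* (repr D * x) by rewrite rcosetM -eD.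
rewrite /= rcosetE => /rcosetP[r rR ->].
by rewrite kR // kP.
Qed.

Lemma cell_size_dvd (A : {set 'I_n}) m :
    (forall x y, x \in A -> cell y = cell x -> y \in A) ->
    (forall x, x \in A -> m <= lev x)%N ->
  (p ^ m %| #|A|)%N.
Proof.
move: {2}#|A| (leqnn #|A|) => k; elim: k A => [|k IH] A Ak closedA levA.
  by move: Ak; rewrite leqn0 => /eqP ->; rewrite dvdn0.
have [->|[x xA]] := set_0Vmem A; first by rewrite cards0 dvdn0.
pose B := [set y | cell y == cell x].
have BA : B \subset A by apply/subsetP => y; rewrite inE => /eqP; apply: closedA xA.
rewrite -(cardsID B A) (setIidPr BA) dvdn_add //.
  by rewrite card_cell dvdn_exp2l // levA.
apply: IH.
- rewrite -ltnS; apply: leq_trans Ak; apply: proper_card; apply/properP; split.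
    exact: subsetDl.
  by exists x; rewrite // !inE eqxx.
- move=> y z; rewrite !inE => /andP[yB yA] e; rewrite e yB /=.
  exact: closedA yA e.
- by move=> y; rewrite inE => /andP[_ /levA].
Qed.

(** In terms of blocks: fewer than [p] of them share level, parity, row and column length, since a
    restricted partition has fewer than [p] columns of each length. *)
Hypothesis restricted : forall x0,
  (#|[set x | [&& lev x == lev x0, par x == par x0, row x == row x0 &
      len (column x) == len (column x0)]]| < p ^ (lev x0).+1)%N.
Hypothesis P_max : forall Q : {group 'S_n}, P \subset Q -> p.-group Q ->
  (forall g x, g \in Q -> cell (g x) = cell x) -> Q \subset P.

Lemma column_reversal : exists2 z, z \in C &
  (forall x, row (z x) = len (column x) - 1 - row x)%N /\ (forall x, z (z x) = x).
Proof.
apply: lift_rows => [x|x y e|x y e].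
- have := row_lt_len x; lia.
- rewrite (line_column e); have := row_lt_len x; lia.
- by rewrite (cell_column e) (congr1 snd e : row x = row y).
Qed.

(** * A relative trace from P on which the form does not vanish *)

Section UpperBound.
Variable z : 'S_n.
Hypotheses (zC : z \in C) (zrow : forall x, row (z x) = (len (column x) - 1 - row x)%N).
Hypothesis zz : forall x, z (z x) = x.
Let eta := cact us z.
Let SA := ('C[us | cact_action] :&: 'C[eta | cact_action])%G.

Lemma mem_SA g : reflect (cact us g = us /\ cact eta g = eta) (g \in SA).
Proof.
rewrite inE; apply: (iffP andP) => [[/astab1P h1 /astab1P h2]|[h1 h2]]; first by [].
by split; apply/astab1P.
Qed.

Lemma eta_us x : eta x = us (z x).
Proof. by rewrite /eta -{1}(zz x) cact_perm. Qed.

Lemma z_inv : z^-1%g = z.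
Proof. by apply/permP => x; rewrite -{1}(zz x) permK. Qed.

Lemma eta_fixed g : g \in P -> cact eta g = eta.
Proof. by move=> gP; have := us_fixed_col zC gP; rewrite z_inv. Qed.

(** [us] records the row and [eta] the row counted from the other end; together they determine the
    column length. *)
Lemma SA_class g x : g \in SA ->
  [/\ par (g x) = par x, row (g x) = row x & len (column (g x)) = len (column x)].
Proof.
case/mem_SA => h1 h2.
have [p1 r1] : par (g x) = par x /\ row (g x) = row x.
  by apply: hw_eq; rewrite -{1}h1 cact_perm.
have [_ r2] : par (z (g x)) = par (z x) /\ row (z (g x)) = row (z x).
  by apply: hw_eq; rewrite -!eta_us -{1}h2 cact_perm.
split=> //; move: r2; rewrite !zrow r1; have := row_lt_len x; have := row_lt_len (g x); rewrite r1; lia.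
Qed.

(* A p-subgroup [Q] of [SA] containing [P] has orbits of p-power size that are unions of
   cells; by restrictedness they contain less than p cells of each size, so they are
   single cells. *)
Lemma P_sylow_SA : p.-Sylow(SA) P.
Proof.
have PSA : P \subset SA.
  by apply/subsetP => g gP; apply/mem_SA; split; [apply: us_fixed | apply: eta_fixed].
have [Q sylQ PQ] := Sylow_superset PSA pP.
suff -> : P = Q by [].
apply/val_inj/eqP; rewrite eqEsubset PQ /=; apply: P_max => //; first exact: pHall_pgroup sylQ.
move=> g x0 gQ; pose O := orbit ('P)%act Q x0.
have QSA := subsetP (pHall_sub sylQ).
have OE y : reflect (exists2 h, h \in Q & h x0 = y) (y \in O).
  by apply: (iffP orbitP) => -[h hQ e]; exists h.
have Ocl x y : x \in O -> cell y = cell x -> y \in O.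
  move=> /OE[h hQ <-] e; have [k kP ek] := P_trans (esym e).
  by apply/OE; exists (h * k)%g; rewrite ?permM ?groupM // (subsetP PQ).
have Oclass x y : x \in O -> y \in O ->
    [/\ par x = par y, row x = row y & len (column x) = len (column y)].
  move=> /OE[h /QSA/(SA_class x0)[h1 h2 h3] <-] /OE[k /QSA/(SA_class x0)[k1 k2 k3] <-].
  by rewrite h1 h2 h3 k1 k2 k3.
have x0O : x0 \in O by apply: orbit_refl.
have [x1 x1O x1min] := @arg_minnP _ x0 (mem O) lev x0O.
have {}x1O : x1 \in O by [].
set l := lev x1 in x1min.
pose M := [set x in O | lev x == l].
have [j Oj] : exists j, #|O| = (p ^ j)%N.
  have : p.-nat #|O|.
    by rewrite card_orbit; apply: pnat_dvd (dvdn_indexg _ _) (pHall_pgroup sylQ).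
  by case/p_natP => j ->; exists j.
have dD : (p ^ l.+1 %| #|O :\: M|)%N.
  apply: cell_size_dvd => [x y|x]; rewrite !inE.
    move=> /andP[nM xO] e; rewrite (Ocl x y xO e) andbT; move: nM; rewrite xO.
    have -> : lev y = lev x by case: e.
    by [].
  by rewrite negb_and => /andP[/orP[/negP//|ne] xO]; rewrite ltn_neqAle eq_sym ne x1min.
have ltM : (#|M| < p ^ l.+1)%N.
  apply: leq_ltn_trans (restricted x1); apply/subset_leq_card/subsetP => x.
  rewrite !inE => /andP[xO /eqP ->]; have [-> -> ->] := Oclass _ _ xO x1O.
  by rewrite !eqxx.
have M0 : (0 < #|M|)%N by apply/card_gt0P; exists x1; rewrite inE x1O eqxx.
(* If [j] exceeded [l], the size of [M] would be a positive multiple of [p ^ l.+1] smaller than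
   [p ^ l.+1]. *)
have lej : (j <= l)%N.
  rewrite leqNgt; apply/negP => lt.
  have : (p ^ l.+1 %| #|O|)%N by rewrite Oj dvdn_exp2l.
  rewrite -(cardsID M O) dvdn_addl // (setIidPr _); last by apply/subsetP => x; rewrite inE => /andP[].
  by move/(dvdn_leq M0); rewrite leqNgt ltM.
have cO : [set y | cell y == cell x1] = O.
  apply/eqP; rewrite eqEcard card_cell Oj leq_exp2l ?prime_gt1 // lej andbT.
  by apply/subsetP => y; rewrite inE => /eqP; apply: Ocl.
have gO : g x0 \in O by apply/OE; exists g.
by move: x0O gO; rewrite -cO !inE => /eqP -> /eqP ->.
Qed.

(* The sum of [row x * row (c x)] only depends on the orbit of [(us, cact us c^-1)], and by
   the rearrangement inequality it is minimal for the reversal only. *)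
Lemma reversal_unique c g : c \in C -> cact us g = us -> cact eta g = cact us c^-1%g -> c = z.
Proof.
move=> cC gus geta.
pose rc (k : color n) := if (n < k)%N then (k - n.+1)%N else k.
have rcus x : rc (us x) = row x.
  rewrite /rc -/(oddc (us x)) oddc_hw hw_coloringE; have := row_lt x.
  by case: (par x); rewrite ?mul1n ?mul0n ?addKn.
pose L x := (len (column x) - 1)%N.
have Lc k x : k \in C -> L (k x) = L x.
  by move=> /col_permsP[k1 _]; rewrite /L (line_column (k1 x)).
have cross : (\sum_x row x * row (c x) = \sum_x row x * row (z x))%N.
  transitivity (\sum_x rc (cact us g x) * rc (cact eta g x))%N.
    by rewrite gus geta; apply: eq_bigr => x _; rewrite cactE invgK !rcus.
  rewrite (reindex_inj (@perm_inj _ g)); apply: eq_bigr => x _ /=.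
  by rewrite !cact_perm eta_us !rcus.
(* The squares add up to a constant plus twice the sum of products. They vanish for the reversal
   [z], hence by [cross] also for [c]. *)
pose q (k : 'S_n) x : int := ((row x)%:Z + (row (k x))%:Z - (L x)%:Z) ^+ 2.
have qE k : k \in C -> \sum_x q k x =
    \sum_x (2 * (row x * row x)%N%:Z + (L x * L x)%N%:Z - 4 * (L x * row x)%N%:Z)
    + 2 * (\sum_x (row x * row (k x)))%N%:Z.
  move=> kC.
  have e1 : \sum_x (row (k x) * row (k x))%N%:Z = \sum_x (row x * row x)%N%:Z.
    by rewrite [RHS](reindex_inj (@perm_inj _ k)).
  have e2 : \sum_x (L x * row (k x))%N%:Z = \sum_x (L x * row x)%N%:Z.
    by rewrite [RHS](reindex_inj (@perm_inj _ k)); apply: eq_bigr => x _; rewrite Lc.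
  rewrite (eq_bigr (fun x => (row x * row x)%N%:Z + (L x * L x)%N%:Z - 2 * (L x * row x)%N%:Z
     + (row (k x) * row (k x))%N%:Z - 2 * (L x * row (k x))%N%:Z
     + 2 * (row x * row (k x))%N%:Z)); last first.
    by move=> x _; rewrite /q expr2 !PoszM; ring.
  rewrite !big_split /= !sumrN -!mulr_sumr e1 e2 -!(big_morph Posz PoszD (erefl _)).
  ring.
have q0 x : q c x = 0.
  have sq : \sum_x q c x = 0.
    rewrite qE // cross -qE // big1 // => y _; rewrite /q zrow /L.
    have := row_lt_len y; move=> h; apply/eqP; rewrite sqrf_eq0; apply/eqP; lia.
  apply: (Num.Theory.psumr_eq0P _ sq) => // y _; rewrite /q; exact: Num.Theory.sqr_ge0.
apply/permP => x; apply: line_row_inj.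
  by have /col_permsP[c1 _] := cC; have /col_permsP[z1 _] := zC; rewrite c1 z1.
rewrite zrow; have := q0 x; rewrite /q => /eqP; rewrite sqrf_eq0 /L => /eqP; lia.
Qed.

Definition Emx : 'M[F]_(dimT n) := kmx (fun u v => ((u == us) && (v == eta))%:R).

Lemma Emx_P g : g \in P -> Tmx F g *m Emx = Emx *m Tmx F g.
Proof.
move=> gP; apply: entP => u v; rewrite -{2}(cactKV g v) ent_mulT ent_Tmul !ent_kmx.
have -> : (cact u g == us) = (u == us).
  by rewrite -{1}(us_fixed gP) (inj_eq (@cact_inj _ g)).
have -> : (cact v g^-1 == eta) = (v == eta).
  by rewrite -(inj_eq (@cact_inj _ g)) cactKV (eta_fixed gP).
case: eqP => [->|_]; last by rewrite mulr0 mul0r.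
case: eqP => [->|_]; last by rewrite mulr0 mul0r.
rewrite -{1}(eta_fixed gP) cactK (sg_fixed us_fixed) // (sg_fixed eta_fixed) //.
Qed.

(** Only [c = z] contributes, by [reversal_unique]; there each coset of [P] inside [SA] counts 1 and
    the others 0. The index is prime to [p] because [P] is a Sylow subgroup of [SA]. *)
Lemma phi_trace_neq0 : phi (rel_trace P (Trep F n) Emx) <> 0.
Proof.
pose X := rel_trace P (Trep F n) Emx.
have odds_eta : odds eta = odds us by rewrite odds_cact odds_us_col.
have termE g v : ent (Tmx F g^-1%g *m Emx *m Tmx F g) us (cact v g) =
    (sg us g^-1 * sg v g) * ((cact us g^-1 == us) && (v == eta))%:R.
  by rewrite ent_mulT ent_Tmul ent_kmx mulrAC.
have Xz c : c \in C -> c != z -> ent (X *m Tmx F c) us us = 0.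
  move=> cC ne; rewrite -{2}(cactKV c us) ent_mulT; apply/eqP; rewrite mulf_eq0; apply/orP; left.
  apply/eqP; rewrite /X /rel_trace ent_sum big1 // => D _; set g := repr D.
  rewrite -(cactKV g (cact us c^-1)) [ent _ _ _]termE.
  case: eqP => [e1|_]; last by rewrite mulr0.
  case: eqP => [e2|_]; last by rewrite mulr0.
  case/eqP: ne; apply: (@reversal_unique c g) => //; first by rewrite -{1}e1 cactKV.
  by rewrite -e2 cactKV.
rewrite -/X phiE (bigD1 z) //= big1 ?addr0; last by move=> c /andP[cC ne]; rewrite Xz ?mulr0.
rewrite -{2}(cactKV z us) ent_mulT z_inv -/eta.
have PSA : P \subset SA := pHall_sub P_sylow_SA.
have sgSA g : g \in SA -> sg us g^-1 * sg (cact eta g^-1) g = 1.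
  case/mem_SA => h1 h2; rewrite -{1}h1 sgV -{1}h2 cactK.
  by rewrite (congr1 (fun O => eps F O g) odds_eta : sg eta g = sg us g) sg_sqr.
have -> : ent X us eta = (#|SA : P|)%:R.
  rewrite /X /rel_trace ent_sum (eq_bigr (fun D => ((repr D \in SA) : nat)%:R)); last first.
    move=> D _; set g := repr D; rewrite -{1}(cactKV g eta) [ent _ _ _]termE.
    case: (boolP (g \in SA)) => [gS|ngS]; first last.
      case: eqP => [e1|_]; last by rewrite mulr0.
      case: eqP => [e2|_]; last by rewrite mulr0.
      by case/negP: ngS; apply/mem_SA; split; [rewrite -{1}e1 | rewrite -{1}e2]; rewrite cactKV.
    rewrite sgSA //; case/mem_SA: gS => h1 h2.
    by rewrite -{1}h1 -{1}h2 !cactK !eqxx mul1r.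
  rewrite -natr_sum /indexg -sum1_card; congr (_%:R).
  rewrite -big_mkcondr; apply: eq_bigl => D; apply/andP/idP => [[DR h]|].
    have [_ eD _] := repr_rcosets (subsetT P) DR.
    by rewrite eD; apply/rcosetsP; exists (repr D); rewrite ?rcosetE.
  move=> DR; have [_ eD rDS] := repr_rcosets PSA DR; split=> //.
  by rewrite eD; apply/rcosetsP; exists (repr D); rewrite ?inE ?rcosetE.
apply/eqP; rewrite !mulf_neq0 ?sg_neq0 ?signr_eq0 //.
rewrite -(dvdn_pcharf charp); apply/negP => d.
have [_ _] := and3P P_sylow_SA; rewrite p'natE ?d //.
Qed.

Lemma trace_corner : in_corner (content us) (rel_trace P (Trep F n) Emx).
Proof.
have EP := Emx_P; have hX := rel_trace_intertwines (subsetT P) EP.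
have hw := wproj_end F (content us).
have wE : wproj (content us) *m Emx = Emx.
  apply: entP => u v; rewrite ent_wmul ent_kmx.
  by case: (u =P us) => [->|_]; rewrite ?eqxx ?mul1r ?mulr0.
have Ew : Emx *m wproj (content us) = Emx.
  apply: entP => u v; rewrite ent_mulw ent_kmx andbC.
  by case: (v =P eta) => [->|_]; rewrite ?mul0r // /eta content_cact eqxx mulr1.
split=> //; rewrite /rel_trace ?mulmx_sumr ?mulmx_suml; apply: eq_bigr => D _.
  by rewrite !mulmxA -(hw _ (in_setT _)) -(mulmxA _ _ Emx) wE.
by rewrite -!mulmxA (hw _ (in_setT _)) (mulmxA Emx) Ew.
Qed.

End UpperBound.

Lemma relative_trace_exists : exists E : 'M[F]_(dimT n),
  [/\ forall g, g \in P -> Tmx F g *m E = E *m Tmx F g,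
      in_corner (content us) (rel_trace P (Trep F n) E)
    & phi (rel_trace P (Trep F n) E) <> 0].
Proof.
have [z zC [zr zz]] := column_reversal; exists (Emx z).
split; [exact: Emx_P | exact: trace_corner | exact: phi_trace_neq0].
Qed.

End ColumnFunctional.

(** * Blocks indexed by the boxes of the p-adic expansions *)

Section Diagrams.
Implicit Types (L : seq nat) (i j c : nat).

Definition diagram L := [seq (i, j) | i <- iota 0 (size L), j <- iota 0 (nth 0 L i)].

Lemma size_diagram L : size (diagram L) = sumn L.
Proof.
rewrite /diagram size_allpairs_dep; congr sumn.
apply: (@eq_from_nth _ 0); rewrite ?size_map ?size_iota // => i iL.
by rewrite (nth_map 0) ?size_iota // nth_iota.
Qed.

Lemma mem_diagram L i j : ((i, j) \in diagram L) = (j < nth 0 L i).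
Proof.
apply/allpairsPdep/idP => [[i' [j' [_ h [-> ->]]]]|lt]; first by rewrite mem_iota in h.
exists i, j; rewrite !mem_iota /=; split=> //; rewrite add0n ltnNge.
by apply: contraTN lt => le; rewrite nth_default.
Qed.

Lemma uniq_diagram L : uniq (diagram L).
Proof.
apply: allpairs_uniq_dep => [|i _|]; try exact: iota_uniq.
by move=> [i j] [i' j'] _ _ /= [-> ->].
Qed.

Lemma count_diagram L i : count (fun d => d.1 == i) (diagram L) = nth 0 L i.
Proof.
rewrite -size_filter -[RHS](size_iota 0) -[RHS](size_map (pair i)).
apply: perm_size; apply: uniq_perm; rewrite ?filter_uniq ?uniq_diagram //.
  by rewrite map_inj_uniq ?iota_uniq // => a b [].
move=> [a b]; rewrite mem_filter mem_diagram /=; apply/andP/mapP => [[/eqP -> h]|[c]].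
  by exists b; rewrite // mem_iota.
by rewrite mem_iota add0n => h [-> ->]; rewrite eqxx.
Qed.

(** For a partition [L] this is the length of column [c], a part of the conjugate partition. *)
Definition collen L c := count (fun a => c < a) L.

Lemma collenP L c r : sorted geq L -> (r < collen L c) = (c < nth 0 L r).
Proof.
have tr : transitive geq by move=> x y z h1 h2; apply: leq_trans h2 h1.
elim: L r => [|a L IH] r sL; first by rewrite nth_nil.
rewrite /collen /= -/(collen L c); have [ca|ac] := ltnP c a.
  by case: r => [|r] /=; rewrite ?ca // add1n ltnS IH // (path_sorted sL).
have all0 : all (fun b => b <= c) L.
  apply/allP => b bL; have /allP/(_ b bL) /= := order_path_min tr sL.
  by move=> ba; apply: leq_trans ac.
have -> : collen L c = 0.
  by apply/eqP; rewrite -leqn0 leqNgt -has_count -all_predC; apply/allP => b /(allP all0) /=; rewrite -leqNgt.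
apply/esym/negbTE; rewrite -leqNgt; case: r => //= r.
have [rL|rL] := ltnP r (size L); last by rewrite nth_default.
exact: (allP all0 _ (mem_nth 0 rL)).
Qed.

Lemma sumn_nth L B : size L <= B -> sumn L = \sum_(j < B) nth 0 L j.
Proof.
elim: L B => [|a L IH] [|B] //= h; rewrite ?big_ord0 //.
  by rewrite big1 // => i _; rewrite nth_nil.
by rewrite big_ord_recl /= (IH B).
Qed.

End Diagrams.

Section Cells.
Variables (p r : nat) (ls ms : seq (seq nat)).
Hypotheses (p0 : 0 < p) (sls : size ls = r.+1) (sms : size ms = r).

(** Level [i] means blocks of size [p ^ i], whence the shift of index for the parts of mu. *)
Definition level_part (s : bool) i : seq nat :=
  if s then (if i is i'.+1 then nth [::] ms i' else [::]) else nth [::] ls i.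

Definition cellT := (bool * nat * nat * nat)%type.
Definition cpar (c : cellT) := c.1.1.1.
Definition clev (c : cellT) := c.1.1.2.
Definition ccol (c : cellT) := c.1.2.
Definition crow (c : cellT) := c.2.

Definition level_cells s i : seq cellT := [seq (s, i, d.2, d.1) | d <- diagram (level_part s i)].
Definition cells : seq cellT :=
  [seq c | i <- rev (iota 0 r.+1), c <- level_cells false i ++ level_cells true i].

Notation rho := (rho_of p r ls ms).

Lemma rho_cells : rho = [seq p ^ clev c | c <- cells].
Proof.
rewrite /rho_of /cells /allpairs_dep map_flatten; congr flatten; rewrite -map_comp.
apply: eq_map => i /=; rewrite map_id map_cat.
have h s : [seq p ^ clev c | c <- level_cells s i] = nseq (sumn (level_part s i)) (p ^ i).
  rewrite /level_cells -map_comp -size_diagram.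
  by elim: (diagram _) => //= d l ->.
by rewrite !h -nseqD; clear h; case: i.
Qed.

Lemma mem_cells s i j k : ((s, i, j, k) \in cells) = (j < nth 0 (level_part s i) k).
Proof.
apply/allpairsPdep/idP => [[i' [c [_]]]|lt].
  rewrite mem_cat => /orP[] /mapP[[a b]]; rewrite mem_diagram /= => h -> [-> -> -> ->] //.
exists i, (s, i, j, k); split=> //.
  rewrite mem_rev mem_iota /= add0n ltnNge; apply/negP => le; move: lt; rewrite /level_part.
  case: (s); last by rewrite [nth [::] _ _]nth_default ?nth_nil // sls.
  by case: (i) le => // i' le; rewrite [nth [::] _ _]nth_default ?nth_nil // sms.
have h : (s, i, j, k) \in level_cells s i.
  by apply/mapP; exists (k, j); rewrite ?mem_diagram.
by rewrite mem_cat; case: (s) h => ->; rewrite ?orbT.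
Qed.

Lemma uniq_cells : uniq cells.
Proof.
have lev_c i c : c \in level_cells false i ++ level_cells true i -> clev c = i.
  by rewrite mem_cat => /orP[] /mapP[d _ ->].
apply: allpairs_uniq_dep => [|i _|].
- by rewrite rev_uniq iota_uniq.
- rewrite cat_uniq; apply/and3P; split.
  + by rewrite map_inj_uniq ?uniq_diagram // => -[a b] [a' b'] [-> ->].
  + by apply/hasPn => c /mapP[d _ ->]; apply/mapP => -[d' _].
  + by rewrite map_inj_uniq ?uniq_diagram // => -[a b] [a' b'] [-> ->].
- move=> [i c] [i' c'] /allpairsPdep[a [b [_ h [-> ->]]]] /allpairsPdep[a' [b' [_ h' [-> ->]]]] /= e.
  by rewrite -(lev_c _ _ h) -(lev_c _ _ h') e.
Qed.

Lemma sum_cells_row s a :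
  \sum_(c <- cells | (cpar c == s) && (crow c == a)) p ^ clev c =
  \sum_(i < r.+1) p ^ i * nth 0 (level_part s i) a.
Proof.
have sumiota m (f : nat -> nat) : \sum_(j <- rev (iota 0 m)) f j = \sum_(i < m) f i.
  by rewrite (perm_big (iota 0 m)) ?perm_rev //= -(big_mkord xpredT) /index_iota subn0.
rewrite /cells /allpairs_dep big_flatten big_map sumiota; apply: eq_bigr => i _.
rewrite map_id big_cat /=.
have h s' : \sum_(c <- level_cells s' i | (cpar c == s) && (crow c == a)) p ^ clev c =
    if s' == s then p ^ i * nth 0 (level_part s i) a else 0.
  rewrite /level_cells big_map /cpar /crow /clev /=; case: eqP => [->|_]; last by rewrite big_pred0_eq.
  by rewrite big_const_seq iter_addn_0 count_diagram mulnC.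
by rewrite !h; clear h; case: s => /=; rewrite ?addn0 ?add0n.
Qed.

Lemma sumn_rho : sumn rho = \sum_(i < r.+1) p ^ i * (sumn (level_part false i) + sumn (level_part true i)).
Proof.
have sumiota m (f : nat -> nat) : \sum_(j <- rev (iota 0 m)) f j = \sum_(i < m) f i.
  by rewrite (perm_big (iota 0 m)) ?perm_rev //= -(big_mkord xpredT) /index_iota subn0.
rewrite /rho_of sumn_flatten -map_comp sumnE big_map sumiota; apply: eq_bigr => i _ /=.
by rewrite sumn_nseq; case: (nat_of_ord i).
Qed.

End Cells.

(** * The boxes of the expansions satisfy the hypotheses on coordinates *)

Section Expansion.
Import GRing.Theory.
Local Open Scope group_scope.
Local Open Scope nat_scope.
Variables (F : fieldType) (n p r : nat) (ls ms : seq (seq nat)) (lam mu : seq nat).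
Hypotheses (oddp : odd p) (charp : p \in [pchar F]%R).
Hypotheses (sls : size ls = r.+1) (sms : size ms = r).
Hypotheses (pls : forall L, L \in ls -> is_partition L) (pms : forall L, L \in ms -> is_partition L).
Hypothesis vlm : valid n p lam mu.
Hypothesis lamE : forall j, nth 0 lam j = \sum_(i < r.+1) p ^ i * nth 0 (nth [::] ls i) j.
Hypothesis muE : forall j, nth 0 mu j = \sum_(i < r) p ^ i * nth 0 (nth [::] ms i) j.

Let p_pr : prime p. Proof. by case/andP: charp. Qed.
Let p0 : 0 < p. Proof. exact: prime_gt0. Qed.
Notation rho := (rho_of p r ls ms).
Notation cl := (cells r ls ms).
Notation part := (level_part ls ms).

Lemma part_sorted s i : sorted geq (part s i).
Proof.
have h ss : (forall L, L \in ss -> is_partition L) -> forall i, sorted geq (nth [::] ss i).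
  move=> hs k; have [lt|le] := ltnP k (size ss); last by rewrite nth_default.
  by have /andP[] := hs _ (mem_nth [::] lt).
rewrite /level_part; case: s; last exact: h.
by case: i => // i; apply: h.
Qed.

Lemma sum_part_false a : \sum_(i < r.+1) p ^ i * nth 0 (part false i) a = nth 0 lam a.
Proof. by rewrite lamE. Qed.

Lemma sum_part_true a : \sum_(i < r.+1) p ^ i * nth 0 (part true i) a = p * nth 0 mu a.
Proof.
rewrite big_ord_recl /= nth_nil muln0 add0n muE big_distrr /=; apply: eq_bigr => i _.
by rewrite /bump /= add1n expnS mulnA.
Qed.

Lemma sumn_rhoE : sumn rho = n.
Proof.
have [_ _ <-] := vlm; rewrite sumn_rho /psize.
pose B := size lam + size mu + \sum_(i < r.+1) (size (part false i) + size (part true i)).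
have sB s (i : 'I_r.+1) : size (part s i) <= B.
  have gen (f g : 'I_r.+1 -> nat) : f i <= \sum_i (f i + g i) /\ g i <= \sum_i (f i + g i).
    by rewrite (bigD1 i) //=; lia.
  apply: leq_trans (leq_addl _ _).
  by have [] := gen (fun i => size (part false i)) (fun i => size (part true i)); case: s.
rewrite (sumn_nth (L := lam) (B := B)) ?(sumn_nth (L := mu) (B := B)); try by rewrite /B; lia.
rewrite (eq_bigr (fun i : 'I_r.+1 => \sum_(j < B) (p ^ i * nth 0 (part false i) j + p ^ i * nth 0 (part true i) j))); last first.
  by move=> i _; rewrite !(sumn_nth (sB _ i)) mulnDr !big_distrr -big_split.
rewrite exchange_big /= big_distrr /= -big_split; apply: eq_bigr => j _.
by rewrite big_split /= sum_part_false sum_part_true.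
Qed.

Let c0 : cellT := (false, 0, 0, 0).
Definition pcell (x : 'I_n) : cellT := nth c0 cl (yblock rho x).
Definition ppar x := cpar (pcell x).
Definition plev x := clev (pcell x).
Definition pcol x := ccol (pcell x).
Definition prow x := crow (pcell x).
Definition poff (x : 'I_n) := x - sumn (take (yblock rho x) rho).
Definition plen (k : bool * nat * nat) := collen (part k.1.1 k.1.2) k.2.
Notation column := (column ppar plev pcol).
Notation line := (line ppar plev pcol poff).
Notation cell := (cell ppar plev prow pcol).

Lemma cellE x : cell x = pcell x.
Proof. by rewrite /cell /column /ppar /plev /pcol /prow; case: (pcell x) => [[[? ?] ?] ?]. Qed.

Lemma size_rho : size rho = size cl.
Proof. by rewrite rho_cells size_map. Qed.

Lemma pblock (x : 'I_n) : [/\ yblock rho x < size cl, x = sumn (take (yblock rho x) rho) + poff x :> nat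
  & poff x < p ^ plev x].
Proof.
have [|h1 h2 h3] := @yblockP rho x; first by rewrite sumn_rhoE.
rewrite -size_rho; split=> //; first by rewrite /poff subnKC.
rewrite /poff ltn_subLR //; apply: leq_trans h3 _; rewrite leq_add2l.
by rewrite {1}rho_cells (nth_map c0) -?size_rho.
Qed.

Lemma pcell_mem x : pcell x \in cl.
Proof. by apply: mem_nth; case: (pblock x). Qed.

Lemma pcell_block x y : (pcell x == pcell y) = (yblock rho x == yblock rho y).
Proof.
by have [h1 _ _] := pblock x; have [h2 _ _] := pblock y; rewrite nth_uniq ?uniq_cells.
Qed.

Lemma point_exists c o : c \in cl -> o < p ^ clev c -> exists x, pcell x = c /\ poff x = o.
Proof.
move=> cM oc; set k := index c cl; have kc : k < size cl by rewrite index_mem.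
have nk : nth 0 rho k = p ^ clev c by rewrite rho_cells (nth_map c0) // nth_index.
have lt : sumn (take k rho) + o < n.
  rewrite -sumn_rhoE -[X in _ < sumn X](cat_take_drop k rho) sumn_cat ltn_add2l.
  by rewrite (drop_nth 0) ?size_rho //= nk (leq_trans oc) ?leq_addr.
have yk : yblock rho (sumn (take k rho) + o) = k by rewrite yblockK ?nk.
by exists (Ordinal lt); rewrite /pcell /poff /= yk addKn nth_index.
Qed.

Lemma card_pcell (Q : pred cellT) :
  #|[set x | Q (pcell x)]| = \sum_(c <- cl | Q c) p ^ clev c.
Proof.
rewrite -sum1_card (partition_big (fun x => Ordinal (let: And3 h _ _ := pblock x in h)) predT) //=.
rewrite (big_nth c0) big_mkord [RHS]big_mkcond; apply: eq_bigr => k _.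
case: ifP => Qk; last first.
  by rewrite big_pred0 // => x; rewrite inE -val_eqE /= /pcell; case: eqP => [->|]; rewrite ?Qk ?andbF.
have <- : nth 0 rho k = p ^ clev (nth c0 cl k) by rewrite rho_cells (nth_map c0).
rewrite -(card_yblock k sumn_rhoE) -sum1_card; apply: eq_bigl => x.
by rewrite !inE -val_eqE /= /pcell; case: eqP => [->|]; rewrite ?Qk ?andbF.
Qed.

Lemma p_line_row_inj x y : line x = line y -> prow x = prow y -> x = y.
Proof.
move=> e1 e2; have e : pcell x = pcell y.
  by rewrite -!cellE /cell e2 (congr1 fst e1 : column x = column y).
have eb : yblock rho x = yblock rho y by apply/eqP; rewrite -pcell_block e.
have [_ hx _] := pblock x; have [_ hy _] := pblock y.
by apply/ord_inj; rewrite hx hy eb (congr1 snd e1 : poff x = poff y).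
Qed.

Lemma p_row_lt_len x : prow x < plen (column x).
Proof.
rewrite /plen collenP ?part_sorted //=; have := pcell_mem x; rewrite -cellE.
by rewrite mem_cells.
Qed.

Lemma p_line_row_surj x k : k < plen (column x) -> exists y, line y = line x /\ prow y = k.
Proof.
rewrite /plen collenP ?part_sorted //= => h.
have cM : (column x, k) \in cl by rewrite /column mem_cells.
have [|y [cy oy]] := point_exists cM (o := poff x); first by case: (pblock x).
exists y; have := cellE y; rewrite cy /cell => -[e1 e2 e3 e4].
by rewrite /line /column e1 e2 e3 oy.
Qed.

(** All smaller rows of the column also contain points, and there are only [n] points. *)
Lemma p_row_lt x : prow x < n.+1.
Proof.
have : size (iota 0 (prow x)) <= size [seq prow y | y <- enum 'I_n].
  apply: uniq_leq_size; first exact: iota_uniq.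
  move=> k; rewrite mem_iota /= add0n => kx.
  have [|y [_ yk]] := @p_line_row_surj x k; first exact: ltn_trans kx (p_row_lt_len x).
  by apply/mapP; exists y; rewrite ?mem_enum.
by rewrite size_iota size_map size_enum_ord ltnS.
Qed.

Lemma p_card_cell x : #|[set y | cell y == cell x]| = p ^ plev x.
Proof.
rewrite (eq_card (B := [set y : 'I_n | yblock rho y == yblock rho x])); last first.
  by move=> y; rewrite !inE !cellE pcell_block.
rewrite (card_yblock _ sumn_rhoE) [X in nth 0 X _]rho_cells (nth_map c0) //; by case: (pblock x).
Qed.

Lemma p_par_lev x : ppar x -> 0 < plev x.
Proof.
move=> px; have := pcell_mem x; rewrite -cellE mem_cells // px.
by case: (plev x) => //=; rewrite nth_nil.
Qed.

Lemma young_group_set : group_set (young n rho).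
Proof.
apply/group_setP; split; first by rewrite inE; apply/forallP => x; rewrite perm1.
move=> g h; rewrite !inE => /forallP hg /forallP hh; apply/forallP => x.
by rewrite permM (eqP (hh _)).
Qed.
Let Y := Group young_group_set.

Lemma young_cell (g : 'S_n) : reflect (forall x, cell (g x) = cell x) (g \in young n rho).
Proof.
rewrite inE; apply: (iffP forallP) => h x.
  by rewrite !cellE; apply/eqP; rewrite pcell_block.
by rewrite -pcell_block -!cellE h.
Qed.

Section Sylow.
Variable P : {group 'S_n}.
Hypothesis sylP : p.-Sylow(Y) P.

Lemma p_P_cell (g : 'S_n) x : g \in P -> cell (g x) = cell x.
Proof. by move=> /(subsetP (pHall_sub sylP)) /young_cell. Qed.

(** A block is an orbit of [Y] of p-power size. In the orbit-stabilizer formulas for [Y] and [P],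
    the stabilizer in [P] is a p-subgroup of the one in [Y], so the orbit of [P] must be as
    large. *)
Lemma p_P_trans x y : cell x = cell y -> exists2 g, g \in P & g x = y.
Proof.
move=> e; pose B := [set y | cell y == cell x].
have oY : orbit ('P)%act Y x = B.
  apply/setP => z; rewrite inE; apply/orbitP/eqP => [[g gY <-]|ez].
    by have /young_cell := gY; apply.
  exists (tperm x z); last by rewrite /= /aperm tpermL.
  by apply/young_cell => t; case: tpermP => // ->.
have oP : orbit ('P)%act P x \subset B.
  by apply/subsetP => z /orbitP[g gP <-]; rewrite inE; apply/eqP; apply: p_P_cell.
have : orbit ('P)%act P x = B.
  apply/eqP; rewrite eqEcard oP /=.
  rewrite -oY.
  pose Yx := ('C_Y[x | 'P])%G; pose Px := ('C_P[x | 'P])%G.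
  have eY : (#|orbit ('P)%act Y x| * #|Yx| = #|Y|)%N by apply: card_orbit_stab.
  have eP : (#|orbit ('P)%act P x| * #|Px| = #|P|)%N by apply: card_orbit_stab.
  have PxYx : Px \subset Yx by apply: setSI; apply: pHall_sub sylP.
  have pPx : p.-nat #|Px| by apply: pnat_dvd (cardSg (subsetIl _ _)) (pHall_pgroup sylP).
  have cPx : (#|Px| <= #|Yx|`_p)%N.
    by apply: dvdn_leq; rewrite ?part_gt0 // -(part_pnat_id pPx) partn_dvd // cardSg.
  have oYp : p.-nat #|orbit ('P)%act Y x|.
    by rewrite oY p_card_cell pnatX pnat_id.
  have := card_Hall sylP; rewrite -eY partnM ?cardG_gt0 //; last first.
    by rewrite oY; apply/card_gt0P; exists x; rewrite inE.
  rewrite (part_pnat_id oYp) => cP.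
  rewrite -(leq_pmul2r (cardG_gt0 Px)) eP cP; by rewrite leq_mul2l cPx orbT.
move/setP/(_ y); rewrite inE e eqxx => /orbitP[g gP <-].
by exists g.
Qed.

Lemma p_P_max (Q : {group 'S_n}) : P \subset Q -> p.-group Q ->
  (forall g x, g \in Q -> cell (g x) = cell x) -> Q \subset P.
Proof.
move=> PQ pQ hQ; have QY : Q \subset Y.
  by apply/subsetP => g gQ; apply/young_cell => x; apply: hQ.
by rewrite (sub_pHall sylP pQ PQ QY).
Qed.

End Sylow.

(** The columns of length [m] have indices from [nth 0 L m] to below [nth 0 L m.-1], so there are
    fewer than [p] of them; a point is then fixed by its column and its offset. *)
Lemma p_restricted_bound : (forall L, L \in ls -> p_restricted p L) ->
    (forall L, L \in ms -> p_restricted p L) ->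
  forall x0, #|[set x | [&& plev x == plev x0, ppar x == ppar x0, prow x == prow x0 &
      plen (column x) == plen (column x0)]]| < p ^ (plev x0).+1.
Proof.
move=> rls rms x0; set A := [set x | _].
set L := part (ppar x0) (plev x0); set m := plen (column x0).
have m0 : 0 < m by apply: leq_ltn_trans (p_row_lt_len x0).
have Lres : nth 0 L m.-1 - nth 0 L m < p.
  have h ss : (forall L, L \in ss -> p_restricted p L) -> forall i,
      nth 0 (nth [::] ss i) m.-1 - nth 0 (nth [::] ss i) m < p.
    move=> hs k; have [lt|le] := ltnP k (size ss); last by rewrite [nth [::] _ _]nth_default // nth_nil.
    by have := hs _ (mem_nth [::] lt) m.-1; rewrite prednK.
  rewrite /L /level_part; case: (ppar x0); last exact: h.
  by case: (plev x0) => [|i]; [rewrite !nth_nil | apply: h].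
set d := _ - _ in Lres.
have colA x : x \in A -> nth 0 L m <= pcol x < nth 0 L m.-1.
  rewrite inE => /and4P[/eqP e1 /eqP e2 _ /eqP e4].
  have e : m = collen L (pcol x) by rewrite /m -e4 /plen /= e1 e2.
  have sL : sorted geq L := part_sorted _ _.
  rewrite leqNgt -!(collenP _ _ sL) -e ltnn /=.
  by rewrite prednK.
have : size [seq (pcol x, poff x) | x <- enum A] <=
   size [seq (k, o) | k <- iota (nth 0 L m) d, o <- iota 0 (p ^ plev x0)].
  apply: uniq_leq_size.
    rewrite map_inj_in_uniq ?enum_uniq // => x y; rewrite !mem_enum !inE.
    move=> /and4P[/eqP e1 /eqP e2 /eqP e3 _] /and4P[/eqP e1' /eqP e2' /eqP e3' _] [e4 e5].
    by apply: p_line_row_inj; rewrite /line /column ?e3 ?e3' // e1 e1' e2 e2' e4 e5.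
  move=> q /mapP[x]; rewrite mem_enum => xA ->; apply/allpairsP; exists (pcol x, poff x).
  rewrite !mem_iota /= add0n; have [_ _ h] := pblock x; have /andP[h1 h2] := colA x xA.
  split=> //; first by rewrite h1 /d; lia.
  by move: xA; rewrite inE => /andP[/eqP <-].
rewrite size_map -cardE size_allpairs !size_iota => le; apply: leq_ltn_trans le _.
by rewrite expnS ltn_pmul2r // expn_gt0 p0.
Qed.

Lemma p_content : content (hw_coloring ppar prow) = wt n lam (pscale p mu).
Proof.
have usE := hw_coloringE ppar p_row_lt.
have key s a c : (forall x, (hw_coloring ppar prow x == c) = (ppar x == s) && (prow x == a)) ->
    content (hw_coloring ppar prow) c = \sum_(i < r.+1) p ^ i * nth 0 (part s i) a.
  move=> h; rewrite ffunE -sum_cells_row -card_pcell; apply: eq_card => x.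
  by rewrite !inE h.
apply/ffunP => c; rewrite [RHS]ffunE; have cc := ltn_ord c.
have [lc|lc] := ltnP c n.+1.
  rewrite (key false c) ?sum_part_false // => x; rewrite -val_eqE /= usE.
  by have := p_row_lt x; case: (ppar x); rewrite ?mul1n ?mul0n /=; lia.
have nthp (s : seq nat) k : nth 0 (pscale p s) k = p * nth 0 s k.
  by have [lt|le] := ltnP k (size s); [rewrite (nth_map 0) | rewrite !nth_default ?muln0 ?size_map].
rewrite (key true (c - n.+1)) ?sum_part_true ?nthp // => x; rewrite -val_eqE /= usE.
by have := p_row_lt x; case: (ppar x); rewrite ?mul1n ?mul0n /=; lia.
Qed.

Notation w := (wt n lam (pscale p mu)).

Lemma expansion_functional : exists (P : {group 'S_n}) (phi : 'M[F]_(dimT n) -> F),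
  [/\ P \in 'Syl_p(young n rho)%g, weight_functional w phi,
      forall (R : {group 'S_n}) f, #|R| < #|P| ->
        (forall g, g \in R -> Tmx F g *m f = f *m Tmx F g)%R ->
        phi (rel_trace R (Trep F n) f) = 0%R
    & (forall L, L \in ls -> p_restricted p L) -> (forall L, L \in ms -> p_restricted p L) ->
      exists E, [/\ forall g, g \in P -> (Tmx F g *m E = E *m Tmx F g)%R,
        in_corner w (rel_trace P (Trep F n) E) & phi (rel_trace P (Trep F n) E) <> 0%R]].
Proof.
have [P sylP] := Sylow_exists p Y.
have pP := pHall_pgroup sylP.
exists P, (@phi F n ppar plev prow pcol poff); split.
- by rewrite inE.
- rewrite -p_content.
  exact: (phi_weight_functional oddp charp p_line_row_inj p_row_lt_len p_line_row_surj
    p_row_lt p_card_cell p_par_lev pP (p_P_cell sylP) (p_P_trans sylP)).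
- move=> R f; exact: (phi_relative_trace oddp charp poff p_row_lt pP (p_P_cell sylP)).
- move=> rls rms; rewrite -p_content.
  exact: (relative_trace_exists oddp charp p_line_row_inj p_row_lt_len p_line_row_surj
    p_row_lt p_card_cell pP (p_P_cell sylP) (p_P_trans sylP) (p_restricted_bound rls rms)
    (p_P_max sylP)).
Qed.

End Expansion.

(** * Vertices and the theorem *)

Section Vertices.
Import GRing.Theory.
Local Open Scope ring_scope.
Variables (F : fieldType) (n : nat).
Notation T := (Trep F n).

(** [A] and [B] commute with the action and move inside the trace; so relative projectivity of a
    summand makes its idempotent a relative trace. *)
Lemma retract_rel_trace m (rY : mx_representation F (Sgroup n) m) A B (R : {group 'S_n}) psi :
    retract rY T A B ->
  \sum_(D in rcosets R (Sgroup n)) (rY (repr D)^-1%g *m psi *m rY (repr D)) = 1%:M ->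
  rel_trace R T (B *m psi *m A) = B *m A.
Proof.
case=> hA hB AB e; rewrite -[B in RHS]mulmx1 -e mulmx_sumr mulmx_suml.
apply: eq_bigr => D _; have Dg x : x \in Sgroup n by rewrite inE.
by rewrite !mulmxA (hB _ (Dg _)) -!mulmxA (hA _ (Dg _)).
Qed.

(** The relative trace of [E] induces a unit on [Y], and dividing by it inside the trace gives
    Higman's criterion. *)
Lemma label_rel_projective w phi (Y : fmod F n) (P : {group 'S_n}) E :
    (2%:R : F) != 0 -> weight_functional w phi -> label_module w phi (frepr Y) ->
    (forall g, g \in P -> Tmx F g *m E = E *m Tmx F g) ->
    in_corner w (rel_trace P T E) -> phi (rel_trace P T E) <> 0 ->
  rel_projective Y P.
Proof.
move=> two_neq0 wphi [iY [A [B [rt cE pE]]]] EP cX pX; have [hA hB AB] := rt.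
have u := functional_unit two_neq0 wphi iY rt cE pE cX pX.
pose U := A *m rel_trace P T E *m B.
have hU : intertwines (frepr Y) (frepr Y) U.
  by apply: intertwinesM hB; apply: intertwinesM hA _; case: cX.
have hV := intertwinesV hU; have UV : U *m invmx U = 1%:M by apply: mulmxV.
move: (invmx U) hV UV => V hV UV; have Dg x : x \in Sgroup n by rewrite inE.
exists (A *m E *m B *m V); split=> [g gP|].
  rewrite !mulmxA (hA _ (Dg _)) -[RHS]mulmxA -hV // !mulmxA; congr (_ *m _).
  by rewrite -(mulmxA A) [T g *m E]EP // -!mulmxA [T g *m B]hB.
rewrite -UV /U /rel_trace mulmx_sumr !mulmx_suml; apply: eq_bigr => D _.
by rewrite !mulmxA (hA _ (Dg _)) -!mulmxA -hV // (mulmxA B) -hB // !mulmxA.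
Qed.

End Vertices.

Theorem theorem1p1 (F : fieldType) (p : nat)
    (hp : prime p) (hodd : odd p) (hchar : p \in [pchar F]%R) (n : nat) :
  exists Y : seq nat -> seq nat -> fmod F n,
    (* each Y(lam|p mu) is indecomposable *)
    (forall lam mu, is_partition lam -> is_partition mu ->
       psize lam + p * psize mu = n ->
       indecomposable (Y lam mu))
    (* (i) *)
    /\ (forall al be, is_partition al -> is_partition be ->
          psize al + psize be = n ->
          exists (k : nat) (U : 'I_k -> 'M[F]_(fdim (signed_young_module F n al be)))
                 (modU : forall i, mxmodule (frepr (signed_young_module F n al be)) (U i))
                 (lab : 'I_k -> seq nat * seq nat),
            direct_decomp U /\
            forall i, [/\ is_partition (lab i).1, is_partition (lab i).2,
                          psize (lab i).1 + p * psize (lab i).2 = n,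
                          dominates2 (lab i).1 (pscale p (lab i).2) al be
                        & fmod_iso (summand (modU i)) (Y (lab i).1 (lab i).2)])
    (* (ii) *)
    /\ (forall lam mu, is_partition lam -> is_partition mu ->
          psize lam + p * psize mu = n ->
          multiplicity_one (signed_young_module F n lam (pscale p mu)) (Y lam mu))
    (* (iii) *)
    /\ (forall lam mu, is_partition lam -> is_partition mu ->
          psize lam + p * psize mu = n ->
          forall (r : nat) (ls ms : seq (seq nat)),
            size ls = r.+1 -> size ms = r ->
            (forall L, L \in ls -> is_partition L /\ p_restricted p L) ->
            (forall L, L \in ms -> is_partition L /\ p_restricted p L) ->
            (forall j, nth 0 lam j = \sum_(i < r.+1) p ^ i * nth 0 (nth [::] ls i) j)%N ->
            (forall j, nth 0 mu j = \sum_(i < r) p ^ i * nth 0 (nth [::] ms i) j)%N ->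
            exists2 P : {group 'S_n}, P \in ('Syl_p(young n (rho_of p r ls ms)))%g
                                   & is_vertex (Y lam mu) P).
Proof.
have two0 : (2%:R != 0 :> F)%R by apply: two_neq0 hodd hchar.
have pscale_part mu : is_partition mu -> is_partition (pscale p mu) /\ psize (pscale p mu) = p * psize mu.
  case/andP => s a; split; last first.
    by rewrite /psize /pscale; elim: mu {s a} => [|x mu IH] /=; rewrite ?muln0 // IH mulnDr.
  apply/andP; split.
    rewrite sorted_map; apply: sub_sorted s => x y /= h; exact: leq_mul.
  by apply/allP => _ /mapP[x xm ->]; rewrite muln_gt0 prime_gt0 //; apply: (allP a).
(* A module and its linear form are chosen together for each pair; outside [valid] the value is a
   dummy. *)
pose spec (lm : seq nat * seq nat) (yf : fmod F n * ('M[F]_(dimT n) -> F)) :=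
  valid n p lm.1 lm.2 -> weight_functional (wt n lm.1 (pscale p lm.2)) yf.2 /\
    label_module (wt n lm.1 (pscale p lm.2)) yf.2 (frepr yf.1).
have [f hf] : exists f, forall lm, spec lm (f lm).
  apply: functional_choice => -[lam mu].
  have [v|nv] := classic (valid n p lam mu); last first.
    by exists (FMod (Trep F n), fun _ => 0%R).
  have [pl pm s] := v.
  (* The trivial expansions with [lam] and [mu] as their terms of index 0 already give a linear
     form, which suffices to define [Y]; the p-adic ones enter in (iii). *)
  have [|||||||P [phi [_ wphi _ _]]] := @expansion_functional F n p 1 [:: lam; [::]] [:: mu] lam mu hodd hchar.
  - by [].
  - by [].
  - by move=> L; rewrite !inE => /orP[] /eqP ->.
  - by move=> L; rewrite !inE => /eqP ->.
  - by [].
  - by move=> j; rewrite !big_ord_recl big_ord0 /= nth_nil muln0 !addn0 mul1n.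
  - by move=> j; rewrite !big_ord_recl big_ord0 /= addn0 mul1n.
  have [pm' sm'] := pscale_part _ pm.
  have [|A [B [rt BA]]] := @signed_young_retract F n lam (pscale p mu) pl pm'; first by rewrite sm'.
  have [Y hY] := label_module_exists wphi rt BA.
  by exists (Y, phi).
pose Y lam mu := (f (lam, mu)).1; pose phi lam mu := (f (lam, mu)).2.
have wphi lam mu : valid n p lam mu -> weight_functional (wt n lam (pscale p mu)) (phi lam mu).
  by move=> /(hf (lam, mu))[].
have lY lam mu : valid n p lam mu -> label_module (wt n lam (pscale p mu)) (phi lam mu) (frepr (Y lam mu)).
  by move=> /(hf (lam, mu))[].
exists Y; split; [|split; [|split]].
- move=> lam mu pl pm s; apply: indec_indecomposable.
  by have [] := lY lam mu (And3 pl pm s).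
- move=> al be pal pbe s; pose M := signed_young_module F n al be.
  have [A [B [[hA hB AB] BA]]] := signed_young_retract F pal pbe s.
  have [k [U [modU [dU iU]]]] := indecomposable_decomposition M.
  have [C [D [rt _ _]]] := direct_decomp_retracts modU dU.
  have ex i : exists lm, [/\ valid n p lm.1 lm.2, domw (wt n lm.1 (pscale p lm.2)) (wt n al be)
      & mx_rsim (frepr (summand (modU i))) (frepr (Y lm.1 lm.2))].
    have [hC hD CD] := rt i.
    have iwt : in_weight (frepr (summand (modU i))) (wt n al be).
      exists (C i *m A)%R, (B *m D i)%R; split.
      - exact: intertwinesM hC hA.
      - exact: intertwinesM hB hD.
      - by rewrite -BA !mulmxA -(mulmxA _ A B) AB mulmx1 -(mulmxA _ A B) AB mulmx1.
    have [lam [mu h]] := indec_has_label two0 hchar wphi lY (indecomposable_indec (iU i)) iwt.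
    by exists (lam, mu).
  have [lab hlab] := functional_choice _ ex.
  exists k, U, modU, lab; split=> // i; have [[pl pm sz] d sim] := hlab i.
  have [pm' sm'] := pscale_part _ pm.
  have size_n s0 : is_partition s0 -> psize s0 <= n -> size s0 <= n.+1.
    by move=> ps0 le; apply/leqW/(leq_trans (size_partition ps0)).
  split=> //; apply: dom_dominates2 d; apply: size_n => //.
  - by rewrite -sz leq_addr.
  - by rewrite sm' -sz leq_addl.
  - by rewrite -s leq_addr.
  - by rewrite -s leq_addl.
- move=> lam mu pl pm s; have [pm' sm'] := pscale_part _ pm; have v := And3 pl pm s.
  have [|A [B [rt BA]]] := @signed_young_retract F n lam (pscale p mu) pl pm'; first by rewrite sm'.
  exact: (label_multiplicity_one two0 (wphi _ _ v) rt BA (lY _ _ v)).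
- move=> lam mu pl pm s r ls ms sls sms hls hms lamE muE; have v := And3 pl pm s.
  have pls L : L \in ls -> is_partition L by move=> /hls[].
  have pms L : L \in ms -> is_partition L by move=> /hms[].
  have [P [phi' [sylP wphi' low up]]] := expansion_functional hodd hchar sls sms pls pms v lamE muE.
  exists P => //.
  (* The label does not depend on the expansion: an idempotent killed by [phi'] would be higher,
     hence killed by the form that defines [Y] as well. *)
  have lY' : label_module (wt n lam (pscale p mu)) phi' (frepr (Y lam mu)).
    have [iY [A [B [rt cE pE]]]] := lY _ _ v; split=> //; exists A, B; split=> // p0; apply: pE.
    have [_ _ _ ker] := wphi _ _ v; apply: ker.
    exact: (functional_ker two0 wphi' cE p0).
  split.
    have [|L /hms[]|E [E1 E2 E3]] := up; [by move=> L /hls[] | by [] | ].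
    exact: (label_rel_projective two0 wphi' lY' E1 E2 E3).
  (* If [Y] were projective relative to [R], its idempotent would be a relative trace from a group
     smaller than [P], which [phi'] kills. *)
  move=> R RP [psi [psiR e]]; have [iY [A [B [rt cE pE]]]] := lY'.
  apply: pE; rewrite -(retract_rel_trace rt e); apply: low; first exact: proper_card.
  move=> g gR; have [hA hB _] := rt; have Sg : g \in Sgroup n by rewrite inE.
  by rewrite !mulmxA [(Tmx F g *m B)%R](hB _ Sg) -!mulmxA -[(A *m Tmx F g)%R](hA _ Sg) (mulmxA _ psi) psiR // !mulmxA.
Qed.
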